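(* Let $f\in L^{2}(\mathbb{R})$. Then $f$ satisfies, for every $\lambda>0$, $$|f(x)| \lesssim e^{-(\frac{1}{2}-\lambda)x^{2}} \ \ (x\in\mathbb{R})\qquad\text{and}\qquad |\widehat{f}(\xi)| \lesssim e^{-(\frac{1}{2}-\lambda)\xi^{2}}\ \ (\xi\in\mathbb{R})$$ if and only if its Hermite coefficients satisfy, for every $r>0$, $$|H(f,n)| \lesssim e^{-rn}\qquad (n\in\mathbb{N}).$$
   Context: $\mathbb{N}=\{0,1,2,\dots\}$. The Fourier transform is $\widehat{f}(\xi)=(2\pi)^{-1/2}\int_{-\infty}^{\infty} f(t)e^{-it\xi}\,dt$ (extended to $L^2(\mathbb{R})$ as usual). The Hermite functions are $$h_{n}(x)=(-1)^{n}\pi^{-1/4}(2^{n}n!)^{-1/2}e^{\frac12 x^{2}}\frac{d^{n}}{dx^{n}}\big[e^{-x^{2}}\big],\qquad n\in\mathbb{N};$$ they form an orthonormal basis of $L^2(\mathbb{R})$, and $H(f,n)=\langle f,h_n\rangle=\int_{-\infty}^{\infty} f(x)h_n(x)\,dx$. The notation $A\lesssim B$ means $A\le C B$ with a constant $C>0$ independent of the variable ($x$, $\xi$ or $n$), but possibly depending on $f$ and on the parameter ($\lambda$ or $r$). Pointwise bounds on $L^2$ functions are understood almost everywhere. *)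

(* Defs.v *)
From HB Require Import structures.
From mathcomp Require Import all_boot all_order all_algebra.
From mathcomp Require Import all_classical all_reals all_analysis.
From mathcomp Require Import complex.

Set Implicit Arguments.
Unset Strict Implicit.
Unset Printing Implicit Defensive.

Import Order.TTheory GRing.Theory Num.Theory.
Import numFieldNormedType.Exports.

Local Open Scope classical_set_scope.
Local Open Scope complex_scope.
Local Open Scope ring_scope.

Section Definitions.
Context (R : realType).
Local Notation mu := (@lebesgue_measure R).
Implicit Types (f g : R -> R[i]) (p : \bar R).

(* [Normc.normc] is the real-valued modulus on [R[i]]; [complex.Re] and [complex.Im]
   are the real-valued projections, not the ['Re] and ['Im] of ssrnum. *)

Definition cmeasurable f : Prop :=
  measurable_fun [set: R] (fun x => complex.Re (f x)) /\
  measurable_fun [set: R] (fun x => complex.Im (f x)).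

Definition cLnorm p f : \bar R :=
  Lnorm mu p (fun x => (Normc.normc (f x))%:E).

(* L^p(R; C), as functions rather than classes modulo a.e. equality. *)
Definition cLfun p f : Prop := cmeasurable f /\ (cLnorm p f < +oo)%E.

Definition cintegral f : R[i] :=
  (\int[mu]_x complex.Re (f x)) +i* (\int[mu]_x complex.Im (f x)).

(* The factor [cos - i sin] is e^{-it xi}. *)
Definition fourierL1 f (xi : R) : R[i] :=
  ((2 * pi) `^ (- 2^-1))%:C *
  cintegral (fun t => f t * (cos (t * xi) -i* sin (t * xi))).

(* Extension by continuity from the dense subspace L^1 `&` L^2 of L^2:
   [g] is the L^2 limit of the transforms of some sequence in L^1 `&` L^2
   that converges to [f] in L^2. *)
Definition is_fourierL2 f g : Prop :=
  cLfun 2%:E g /\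
  exists u : nat -> R -> R[i],
    [/\ forall k, cLfun 1%:E (u k) /\ cLfun 2%:E (u k),
        (fun k => cLnorm 2%:E (fun x => u k x - f x)) @ \oo --> 0%E &
        (fun k => cLnorm 2%:E (fun xi => fourierL1 (u k) xi - g xi))
          @ \oo --> 0%E].

(* For [f] in L^2 such a [g] exists and is unique up to a.e. equality
   (Plancherel); the operator selects a representative, and the default value
   0 is only used outside of L^2. *)
Definition fourier f : R -> R[i] :=
  xget (fun=> 0) [set g | is_fourierL2 f g].

Definition hermite_fun (n : nat) (x : R) : R :=
  (-1) ^+ n * pi `^ (- 4^-1) * ((2 ^ n * n`!)%N%:R) `^ (- 2^-1) *
  expR (2^-1 * x ^+ 2) * derive1n n (fun y : R => expR (- y ^+ 2)) x.

Definition hermite_coef f (n : nat) : R[i] :=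
  cintegral (fun x => f x * (hermite_fun n x)%:C).

Definition gaussian_bound (lambda : R) g : Prop :=
  exists2 C : R, 0 < C &
    {ae mu, forall x, Normc.normc (g x) <= C * expR (- (2^-1 - lambda) * x ^+ 2)}.

End Definitions.

(* Main.v *)
Require Import Defs.
From HB Require Import structures.
From mathcomp Require Import all_boot all_order all_algebra.
From mathcomp Require Import all_classical all_reals all_analysis.
From mathcomp Require Import measurable_realfun complex.
From mathcomp Require Import ring lra.
Import Order.TTheory GRing.Theory Num.Theory.
Import numFieldNormedType.Exports.
Local Open Scope ring_scope.

(** Write [F z] for the integral of [f] against [exp (2 x z - z^2 - x^2/2)]; its Taylor
    coefficients at 0 are the unnormalised Hermite coefficients of [f] divided by [n!], and
    passing to the Fourier transform replaces [F z] by [F (- i z)].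

    If the coefficients decay superexponentially, the bound
    [|h_n x| <= C K^n exp (- (1/2 - e) x^2)] (Cauchy's estimate for the generating function on
    the circle of radius [sqrt n]) makes the Hermite series converge to a function with the
    required decay; it equals [f] almost everywhere because [F] determines [f]. The same
    applies to the Fourier transform, whose coefficients have the same modulus.

    Conversely, the Gaussian mean of [F (s y)] in [y] is, up to a power of [1 + s^2], the
    integral of [f x * exp ((s^2 / (1 + s^2) - 1/2) x^2)]. The bounds on [f] make this an
    analytic function of [z = - s^2] near the whole half-plane [Re z <= 0], locally bounded
    with radius of convergence bounded below, and its Taylor coefficients at 0 are, up to
    harmless factors, the even coefficients of [f]. The Fourier transform changes the sign of
    every other such coefficient, so the same power series continues to the opposite
    half-plane as well, hence is entire. The odd coefficients are treated with [y F (s y)]. *)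

Set Implicit Arguments.
Unset Strict Implicit.
Unset Printing Implicit Defensive.

Local Open Scope classical_set_scope.
Local Open Scope complex_scope.
Local Open Scope ring_scope.

(** The Gaussian mean serves to change the normalisation. The Taylor coefficients of [F] carry
    [1 / n!], the Hermite coefficients essentially [1 / sqrt (n!)]. The Gaussian moment of order
    [2k] divided by [(2k)!] is [sqrt pi / (4^k k!)], which agrees with the Hermite normalisation up
    to exponential factors; so decay faster than every exponential amounts to the series in [s^2]
    being entire. With [w = 1 / (1 - z)] the exponent becomes [(1/2 - w) x^2], and the bounds on [f]
    for all [lambda] give convergence for [Re w > 0], that is for [Re z < 1]. This half-plane
    contains [Re z <= 0] with a margin, whence the uniform radius, and together with its mirror
    image, supplied by the Fourier transform, it covers the plane. The leftover power of [1 + s^2]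
    is half-integral; it is produced by a Gaussian integral in a second real variable, so that no
    branch of a square root has to be continued. Analytic functions occur only as absolutely
    convergent power series: continuation is recentring, and the one contour integral is the circle
    in Cauchy's estimate. *)

Notation nc := Normc.normc.
Notation cRe := complex.Re.
Notation cIm := complex.Im.

(** * Complex modulus and complex-valued integrals *)

Section complex_modulus.
Context {R : realType}.
Implicit Types (z w : R[i]) (x y : R).

Lemma cReD z w : cRe (z + w) = cRe z + cRe w. Proof. by case: z; case: w. Qed.
Lemma cImD z w : cIm (z + w) = cIm z + cIm w. Proof. by case: z; case: w. Qed.
Lemma cReN z : cRe (- z) = - cRe z. Proof. by case: z. Qed.
Lemma cImN z : cIm (- z) = - cIm z. Proof. by case: z. Qed.
Lemma cReM z w : cRe (z * w) = cRe z * cRe w - cIm z * cIm w.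
Proof. by case: z; case: w. Qed.
Lemma cImM z w : cIm (z * w) = cRe z * cIm w + cIm z * cRe w.
Proof. by case: z; case: w. Qed.

Lemma complex_eqP z w : cRe z = cRe w -> cIm z = cIm w -> z = w.
Proof. by case: z => a b; case: w => c d /= -> ->. Qed.

Lemma nc_ge0 z : 0 <= nc z. Proof. by case: z => a b; exact: sqrtr_ge0. Qed.

Lemma ncR x : nc x%:C = `|x|.
Proof. by rewrite /= expr0n /= addr0 sqrtr_sqr. Qed.

Lemma nc0 : nc 0 = 0 :> R. Proof. exact: Normc.normc0. Qed.

Lemma nc1 : nc 1 = 1 :> R. Proof. exact: Normc.normc1. Qed.

Lemma ncX z n : nc (z ^+ n) = nc z ^+ n.
Proof. by elim: n => [|n IH]; rewrite ?nc1// !exprS Normc.normcM IH. Qed.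

Lemma ncD z w : nc (z + w) <= nc z + nc w. Proof. exact: le_normcD. Qed.

Lemma ncN z : nc (- z) = nc z. Proof. exact: normcN. Qed.

Lemma ncB z w : nc (z - w) <= nc z + nc w.
Proof. by rewrite -(ncN w) ncD. Qed.

Lemma nc_sqr z : nc z ^+ 2 = cRe z ^+ 2 + cIm z ^+ 2.
Proof. by case: z => a b /=; rewrite sqr_sqrtr// addr_ge0// sqr_ge0. Qed.

Lemma Re_le_nc z : `|cRe z| <= nc z.
Proof.
by case: z => a b /=; rewrite -sqrtr_sqr ler_sqrt ?lerDl ?sqr_ge0// addr_ge0 ?sqr_ge0.
Qed.

Lemma Im_le_nc z : `|cIm z| <= nc z.
Proof.
by case: z => a b /=; rewrite -sqrtr_sqr ler_sqrt ?lerDr ?sqr_ge0// addr_ge0 ?sqr_ge0.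
Qed.

Lemma nc_le_ReIm z : nc z <= `|cRe z| + `|cIm z|.
Proof.
rewrite -(@ler_pXn2r _ 2)// ?nnegrE ?nc_ge0 ?addr_ge0//.
rewrite nc_sqr sqrrD !real_normK ?num_real// lerD2r.
by rewrite lerDl mulrn_wge0// mulr_ge0.
Qed.

Lemma nc_eq0 z : (nc z == 0) = (z == 0).
Proof.
by apply/eqP/eqP => [/Normc.eq0_normc//|->]; exact: nc0.
Qed.

Lemma nc_gt0 z : (0 < nc z) = (z != 0).
Proof. by rewrite lt_def nc_ge0 andbT nc_eq0. Qed.

Lemma nc_conj z : nc (conjc z) = nc z.
Proof. by case: z => a b /=; rewrite sqrrN. Qed.

Lemma mulc_conj z : z * conjc z = (nc z ^+ 2)%:C.
Proof.
by case: z => a b; apply: complex_eqP => /=; rewrite ?sqr_sqrtr; try ring;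
  rewrite addr_ge0// sqr_ge0.
Qed.

Lemma nc_nat n : nc n%:R = n%:R :> R.
Proof. by rewrite -[n%:R](@rmorph_nat _ _ (real_complex R)) ncR ger0_norm. Qed.

End complex_modulus.

Section complex_integral.
Context d (T : measurableType d) {R : realType}.
Variable mu : {measure set T -> \bar R}.
Implicit Types (f g : T -> R[i]) (h : T -> R).

Definition cmeas f :=
  measurable_fun setT (fun x => cRe (f x)) /\
  measurable_fun setT (fun x => cIm (f x)).

(** Convertible to [cintegral] when [mu] is Lebesgue measure, which lets the lemmas below apply to
    [hermite_coef] and [fourierL1] as they stand. The measure is general because counting measure
    and product measures are also used. *)
Definition cint f : R[i] := (\int[mu]_x cRe (f x)) +i* (\int[mu]_x cIm (f x)).

Definition cintegrable f :=
  cmeas f /\ mu.-integrable setT (fun x => (nc (f x))%:E).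

Lemma integrable_dom h h' : measurable_fun setT h ->
  mu.-integrable setT (EFin \o h') -> (forall x, `|h x| <= h' x) ->
  mu.-integrable setT (EFin \o h).
Proof.
move=> mh ih hh; apply: le_integrable ih => //; first exact/measurable_EFinP.
by move=> x _ /=; rewrite lee_fin; apply: le_trans (hh x) _; exact: ler_norm.
Qed.

Lemma integrable_scale k h : mu.-integrable setT (EFin \o h) ->
  mu.-integrable setT (EFin \o (fun x => k * h x)).
Proof. by move=> /(integrableZl measurableT k). Qed.

Lemma cmeas_cst (c : R[i]) : cmeas (fun=> c).
Proof. by split; exact: measurable_cst. Qed.

Lemma cmeas_real h : measurable_fun setT h -> cmeas (fun x => (h x)%:C).
Proof. by move=> mh; split => //=; exact: measurable_cst. Qed.

Lemma cmeasD f g : cmeas f -> cmeas g -> cmeas (fun x => f x + g x).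
Proof.
move=> [f1 f2] [g1 g2]; split.
- by under eq_fun do rewrite cReD; exact: measurable_funD.
- by under eq_fun do rewrite cImD; exact: measurable_funD.
Qed.

Lemma cmeasN f : cmeas f -> cmeas (fun x => - f x).
Proof.
move=> [f1 f2]; split.
- by under eq_fun do rewrite cReN; exact: measurable_funN.
- by under eq_fun do rewrite cImN; exact: measurable_funN.
Qed.

Lemma cmeasB f g : cmeas f -> cmeas g -> cmeas (fun x => f x - g x).
Proof. by move=> mf mg; apply: cmeasD => //; exact: cmeasN. Qed.

Lemma cmeasM f g : cmeas f -> cmeas g -> cmeas (fun x => f x * g x).
Proof.
move=> [f1 f2] [g1 g2]; split.
- under eq_fun do rewrite cReM; apply: measurable_funB; exact: measurable_funM.
- under eq_fun do rewrite cImM; apply: measurable_funD; exact: measurable_funM.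
Qed.

Lemma cmeas_conj f : cmeas f -> cmeas (fun x => conjc (f x)).
Proof.
move=> [f1 f2]; split.
- by apply: eq_measurable_fun f1 => x _; case: (f x).
- have := measurable_funN f2.
  by apply: eq_measurable_fun => x _ /=; case: (f x).
Qed.

Lemma cmeasX f n : cmeas f -> cmeas (fun x => f x ^+ n).
Proof.
move=> mf; elim: n => [|n IH]; first by under eq_fun do rewrite expr0; exact: cmeas_cst.
by under eq_fun do rewrite exprS; exact: cmeasM.
Qed.

Lemma measurable_nc f : cmeas f -> measurable_fun setT (fun x => nc (f x)).
Proof.
move=> [f1 f2].
have -> : (fun x => nc (f x)) = (fun x => Num.sqrt (cRe (f x) ^+ 2 + cIm (f x) ^+ 2)).
  by apply/funext => x; case: (f x).
apply: (measurableT_comp (continuous_measurable_fun (@sqrt_continuous R))).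
by apply: measurable_funD; apply: measurable_funX.
Qed.

Lemma integrable_cintegrable f h : cmeas f ->
  mu.-integrable setT (EFin \o h) -> (forall x, nc (f x) <= h x) -> cintegrable f.
Proof.
move=> mf ih fh; split=> //; apply: le_integrable ih => //.
  exact/measurable_EFinP/measurable_nc.
move=> x _; rewrite /= lee_fin (ger0_norm (nc_ge0 _)).
by apply: le_trans (fh x) _; exact: ler_norm.
Qed.

Lemma cintegrable_le f g : cmeas f -> cintegrable g ->
  (forall x, nc (f x) <= nc (g x)) -> cintegrable f.
Proof. by move=> mf [_ ig]; exact: integrable_cintegrable. Qed.

Lemma cintegrable_Re f : cintegrable f -> mu.-integrable setT (fun x => (cRe (f x))%:E).
Proof.
move=> [[f1 f2] i]; apply: le_integrable i => //; first exact/measurable_EFinP.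
by move=> x _ /=; rewrite lee_fin (ger0_norm (nc_ge0 _)) Re_le_nc.
Qed.

Lemma cintegrable_Im f : cintegrable f -> mu.-integrable setT (fun x => (cIm (f x))%:E).
Proof.
move=> [[f1 f2] i]; apply: le_integrable i => //; first exact/measurable_EFinP.
by move=> x _ /=; rewrite lee_fin (ger0_norm (nc_ge0 _)) Im_le_nc.
Qed.

Lemma cintegrableZ (c : R[i]) f : cintegrable f -> cintegrable (fun x => c * f x).
Proof.
move=> [mf jf].
apply: (@integrable_cintegrable _ (fun x => nc c * nc (f x))).
- by apply: cmeasM => //; exact: cmeas_cst.
- by have := integrableZl measurableT (nc c) jf.
- by move=> x; rewrite Normc.normcM.
Qed.

Lemma cintegrableN f : cintegrable f -> cintegrable (fun x => - f x).
Proof.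
by move=> /(cintegrableZ (-1)); under eq_fun do rewrite mulN1r.
Qed.

Lemma eq_cint f g : (forall x, f x = g x) -> cint f = cint g.
Proof. by move=> /funext ->. Qed.

Lemma cintD f g : cintegrable f -> cintegrable g ->
  cint (fun x => f x + g x) = cint f + cint g.
Proof.
move=> jf jg; apply: complex_eqP; rewrite ?cReD ?cImD /=.
- rewrite -RintegralD//; [|exact: cintegrable_Re|exact: cintegrable_Re].
  by apply: eq_Rintegral => x _; rewrite cReD.
- rewrite -RintegralD//; [|exact: cintegrable_Im|exact: cintegrable_Im].
  by apply: eq_Rintegral => x _; rewrite cImD.
Qed.

Lemma cintZ (c : R[i]) f : cintegrable f ->
  cint (fun x => c * f x) = c * cint f.
Proof.
move=> jf; have jr := cintegrable_Re jf; have ji := cintegrable_Im jf.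
have Z h (k : R) : mu.-integrable setT (EFin \o h) ->
  mu.-integrable setT (EFin \o (fun x => k * h x)).
  by move=> /(integrableZl measurableT k).
apply: complex_eqP; rewrite ?cReM ?cImM /=.
- rewrite -!RintegralZl// -RintegralB//; [|exact: Z|exact: Z].
  by apply: eq_Rintegral => x _; rewrite cReM.
- rewrite -!RintegralZl// -RintegralD//; [|exact: Z|exact: Z].
  by apply: eq_Rintegral => x _; rewrite cImM.
Qed.

Lemma cintN f : cintegrable f -> cint (fun x => - f x) = - cint f.
Proof.
by move=> jf; rewrite -mulN1r -cintZ//; apply: eq_cint => x; rewrite mulN1r.
Qed.

Lemma cintB f g : cintegrable f -> cintegrable g ->
  cint (fun x => f x - g x) = cint f - cint g.
Proof. by move=> jf jg; rewrite cintD ?cintN//; exact: cintegrableN. Qed.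

Lemma cint_real h : cint (fun x => (h x)%:C) = (\int[mu]_x h x)%:C.
Proof. by apply: complex_eqP => //=; rewrite Rintegral_cst// mul0r. Qed.

Lemma cint0 : cint (fun=> 0) = 0.
Proof. by rewrite (cint_real (fun=> 0)) Rintegral_cst// mul0r. Qed.

(** Rotating by the phase of the integral makes it real and nonnegative; its modulus is then the
    integral of a real part, which the modulus of the integrand dominates. *)
Lemma nc_cint f : cintegrable f -> nc (cint f) <= \int[mu]_x nc (f x).
Proof.
move=> jf; set I := cint f.
have [I0|I0] := eqVneq I 0; first by rewrite I0 nc0 Rintegral_ge0// => x _; exact: nc_ge0.
have nI0 : nc I != 0 by rewrite nc_eq0.
pose c := conjc I * ((nc I)^-1)%:C.
have cI : c * I = (nc I)%:C.
  rewrite /c mulrAC (mulrC _ I) mulc_conj -rmorphM/= expr2 -mulrA divff// mulr1//.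
have nc_c : nc c = 1.
  by rewrite /c Normc.normcM nc_conj ncR ger0_norm ?invr_ge0 ?nc_ge0// divff.
have -> : nc I = cRe (cint (fun x => c * f x)) by rewrite cintZ// cI.
rewrite /= le_Rintegral//.
- exact/cintegrable_Re/cintegrableZ.
- by case: jf.
- move=> x _; apply: le_trans (ler_norm _) _; apply: le_trans (Re_le_nc _) _.
  by rewrite Normc.normcM nc_c mul1r.
Qed.

Lemma nc_cint_le f h : cmeas f -> mu.-integrable setT (EFin \o h) ->
  (forall x, nc (f x) <= h x) -> nc (cint f) <= \int[mu]_x h x.
Proof.
move=> mf ih fh; apply: le_trans (nc_cint (integrable_cintegrable mf ih fh)) _.
rewrite le_Rintegral//.
by have [] := integrable_cintegrable mf ih fh.
Qed.

Lemma cint_conj f : cintegrable f -> cint (fun x => conjc (f x)) = conjc (cint f).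
Proof.
move=> jf; apply: complex_eqP => /=.
- by apply: eq_Rintegral => x _; case: (f x).
- rewrite -mulN1r -RintegralZl//; last exact: cintegrable_Im.
  by apply: eq_Rintegral => x _; rewrite mulN1r; case: (f x).
Qed.

End complex_integral.

Section complex_fubini.
Context d1 d2 (T1 : measurableType d1) (T2 : measurableType d2) {R : realType}.
Variable m1 : {sigma_finite_measure set T1 -> \bar R}.
Variable m2 : {sigma_finite_measure set T2 -> \bar R}.
Local Open Scope ereal_scope.

Lemma Rintegral_swap (F : T1 * T2 -> R) :
  (m1 \x m2).-integrable setT (EFin \o F) ->
  (\int[m1]_x \int[m2]_y F (x, y) = \int[m2]_y \int[m1]_x F (x, y))%R.
Proof.
move=> iF; rewrite /Rintegral.
(* [fine] changes the inner integral only at those [x] whose section is not integrable, and these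
   form a null set. *)
have E1 : \int[m1]_x (fine (\int[m2]_y (F (x, y))%:E))%:E
          = \int[m1]_x \int[m2]_y (F (x, y))%:E.
  apply: ae_eq_integral => //.
  - apply/measurable_EFinP; apply: measurableT_comp => //.
    exact: (measurable_fubini_F iF).
  - exact: (measurable_fubini_F iF).
  - have := ae_integrable1 iF.
    by apply: filterS => x h _; rewrite fineK//; exact: integrable_fin_num.
have E2 : \int[m2]_y (fine (\int[m1]_x (F (x, y))%:E))%:E
          = \int[m2]_y \int[m1]_x (F (x, y))%:E.
  apply: ae_eq_integral => //.
  - apply/measurable_EFinP; apply: measurableT_comp => //.
    exact: (measurable_fubini_G iF).
  - exact: (measurable_fubini_G iF).
  - have := ae_integrable2 iF.
    by apply: filterS => x h _; rewrite fineK//; exact: integrable_fin_num.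
by rewrite E1 E2; congr fine; exact: (Fubini iF).
Qed.

Lemma cint_swap (F : T1 -> T2 -> R[i]) :
  cintegrable (m1 \x m2) (fun z => F z.1 z.2) ->
  cint m1 (fun x => cint m2 (F x)) = cint m2 (fun y => cint m1 (F ^~ y)).
Proof.
move=> jF; congr (_ +i* _)%C.
- exact: (Rintegral_swap (cintegrable_Re jF)).
- exact: (Rintegral_swap (cintegrable_Im jF)).
Qed.

Lemma cintegrable_prod (F : T1 -> T2 -> R[i]) :
  cmeas (fun z : T1 * T2 => F z.1 z.2) ->
  \int[m1]_x \int[m2]_y (nc (F x y))%:E < +oo ->
  cintegrable (m1 \x m2) (fun z => F z.1 z.2).
Proof.
move=> mF foo; split => //; apply/integrable12ltyP.
  exact/measurable_EFinP/measurable_nc.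
under eq_integral => x _ do under eq_integral => y _ do rewrite /= ger0_norm ?nc_ge0//.
exact: foo.
Qed.

Lemma cmeas_cint (F : T1 -> T2 -> R[i]) :
  cintegrable (m1 \x m2) (fun z => F z.1 z.2) ->
  cmeas (fun x => cint m2 (F x)).
Proof.
move=> jF; split => /=; apply: measurableT_comp => //.
- exact: (measurable_fubini_F (cintegrable_Re jF)).
- exact: (measurable_fubini_F (cintegrable_Im jF)).
Qed.

Lemma cintegrable_fubini_F (F : T1 -> T2 -> R[i]) :
  cintegrable (m1 \x m2) (fun z => F z.1 z.2) ->
  cintegrable m1 (fun x => cint m2 (F x)).
Proof.
move=> jF; have [mr mi] := cmeas_cint jF.
have iR := integrable_fubini_F (cintegrable_Re jF).
have iI := integrable_fubini_F (cintegrable_Im jF).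
have fine_int (g : T1 -> \bar R) : m1.-integrable setT g ->
    m1.-integrable setT (fun x => (`|fine (g x)|%R)%:E).
  move=> ig; have mg := measurable_int m1 ig.
  apply: le_integrable ig => //.
    by apply/measurable_EFinP; apply: measurableT_comp => //; exact: measurableT_comp.
  by move=> x _; case: (g x) => [r| |] /=; rewrite ?normr_id ?normr0 ?leey.
apply: (@integrable_cintegrable _ _ _ _ _
  (fun x => (`|cRe (cint m2 (F x))| + `|cIm (cint m2 (F x))|)%R)).
- exact: cmeas_cint.
- by have := integrableD measurableT (fine_int _ iR) (fine_int _ iI).
- by move=> x; exact: nc_le_ReIm.
Qed.

End complex_fubini.

Section complex_fubini_swap.
Context d1 d2 (T1 : measurableType d1) (T2 : measurableType d2) {R : realType}.
Variable m1 : {sigma_finite_measure set T1 -> \bar R}.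
Variable m2 : {sigma_finite_measure set T2 -> \bar R}.
Local Open Scope ereal_scope.

Lemma cintegrable_prodC (F : T1 -> T2 -> R[i]) :
  cintegrable (m1 \x m2) (fun z => F z.1 z.2) ->
  cintegrable (m2 \x m1) (fun z => F z.2 z.1).
Proof.
move=> [[f1 f2] iF].
have mF : cmeas (fun z : T2 * T1 => F z.2 z.1).
  by split; [exact: (measurableT_comp f1 (@measurable_swap _ _ T2 T1))
            |exact: (measurableT_comp f2 (@measurable_swap _ _ T2 T1))].
apply: (@cintegrable_prod _ _ _ _ _ _ _ (fun y x => F x y)) => //.
have /integrable21ltyP := iF.
move=> /(_ (measurable_int _ iF)).
under eq_integral => x _ do under eq_integral => y _ do rewrite /= ger0_norm ?nc_ge0//.
by [].
Qed.

Lemma cintegrable_fubini_G (F : T1 -> T2 -> R[i]) :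
  cintegrable (m1 \x m2) (fun z => F z.1 z.2) ->
  cintegrable m2 (fun y => cint m1 (F ^~ y)).
Proof. by move=> /cintegrable_prodC/(@cintegrable_fubini_F _ _ _ _ _ _ _ (fun y x => F x y)). Qed.

Lemma cmeas_cint' (F : T1 -> T2 -> R[i]) :
  cintegrable (m1 \x m2) (fun z => F z.1 z.2) ->
  cmeas (fun y => cint m1 (F ^~ y)).
Proof. by move=> /cintegrable_prodC/(@cmeas_cint _ _ _ _ _ _ _ (fun y x => F x y)). Qed.

End complex_fubini_swap.

Section product_domination.
Context d1 d2 (T1 : measurableType d1) (T2 : measurableType d2) {R : realType}.
Variable m1 : {sigma_finite_measure set T1 -> \bar R}.
Variable m2 : {sigma_finite_measure set T2 -> \bar R}.

(** Tonelli's criterion with explicit majorants, [G] for the integrand and [H] for its inner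
    integral; exchanges of sums and integrals below are justified in this form. *)
Lemma cintegrable_prod_dom (F : T1 -> T2 -> R[i]) (G : T1 -> T2 -> R) (H : T1 -> R) :
  cmeas (fun z : T1 * T2 => F z.1 z.2) ->
  (forall x y, nc (F x y) <= G x y) ->
  (forall x, m2.-integrable setT (EFin \o G x)) ->
  (forall x, \int[m2]_y G x y <= H x) ->
  m1.-integrable setT (EFin \o H) ->
  cintegrable (m1 \x m2)%E (fun z => F z.1 z.2).
Proof.
move=> mF FG iG GH iH; apply: cintegrable_prod => //.
have iF x : m2.-integrable setT (fun y => (nc (F x y))%:E).
  have mFx : cmeas (F x).
    by case: mF => mF1 mF2; split;
      [exact: (measurableT_comp mF1 (pair1_measurable x))
      |exact: (measurableT_comp mF2 (pair1_measurable x))].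
  by have [] := integrable_cintegrable mFx (iG x) (FG x).
have mE : measurable_fun setT (fun z : T1 * T2 => (nc (F z.1 z.2))%:E).
  exact/measurable_EFinP/measurable_nc.
apply: (@le_lt_trans _ _ (\int[m1]_x (H x)%:E)%E); last first.
  have /integrableP[mH fH] := iH; apply: le_lt_trans fH.
  by apply: le_trans (le_abse_integral _ _ _) => //; rewrite lee_abs.
apply: ge0_le_integral => //.
- by move=> x _; apply: integral_ge0 => y _; rewrite lee_fin nc_ge0.
- apply: (@measurable_fun_fubini_tonelli_F _ _ _ _ _ m2 (fun z => (nc (F z.1 z.2))%:E)) => //.
  by move=> z; rewrite lee_fin nc_ge0.
- exact: (measurable_int m1 iH).
- move=> x _. rewrite -(fineK (integrable_fin_num _ (iF x)))// lee_fin.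
  apply: le_trans (GH x); rewrite -[leLHS]/(\int[m2]_y nc (F x y)).
  by apply: le_Rintegral; [|exact: iF|exact: iG|move=> y _; exact: FG].
Qed.

End product_domination.

Section counting_measurability.
Context {R : realType}.

Lemma measurable_fun_nat d (T : measurableType d) (f : nat -> T) : measurable_fun setT f.
Proof. by []. Qed.

Lemma measurable_fun_natX d (T : measurableType d) (F : nat -> T -> R) :
  (forall n, measurable_fun setT (F n)) ->
  measurable_fun setT (fun z : nat * T => F z.1 z.2).
Proof.
move=> mF _ Y mY; rewrite setTI.
have -> : (fun z : nat * T => F z.1 z.2) @^-1` Y =
    \bigcup_n ([set n] `*` (F n @^-1` Y)).
  apply/seteqP; split => [[n t] /= h|[n t] [k _ [/= -> h]]//].
  by exists n => //; split.
apply: bigcupT_measurable => n; apply: measurableX => //.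
by rewrite -[X in measurable X]setTI; exact: mF.
Qed.

Lemma cmeas_nat (a : nat -> R[i]) : cmeas a.
Proof. by split; exact: measurable_fun_nat. Qed.

Lemma cmeas_natX d (T : measurableType d) (F : nat -> T -> R[i]) :
  (forall n, cmeas (F n)) -> cmeas (fun z : nat * T => F z.1 z.2).
Proof.
move=> mF; split.
- by apply: (@measurable_fun_natX _ _ (fun n t => cRe (F n t))) => n; case: (mF n).
- by apply: (@measurable_fun_natX _ _ (fun n t => cIm (F n t))) => n; case: (mF n).
Qed.

End counting_measurability.

HB.instance Definition _ (R : realType) :=
  @Measure_isSigmaFinite.Build _ nat R (@counting nat R) (sigma_finite_counting R).

(** * Series and power series *)

Section sums.
Context {R : realType}.
Implicit Types (a b : nat -> R[i]) (u v : nat -> R).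

Local Notation cnt := (@counting nat R).

(* Series are integrals for the counting measure, so that exchanges of sums and
   integrals are all instances of Fubini's theorem. *)
Definition rsummable u := cnt.-integrable setT (EFin \o u).
Definition rsum u : R := \int[cnt]_k u k.
Definition csummable a := cintegrable cnt a.
Definition csum a : R[i] := cint cnt a.

Lemma ge0_rsummable u l : (forall k, 0 <= u k) -> series u @ \oo --> l ->
  rsummable u /\ rsum u = l.
Proof.
move=> u0 ul.
have E : (\int[cnt]_k (u k)%:E = l%:E)%E.
  rewrite ge0_integral_count; last by move=> k; rewrite lee_fin.
  apply/cvg_lim => //; apply: cvg_EFin.
    by apply: nearW => n; apply/sum_fin_numP.
  by apply: cvg_trans ul; apply: near_eq_cvg; apply: nearW => n /=;
    rewrite sumEFin.
split; last by rewrite /rsum /Rintegral E.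
apply/integrableP; split => //.
by under eq_integral do rewrite /= ger0_norm//; rewrite E ltry.
Qed.

Lemma ge0_rsum_cvg u : (forall k, 0 <= u k) -> rsummable u -> series u @ \oo --> rsum u.
Proof.
move=> u0 su.
have fu : (\int[cnt]_k (u k)%:E \is a fin_num)%E by exact: integrable_fin_num.
have : (\sum_(0 <= k < n) (u k)%:E)%E @[n --> \oo] --> (\int[cnt]_k (u k)%:E)%E.
  rewrite ge0_integral_count; last by move=> k; rewrite lee_fin.
  by apply: is_cvg_nneseries => k _ _; rewrite lee_fin.
rewrite -(fineK fu) => /fine_cvgP[_]; apply: cvg_trans.
by apply: near_eq_cvg; apply: nearW => n /=; rewrite sumEFin.
Qed.

Lemma rsummable_le u v : rsummable v -> (forall k, `|u k| <= v k) -> rsummable u.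
Proof.
move=> sv uv; apply: le_integrable sv => //.
by move=> k _ /=; rewrite lee_fin; apply: le_trans (uv k) _; exact: ler_norm.
Qed.

Lemma rsummableD u v : rsummable u -> rsummable v -> rsummable (fun k => u k + v k).
Proof. by move=> su sv; have := integrableD measurableT su sv. Qed.

Lemma rsummableZ c u : rsummable u -> rsummable (fun k => c * u k).
Proof. by move=> su; have := integrableZl measurableT c su. Qed.

Lemma rsum_cvg u : rsummable u -> series u @ \oo --> rsum u.
Proof.
move=> su; have sa : rsummable (fun k => `|u k|) by exact: integrable_norm su.
have sd : rsummable (fun k => `|u k| + u k) by exact: rsummableD.
have := cvgB (ge0_rsum_cvg _ sd) (ge0_rsum_cvg _ sa).
have -> : rsum (fun k => `|u k| + u k) - rsum (fun k => `|u k|) = rsum u.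
  by rewrite /rsum RintegralD//; ring.
have -> : series (fun k => `|u k| + u k) - series (fun k => `|u k|) = series u.
  apply/funext => n.
  change (\sum_(0 <= k < n) (`|u k| + u k) - \sum_(0 <= k < n) `|u k| = \sum_(0 <= k < n) u k).
  by rewrite -sumrB; apply: eq_bigr => k _; ring.
by apply=> k //; rewrite -lerBlDr sub0r -normrN ler_norm.
Qed.

Lemma rsumE u l : rsummable u -> series u @ \oo --> l -> rsum u = l.
Proof. by move=> /rsum_cvg h hl; exact: (cvg_unique (@Rhausdorff R) h hl). Qed.

Lemma rsum_peel u : rsummable u ->
  rsummable (fun k => u k.+1) /\ rsum u = u 0%N + rsum (fun k => u k.+1).
Proof.
move=> su; have sS : rsummable (fun k => u k.+1).
  have /ge0_rsum_cvg : rsummable (fun k => `|u k|) by exact: integrable_norm su.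
  move=> /(_ (fun k => normr_ge0 _)) h.
  have h' : series (fun k => `|u k.+1|) @ \oo --> rsum (fun k => `|u k|) - `|u 0%N|.
    have -> : series (fun k => `|u k.+1|) =
      (fun n => series (fun k => `|u k|) n.+1 - `|u 0%N|).
      by apply/funext => n; rewrite /series /= big_nat_recl// addrC addKr.
    apply: cvgB; last exact: cvg_cst.
    by rewrite -(cvg_shiftS (series (fun k => `|u k|))) in h.
  have [sn _] := ge0_rsummable (fun k => normr_ge0 (u k.+1)) h'.
  by apply: rsummable_le sn _.
split => //; apply: rsumE => //.
rewrite -cvg_shiftS.
have -> : (fun n => series u n.+1) = (fun n => u 0%N + series (fun k => u k.+1) n).
  by apply/funext => n; rewrite /series /= big_nat_recl.
by apply: cvgD; [exact: cvg_cst|exact: rsum_cvg].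
Qed.

Lemma csummable_le a u : rsummable u -> (forall k, nc (a k) <= u k) -> csummable a.
Proof. by move=> su au; exact: integrable_cintegrable (cmeas_nat a) su au. Qed.

Lemma csummable_nc a : csummable a -> rsummable (fun k => nc (a k)).
Proof. by case. Qed.

Lemma csum_peel a : csummable a ->
  csummable (fun k => a k.+1) /\ csum a = a 0%N + csum (fun k => a k.+1).
Proof.
move=> sa; have [sr er] := rsum_peel (cintegrable_Re sa).
have [si ei] := rsum_peel (cintegrable_Im sa).
split; last by apply: complex_eqP; rewrite ?cReD ?cImD; [exact: er|exact: ei].
by have [sn _] := rsum_peel (csummable_nc sa); apply: csummable_le sn _.
Qed.

Lemma rsum_geom x : 0 <= x -> x < 1 ->
  rsummable (fun k => x ^+ k) /\ rsum (fun k => x ^+ k) = (1 - x)^-1.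
Proof.
move=> x0 x1; apply: ge0_rsummable; first by move=> k; exact: exprn_ge0.
have := @cvg_geometric_series R 1 x; rewrite ger0_norm// mul1r => /(_ x1).
suff -> : geometric 1 x = (fun k => x ^+ k) by [].
by apply/funext => n; rewrite /geometric /= mul1r.
Qed.

Lemma rsum_exp x : 0 <= x ->
  rsummable (fun k => x ^+ k / k`!%:R) /\ rsum (fun k => x ^+ k / k`!%:R) = expR x.
Proof.
move=> x0; apply: ge0_rsummable => [k|]; first by rewrite divr_ge0// exprn_ge0.
exact: is_cvg_series_exp_coeff.
Qed.

Lemma le_rsum u v : rsummable u -> rsummable v -> (forall k, u k <= v k) ->
  rsum u <= rsum v.
Proof. by move=> su sv uv; apply: le_Rintegral. Qed.

Lemma term_le_rsum u n : (forall k, 0 <= u k) -> rsummable u -> u n <= rsum u.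
Proof.
elim: n u => [|n IH] u u0 su; have [sS ->] := rsum_peel su.
  by rewrite lerDl; apply: Rintegral_ge0.
by apply: (le_trans (IH _ (fun k => u0 k.+1) sS)); rewrite lerDr.
Qed.

Lemma nc_csum a u : rsummable u -> (forall k, nc (a k) <= u k) -> nc (csum a) <= rsum u.
Proof. by move=> su au; exact: nc_cint_le (cmeas_nat a) su au. Qed.

Lemma csum_swap (F : nat -> nat -> R[i]) (G : nat -> nat -> R) (H : nat -> R) :
  (forall i j, nc (F i j) <= G i j) -> (forall i, rsummable (G i)) ->
  (forall i, rsum (G i) <= H i) -> rsummable H ->
  csum (fun i => csum (F i)) = csum (fun j => csum (F ^~ j)) /\
  csummable (fun j => csum (F ^~ j)).
Proof.
move=> FG sG GH sH.
pose m : {sigma_finite_measure set nat -> \bar R} := @counting nat R.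
have jF : cintegrable (m \x m)%E (fun z => F z.1 z.2).
  by apply: cintegrable_prod_dom FG sG GH sH; apply: cmeas_natX => n; exact: cmeas_nat.
split; [exact: cint_swap jF|exact: cintegrable_fubini_G jF].
Qed.

End sums.

Section finite_sums.
Context {R : realType}.
Implicit Types (a b : nat -> R[i]) (u v : nat -> R).

Lemma rsum_finite u n : (forall k, (n <= k)%N -> u k = 0) ->
  rsummable u /\ rsum u = \sum_(k < n) u k.
Proof.
move=> un.
have H v : (forall k, (n <= k)%N -> v k = 0) -> series v @ \oo --> \sum_(k < n) v k.
  move=> vn; apply: cvg_near_cst; near=> m.
  rewrite /series /= (@big_cat_nat _ _ _ n)//=; last by near: m; exact: nbhs_infty_ge.
  rewrite big_mkord [X in _ + X]big1_seq ?addr0// => k /=.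
  by rewrite mem_index_iota => /andP[nk _]; exact: vn.
have su : rsummable u.
  have [|s _] := ge0_rsummable (fun k => normr_ge0 (u k)) (H (fun k => `|u k|) _).
    by move=> k /un ->; rewrite normr0.
  exact: rsummable_le s _.
by split=> //; apply: rsumE => //; exact: H.
Unshelve. all: by end_near. Qed.

Lemma csum_finite a n : (forall k, (n <= k)%N -> a k = 0) ->
  csummable a /\ csum a = \sum_(k < n) a k.
Proof.
move=> an; split.
  have [|s _] := @rsum_finite (fun k => nc (a k)) n.
    by move=> k /an ->; rewrite nc0.
  exact: csummable_le s _.
apply: complex_eqP.
- rewrite (big_morph _ cReD (erefl : cRe 0 = 0)).
  by have [|_ <-] := @rsum_finite (fun k => cRe (a k)) n; first by move=> k /an ->.
- rewrite (big_morph _ cImD (erefl : cIm 0 = 0)).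
  by have [|_ <-] := @rsum_finite (fun k => cIm (a k)) n; first by move=> k /an ->.
Qed.

Lemma csum_shift a j : csummable a -> (forall k, (k < j)%N -> a k = 0) ->
  csummable (fun k => a (j + k)%N) /\ csum a = csum (fun k => a (j + k)%N).
Proof.
elim: j a => [|j IH] a sa a0; first by split.
have [sS ->] := csum_peel sa; rewrite a0// add0r.
by have [] := IH _ sS (fun k kj => a0 k.+1 kj).
Qed.

Lemma csummableZ c a : csummable a -> csummable (fun k => c * a k).
Proof. exact: cintegrableZ. Qed.

Lemma csumZ c a : csummable a -> csum (fun k => c * a k) = c * csum a.
Proof. exact: cintZ. Qed.

Lemma eq_csum a b : (forall k, a k = b k) -> csum a = csum b.
Proof. exact: eq_cint. Qed.

Lemma eq_rsum u v : (forall k, u k = v k) -> rsum u = rsum v.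
Proof. by move=> /funext ->. Qed.

Lemma csum_binomial (z h : R[i]) k :
  csum (fun j => (z ^+ (k - j) * h ^+ j) *+ 'C(k, j)) = (z + h) ^+ k.
Proof.
have [|_ ->] := @csum_finite (fun j => (z ^+ (k - j) * h ^+ j) *+ 'C(k, j)) k.+1.
  by move=> j kj; rewrite bin_small.
by rewrite exprDn.
Qed.

Lemma rsum_binomial (x y : R) k :
  rsummable (fun j => (x ^+ (k - j) * y ^+ j) *+ 'C(k, j)) /\
  rsum (fun j => (x ^+ (k - j) * y ^+ j) *+ 'C(k, j)) = (x + y) ^+ k.
Proof.
have [|s ->] := @rsum_finite (fun j => (x ^+ (k - j) * y ^+ j) *+ 'C(k, j)) k.+1.
  by move=> j kj; rewrite bin_small.
by rewrite exprDn.
Qed.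

End finite_sums.

Section power_series.
Context {R : realType}.
Implicit Types (a b m : nat -> R[i]) (r s t : R) (z h w : R[i]).

Definition ps a z := csum (fun n => a n * z ^+ n).
Definition psok a r := rsummable (fun n => nc (a n) * r ^+ n).

Lemma psok_csummable a r z : psok a r -> nc z <= r -> csummable (fun n => a n * z ^+ n).
Proof.
move=> sa zr; apply: csummable_le sa _ => n.
by rewrite Normc.normcM ncX ler_wpM2l ?nc_ge0// lerXn2r ?nnegrE ?nc_ge0// (le_trans (nc_ge0 z)).
Qed.

Lemma psok_le a r s : psok a r -> 0 <= s -> s <= r -> psok a s.
Proof.
move=> sa s0 sr; apply: rsummable_le sa _ => n.
rewrite ger0_norm ?mulr_ge0 ?nc_ge0 ?exprn_ge0//.
by rewrite ler_wpM2l ?nc_ge0// lerXn2r ?nnegrE// (le_trans s0).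
Qed.

Lemma psok_geom a (K r s : R) : 0 <= r -> r < s -> (forall n, nc (a n) * s ^+ n <= K) ->
  psok a r /\ rsum (fun n => nc (a n) * r ^+ n) <= K * (1 - r / s)^-1.
Proof.
move=> r0 rs aK; have s0 : 0 < s by exact: le_lt_trans rs.
have x1 : r / s < 1 by rewrite ltr_pdivrMr// mul1r.
have x0 : 0 <= r / s by rewrite divr_ge0// ltW.
have [sg eg] := rsum_geom x0 x1.
have B n : nc (a n) * r ^+ n <= K * (r / s) ^+ n.
  rewrite [leLHS](_ : _ = (nc (a n) * s ^+ n) * (r / s) ^+ n); last first.
    by rewrite expr_div_n; field; rewrite expf_neq0// gt_eqF.
  by rewrite ler_wpM2r// exprn_ge0.
have sK := rsummableZ K sg.
have sa : psok a r.
  by apply: rsummable_le sK _ => n; rewrite ger0_norm ?mulr_ge0 ?nc_ge0 ?exprn_ge0.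
split => //; apply: le_trans (le_rsum sa sK B) _.
by rewrite -eg /rsum RintegralZl.
Qed.

Lemma nc_ps a r z : psok a r -> nc z <= r -> nc (ps a z) <= rsum (fun n => nc (a n) * r ^+ n).
Proof.
move=> sa zr; apply: nc_csum => // n.
by rewrite Normc.normcM ncX ler_wpM2l ?nc_ge0// lerXn2r ?nnegrE ?nc_ge0// (le_trans (nc_ge0 z)).
Qed.

Lemma psokS a r : 0 < r -> psok a r -> psok (fun n => a n.+1) r.
Proof.
move=> r0 sa; have [sS _] := rsum_peel sa.
have := rsummableZ r^-1 sS; congr rsummable; apply/funext => n.
by rewrite exprS; field; rewrite gt_eqF.
Qed.

Lemma psS a r z : 0 < r -> psok a r -> nc z <= r -> ps a z = a 0%N + z * ps (fun n => a n.+1) z.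
Proof.
move=> r0 sa zr; rewrite [LHS](csum_peel (psok_csummable sa zr)).2.
rewrite /ps expr0 mulr1 -csumZ; last exact: psok_csummable (psokS r0 sa) zr.
by congr (_ + _); apply: eq_csum => n; rewrite exprS mulrCA.
Qed.

(** [a 0%N] is minus [x] times a tail bounded by [M], for arbitrarily small [x]. *)
Lemma ps_eq0_coef0 a r : 0 < r -> psok a r ->
  (forall x, 0 < x -> x < r -> ps a x%:C = 0) -> a 0%N = 0.
Proof.
move=> r0 sa a0.
have S1 := psokS r0 sa.
set M := rsum (fun n => nc (a n.+1) * r ^+ n).
have M0 : 0 <= M by apply: Rintegral_ge0 => k _; rewrite mulr_ge0 ?nc_ge0 ?exprn_ge0// ltW.
have B x : 0 < x -> x < r -> nc (a 0%N) <= x * M.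
  move=> x0 xr; have nx : nc x%:C <= r by rewrite ncR ger0_norm ltW.
  have := a0 _ x0 xr; rewrite (psS r0 sa nx) => /eqP; rewrite addr_eq0 => /eqP ->.
  rewrite ncN Normc.normcM ncR (ger0_norm (ltW x0)) ler_wpM2l ?(ltW x0)//.
  exact: nc_ps S1 nx.
apply/eqP; rewrite -nc_eq0 eq_le nc_ge0 andbT leNgt; apply/negP => p.
pose x := Num.min (r / 2) (nc (a 0%N) / (M + 1) / 2).
have M1 : 0 < M + 1 by rewrite ltr_wpDl.
have x0 : 0 < x by rewrite lt_min !divr_gt0.
have xr : x < r by rewrite gt_min; apply/orP; left; lra.
have := B _ x0 xr; rewrite leNgt => /negP; apply.
apply: (@le_lt_trans _ _ (nc (a 0%N) / (M + 1) / 2 * M)).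
  by rewrite ler_wpM2r// ge_min lexx orbT.
have q0 : 0 < nc (a 0%N) / (M + 1) by rewrite divr_gt0.
have := divfK (lt0r_neq0 M1) (nc (a 0%N)); move: q0 p.
move: (nc (a 0%N) / (M + 1)) (nc (a 0%N)) => q A q0 A0; nra.
Qed.

Lemma ps_eq0_coef a r : 0 < r -> psok a r ->
  (forall x, 0 < x -> x < r -> ps a x%:C = 0) -> forall n, a n = 0.
Proof.
move=> r0 sa a0 n; elim: n a sa a0 => [|n IH] a sa a0; first exact: ps_eq0_coef0 r0 sa a0.
apply: (IH _ (psokS r0 sa)) => x x0 xr.
have nx : nc x%:C <= r by rewrite ncR ger0_norm ltW.
have := a0 _ x0 xr; rewrite (psS r0 sa nx) (ps_eq0_coef0 r0 sa a0) add0r => /eqP.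
rewrite mulf_eq0 => /orP[|/eqP//].
by rewrite -nc_eq0 ncR normr_eq0 gt_eqF.
Qed.

Lemma psokB a b r : 0 <= r -> psok a r -> psok b r -> psok (fun n => a n - b n) r.
Proof.
move=> r0 sa sb; apply: rsummable_le (rsummableD sa sb) _ => n.
rewrite ger0_norm ?mulr_ge0 ?nc_ge0 ?exprn_ge0//.
by rewrite -mulrDl ler_wpM2r ?exprn_ge0// ncB.
Qed.

Lemma psB a b r z : psok a r -> psok b r -> nc z <= r ->
  ps (fun n => a n - b n) z = ps a z - ps b z.
Proof.
move=> sa sb zr; rewrite /ps /csum -cintB.
- by apply: eq_cint => n; rewrite mulrBl.
- exact: psok_csummable sa zr.
- exact: psok_csummable sb zr.
Qed.

(** Agreement on a segment of the positive real axis suffices; several of the functions compared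
    below are known only there. *)
Lemma ps_inj a b r : 0 < r -> psok a r -> psok b r ->
  (forall x, 0 < x -> x < r -> ps a x%:C = ps b x%:C) -> forall n, a n = b n.
Proof.
move=> r0 sa sb ab n; apply/eqP; rewrite -subr_eq0; apply/eqP.
apply: (@ps_eq0_coef (fun n => a n - b n) r) => //; first exact: psokB (ltW r0) sa sb.
move=> x x0 xr; have nx : nc x%:C <= r by rewrite ncR ger0_norm ltW.
by rewrite (psB sa sb nx) ab// subrr.
Qed.

Lemma psokZ c a r : psok a r -> psok (fun n => c * a n) r.
Proof.
move=> sa; have := rsummableZ (nc c) sa; congr rsummable; apply/funext => n.
by rewrite Normc.normcM mulrA.
Qed.

Lemma psZ c a r z : psok a r -> nc z <= r -> ps (fun n => c * a n) z = c * ps a z.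
Proof.
move=> sa zr; rewrite /ps -csumZ; last exact: psok_csummable sa zr.
by apply: eq_csum => n; rewrite mulrA.
Qed.

(** The coefficient of [h ^+ j] in [ps m (z + h)]. For [k < j] the truncated difference [k - j] is
    harmless because the binomial coefficient vanishes. *)
Definition recenter m z j := csum (fun k => m k * (z ^+ (k - j) *+ 'C(k, j))).

(** Expand [(z + h) ^+ k] and exchange the sums: the moduli of the terms of index [k] add up to at
    most [nc (m k) * (nc z + t) ^+ k], which is summable. *)
Lemma ps_recenter m s z t : psok m s -> 0 < t -> nc z + t <= s ->
  [/\ psok (recenter m z) t,
      forall h, nc h <= t -> ps m (z + h) = ps (recenter m z) h &
      forall j, csummable (fun k => m k * (z ^+ (k - j) *+ 'C(k, j)))].
Proof.
move=> sm t0 zts; pose x := nc z.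
have x0 : 0 <= x by exact: nc_ge0.
have sm' : psok m (x + t) by apply: psok_le sm _ zts; rewrite addr_ge0// ltW.
pose G k j := nc (m k) * ((x ^+ (k - j) * t ^+ j) *+ 'C(k, j)).
have G0 k j : 0 <= G k j.
  by rewrite mulr_ge0 ?nc_ge0// mulrn_wge0// mulr_ge0// exprn_ge0// ltW.
have sG k : rsummable (G k) by exact: rsummableZ (rsum_binomial x t k).1.
have eG k : rsum (G k) <= nc (m k) * (x + t) ^+ k.
  by rewrite /G /rsum RintegralZl//; [rewrite -(rsum_binomial x t k).2|exact: (rsum_binomial x t k).1].
have FG h : nc h <= t -> forall k j,
    nc (m k * (z ^+ (k - j) *+ 'C(k, j)) * h ^+ j) <= G k j.
  move=> ht k j; rewrite /G !Normc.normcM normcMn !ncX -mulrA ler_wpM2l ?nc_ge0//.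
  rewrite -mulrnAl ler_wpM2l ?mulrn_wge0 ?exprn_ge0//.
  by rewrite lerXn2r// ?nnegrE ?nc_ge0// ltW.
have col j : csummable (fun k => m k * (z ^+ (k - j) *+ 'C(k, j))).
  have sc := rsummableZ (t ^- j) sm'.
  apply: csummable_le sc _ => k.
  rewrite ler_pdivlMl ?exprn_gt0//.
  have tt : nc t%:C <= t by rewrite ncR ger0_norm// ltW.
  have := FG _ tt k j; rewrite Normc.normcM ncX ncR (ger0_norm (ltW t0)) mulrC => /le_trans; apply.
  apply: le_trans (eG k); exact: (term_le_rsum _ (G0 k) (sG k)).
split; [| |exact: col].
  have GC k j : nc (G k j)%:C <= G k j by rewrite ncR ger0_norm.
  have [_ /csummable_nc sC] := csum_swap GC sG eG sm'.
  apply: rsummable_le sC _ => j.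
  rewrite ger0_norm ?mulr_ge0 ?nc_ge0 ?exprn_ge0 ?(ltW t0)//.
  have tt : nc t%:C <= t by rewrite ncR ger0_norm// ltW.
  rewrite /csum cint_real ncR ger0_norm; last by apply: Rintegral_ge0.
  rewrite -[t ^+ j](ger0_norm (exprn_ge0 _ (ltW t0))) -ncR rmorphXn -Normc.normcM mulrC /recenter -(csumZ _ (col j)).
  apply: nc_csum.
    apply: rsummable_le sm' _ => k; rewrite ger0_norm//.
    apply: le_trans (eG k); exact: (term_le_rsum _ (G0 k) (sG k)).
  by move=> k; rewrite mulrC; exact: FG.
move=> h ht.
have [E _] := csum_swap (FG h ht) sG eG sm'.
rewrite /ps -[LHS](_ : csum (fun k => csum (fun j => m k * (z ^+ (k - j) *+ 'C(k, j)) * h ^+ j)) = _).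
  rewrite E; apply: eq_csum => j; rewrite mulrC -(csumZ _ (col j)).
  by apply: eq_csum => k; rewrite mulrC.
apply: eq_csum => k; rewrite -csum_binomial -csumZ.
  by apply: eq_csum => j; rewrite -mulrA mulrnAl.
by have [] := @csum_finite R (fun j => (z ^+ (k - j) * h ^+ j) *+ 'C(k, j)) k.+1
  (fun j kj => etrans (congr1 (GRing.natmul _) (bin_small kj)) (mulr0n _)).
Qed.

End power_series.

(** * Complex exponential and Cauchy's estimate *)

Section complex_exponential.
Context {R : realType}.
Implicit Types (x y t : R) (z w : R[i]).

Definition cis t : R[i] := cos t +i* sin t.

Definition cexp z : R[i] := (expR (cRe z))%:C * cis (cIm z).

Lemma cis0 : cis 0 = 1. Proof. by rewrite /cis cos0 sin0. Qed.

Lemma cisD x y : cis (x + y) = cis x * cis y.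
Proof. by apply: complex_eqP; rewrite ?cReM ?cImM /= ?cosD ?sinD//; ring. Qed.

Lemma nc_cis t : nc (cis t) = 1.
Proof. by rewrite /= cos2Dsin2 sqrtr1. Qed.

Lemma cisN t : cis (- t) = conjc (cis t).
Proof. by rewrite /cis cosN sinN. Qed.

Lemma cisMn t n : cis (t *+ n) = cis t ^+ n.
Proof. by elim: n => [|n IH]; rewrite ?cis0// mulrS cisD IH exprS. Qed.

Lemma cexpD z w : cexp (z + w) = cexp z * cexp w.
Proof. by rewrite /cexp cReD cImD expRD cisD rmorphM/=; ring. Qed.

Lemma cexpR x : cexp x%:C = (expR x)%:C.
Proof. by rewrite /cexp /= cis0 mulr1. Qed.

Lemma cexpI y : cexp (0 +i* y) = cis y.
Proof. by rewrite /cexp /= expR0 mul1r. Qed.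

Lemma nc_cexp z : nc (cexp z) = expR (cRe z).
Proof. by rewrite /cexp Normc.normcM nc_cis ncR ger0_norm ?expR_ge0// mulr1. Qed.

Definition ifact (n : nat) : R[i] := (n`!%:R^-1)%:C.

Lemma psok_ifact t : 0 <= t -> psok ifact t /\ rsum (fun n => nc (ifact n) * t ^+ n) = expR t.
Proof.
move=> t0; have [s <-] := rsum_exp t0.
suff E n : nc (ifact n) * t ^+ n = t ^+ n / n`!%:R.
  split; last exact: eq_rsum.
  by rewrite /psok; under eq_fun do rewrite E.
by rewrite ncR ger0_norm ?invr_ge0// mulrC.
Qed.

Lemma natrC (n : nat) : n%:R = n%:R%:C :> R[i].
Proof. by rewrite rmorph_nat. Qed.

(** Since the binomial coefficient over [k!] is [1 / (j! (k - j)!)], recentring the exponential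
    series multiplies its coefficients by its value at [z]; the addition formula is read off from
    this. *)
Lemma recenter_ifact z j : recenter ifact z j = ps ifact z * ifact j.
Proof.
have z0 := nc_ge0 z.
have [s _] := psok_ifact (addr_ge0 z0 ler01).
have [_ _ /(_ j) sa] := ps_recenter s ltr01 (lexx _).
pose a k := ifact k * (z ^+ (k - j) *+ 'C(k, j)).
have aE k : a (j + k)%N = ifact j * (ifact k * z ^+ k).
  rewrite /a addKn -mulr_natr natrC mulrA mulrA mulrAC; congr (_ * _).
  rewrite -!rmorphM/=; congr (_%:C).
  have := bin_fact (leq_addr k j); rewrite addKn => /(congr1 (fun n => n%:R : R)).
  rewrite !natrM => <-; field.
  by rewrite !pnatr_eq0 -!lt0n !fact_gt0 bin_gt0 leq_addr.
have [|_ E] := @csum_shift _ a j sa.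
  by move=> k kj; rewrite /a bin_small// mulr0n mulr0.
rewrite /recenter E mulrC -csumZ; last exact: psok_csummable (psok_ifact z0).1 _.
exact: eq_csum.
Qed.

Lemma ps_ifactD z w : ps ifact (z + w) = ps ifact z * ps ifact w.
Proof.
have z0 := nc_ge0 z; have w1 : 0 < nc w + 1 by rewrite ltr_wpDl ?nc_ge0.
have [s _] := psok_ifact (addr_ge0 z0 (ltW w1)).
have [_ E _] := ps_recenter s w1 (lexx _).
rewrite E ?lerDl// -(psZ _ (psok_ifact (nc_ge0 w)).1 (lexx _)).
by apply: eq_csum => k; rewrite recenter_ifact.
Qed.

Lemma ps_ifactR x : ps ifact x%:C = (expR x)%:C.
Proof.
have [s _] := psok_ifact (nc_ge0 x%:C).
have sa := psok_csummable s (lexx _).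
have E n : ifact n * x%:C ^+ n = (exp_coeff x n)%:C.
  by rewrite /exp_coeff /= -rmorphXn -rmorphM/= mulrC.
rewrite /ps /csum (eq_cint _ E) cint_real; congr (_%:C).
apply: rsumE; last exact: is_cvg_series_exp_coeff.
by apply: rsummable_le (csummable_nc sa) _ => n; rewrite E ncR.
Qed.

Lemma ps_ifactI y : ps ifact (0 +i* y) = cis y.
Proof.
have [s _] := psok_ifact (nc_ge0 (0 +i* y)).
have sa := psok_csummable s (lexx _).
have iX n : ('i%C : R[i]) ^+ n = ((~~ odd n)%:R * (-1) ^+ n./2) +i* ((odd n)%:R * (-1) ^+ n.-1./2).
  elim/ltn_ind: n => -[|[|n]] IH.
  - by rewrite expr0 /= !mul1r mul0r.
  - by rewrite expr1 /= !mul1r mul0r.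
  - rewrite 2!exprS mulrA -expr2 sqr_i (IH n)//=; rewrite negbK.
    case: n {IH} => [|n] /=; apply: complex_eqP => /=; rewrite ?exprS; try by ring.
    by rewrite negbK; ring.
have E n : ifact n * (0 +i* y) ^+ n = (cos_coeff y n) +i* (sin_coeff y n).
  have -> : 0 +i* y = y%:C * 'i%C by apply: complex_eqP => /=; ring.
  rewrite exprMn iX -rmorphXn mulrA -rmorphM/=; apply: complex_eqP => /=;
    by rewrite /cos_coeff /sin_coeff /= -?exprnP; ring.
rewrite /ps /csum (eq_cint _ E); apply: complex_eqP.
- rewrite [in RHS]/cis /= unlock; apply: rsumE; last exact: is_cvg_series_cos_coeff.
  by apply: rsummable_le (csummable_nc sa) _ => n; rewrite E; exact: (Re_le_nc (_ +i* _)).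
- rewrite [in RHS]/cis /= unlock; apply: rsumE; last exact: is_cvg_series_sin_coeff.
  by apply: rsummable_le (csummable_nc sa) _ => n; rewrite E; exact: (Im_le_nc (_ +i* _)).
Qed.

Lemma cexp_ps z : cexp z = ps ifact z.
Proof.
have {2}-> : z = (cRe z)%:C + (0 +i* cIm z) by apply: complex_eqP => /=; ring.
by rewrite ps_ifactD ps_ifactR ps_ifactI.
Qed.

End complex_exponential.

Section cauchy_estimate.
Context {R : realType}.
Local Notation mu := (@lebesgue_measure R).

Lemma Rintegral_FTC2 (f F : R -> R) (a b : R) : a < b -> continuous f ->
  (forall x : R, is_derive x 1 F (f x)) -> \int[mu]_(x in `[a, b]) f x = F b - F a.
Proof.
move=> ab cf dF.
have cF : continuous F.
  by move=> x; apply/differentiable_continuous/derivable1_diffP; case: (dF x).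
rewrite /Rintegral (@continuous_FTC2 _ f F)//.
- exact: continuous_subspaceT.
- split.
  + by move=> x _; case: (dF x).
  + exact/cvg_at_right_filter/cF.
  + exact/cvg_at_left_filter/cF.
- by move=> x _; rewrite derive1E; case: (dF x).
Qed.

Let I2pi : set R := `[0, pi *+ 2]%classic.
(** Integrals over the circle are written on the whole line with the weight [chi], because [cint]
    and the Fubini lemmas integrate over the full space. *)
Let chi : R -> R := \1_I2pi.

Let mI : measurable I2pi. Proof. exact: measurable_itv. Qed.

Let pi2_gt0 : 0 < (pi : R) *+ 2. Proof. by rewrite pmulrn_lgt0// pi_gt0. Qed.

Let Rintegral_chi (f : R -> R) : \int[mu]_x (chi x * f x) = \int[mu]_(x in I2pi) f x.
Proof.
rewrite [RHS]Rintegral_mkcond; apply: eq_Rintegral => x _.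
by rewrite patch_indic mulrC.
Qed.

Let integrable_chi : mu.-integrable setT (EFin \o chi).
Proof. exact: integrable_indic_itv. Qed.

Let Rintegral_chi1 : \int[mu]_x chi x = pi *+ 2.
Proof.
transitivity (\int[mu]_x (chi x * 1)); first by apply: eq_Rintegral => x _; rewrite mulr1.
rewrite Rintegral_chi Rintegral_cst// mul1r.
have := @lebesgue_measure_itv R `[0, pi *+ 2].
by rewrite /= lte_fin pi2_gt0 /= oppr0 adde0 => ->.
Qed.

Let cint_cis (k : nat) : (0 < k)%N ->
  cint mu (fun t => (chi t)%:C * cis (t * k%:R)) = 0.
Proof.
move=> k0; have kn0 : k%:R != 0 :> R by rewrite pnatr_eq0 -lt0n.
have cis1 : cis (pi *+ 2 * k%:R) = 1 :> R[i].
  by rewrite mulr_natr cisMn /cis cos2pi sin2pi expr1n.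
have [c1 s1] : cos ((pi : R) *+ 2 * k%:R) = 1 /\ sin ((pi : R) *+ 2 * k%:R) = 0.
  by case: cis1.
have cl (g : R -> R) : continuous g -> continuous (fun t : R => g (t * k%:R)).
  move=> cg x; apply: (@continuous_comp _ _ _ (fun t : R => t * k%:R) g); last exact: cg.
  exact: mulrr_continuous.
apply: complex_eqP => /=.
- transitivity (\int[mu]_t (chi t * cos (t * k%:R))).
    by apply: eq_Rintegral => t _; rewrite mul0r subr0.
  have dF (x : R) : is_derive x 1 (fun t : R => sin (t * k%:R) / k%:R) (cos (x * k%:R)).
    by apply: is_derive_eq; rewrite !scaler0 !add0r /GRing.scale /=; field.
  rewrite Rintegral_chi (Rintegral_FTC2 pi2_gt0 (cl _ (@continuous_cos R)) dF).
  by rewrite s1 mul0r mul0r sin0 mul0r subrr.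
- transitivity (\int[mu]_t (chi t * sin (t * k%:R))).
    by apply: eq_Rintegral => t _; rewrite mul0r addr0.
  have dF (x : R) : is_derive x 1 (fun t : R => - cos (t * k%:R) / k%:R) (sin (x * k%:R)).
    by apply: is_derive_eq; rewrite !scaler0 !add0r /GRing.scale /=; field.
  rewrite Rintegral_chi (Rintegral_FTC2 pi2_gt0 (cl _ (@continuous_sin R)) dF).
  by rewrite c1 mul0r cos0 subrr.
Qed.

Let cmeas_cis (c : R) : cmeas (fun t : R => cis (t * c)).
Proof.
by split; apply: (@continuous_measurable_fun R) => x /=;
  apply: (@continuous_comp _ _ _ (fun t : R => t * c));
  [exact: mulrr_continuous|exact: continuous_cos|exact: mulrr_continuous|exact: continuous_sin].
Qed.

(** Integrate the series on the circle of radius [r] against the conjugate of the character of index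
    [q]; orthogonality leaves only the term of index [q]. *)
Lemma ps_coef_bound (a : nat -> R[i]) (r K : R) : 0 <= r -> psok a r ->
  (forall z, nc z = r -> nc (ps a z) <= K) -> forall n, nc (a n) * r ^+ n <= K.
Proof.
move=> r0 sa aK q.
pose F n t : R[i] := (chi t)%:C * (a n * r%:C ^+ n * (cis (t * n%:R) * cis (t * - q%:R))).
pose G n t : R := nc (a n) * r ^+ n * chi t.
have chi0 t : 0 <= chi t by rewrite /chi indicE.
have FG n t : nc (F n t) <= G n t.
  rewrite /F /G 2!Normc.normcM ncR ger0_norm// 2!Normc.normcM !nc_cis !mulr1.
  by rewrite ncX ncR ger0_norm// mulrC.
have iG n : mu.-integrable setT (EFin \o G n).
  exact: integrable_scale integrable_chi.
have eG n : \int[mu]_t G n t <= pi *+ 2 * (nc (a n) * r ^+ n).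
  by rewrite RintegralZl// Rintegral_chi1 mulrC.
have sH : rsummable (fun n => pi *+ 2 * (nc (a n) * r ^+ n)) by exact: rsummableZ.
have mchi : cmeas (fun t => (chi t)%:C).
  by apply: cmeas_real; apply/measurable_EFinP; exact: measurable_int integrable_chi.
have mF n : cmeas (F n).
  apply: cmeasM => //; apply: cmeasM; first exact: cmeas_cst.
  exact: cmeasM.
pose m : {sigma_finite_measure set nat -> \bar R} := @counting nat R.
have jF : cintegrable (m \x mu)%E (fun z => F z.1 z.2).
  by apply: (@cintegrable_prod_dom _ _ _ _ _ m mu F G _ _ FG iG eG sH); exact: cmeas_natX.
have E := cint_swap jF.
have L : csum (fun n => cint mu (F n)) = a q * r%:C ^+ q * (pi *+ 2)%:C.
  have Fn n : cint mu (F n) = a n * r%:C ^+ n * (if n == q then (pi *+ 2)%:C else 0).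
    have jc c : cintegrable mu (fun t => (chi t)%:C * cis (t * c)).
      apply: (integrable_cintegrable _ integrable_chi); first exact: cmeasM mchi (cmeas_cis c).
      by move=> t; rewrite Normc.normcM nc_cis ncR mulr1 ger0_norm.
    rewrite -[LHS](_ : cint mu (fun t => a n * r%:C ^+ n * ((chi t)%:C * cis (t * (n%:R - q%:R)))) = _); last first.
      by apply: eq_cint => t; rewrite /F mulrBr cisD mulrN; ring.
    rewrite cintZ//; congr (_ * _); case: (ltngtP n q) => [nq|nq|->].
    - transitivity (conjc (cint mu (fun t => (chi t)%:C * cis (t * (q - n)%:R)))).
        rewrite -cint_conj; last exact: jc.
        apply: eq_cint => t; rewrite natrB ?(ltnW nq)// -opprB mulrN cisN.
        by apply: complex_eqP => /=; ring.
      by rewrite cint_cis ?subn_gt0// conjc0.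
    - by rewrite -natrB ?(ltnW nq)// cint_cis ?subn_gt0.
    - rewrite subrr -Rintegral_chi1 -cint_real; apply: eq_cint => t.
      by rewrite mulr0 cis0 mulr1.
  rewrite (eq_csum Fn).
  have [|_ ->] := @csum_finite R (fun n => a n * r%:C ^+ n * (if n == q then (pi *+ 2)%:C else 0)) q.+1.
    by move=> k qk; rewrite gtn_eqF// mulr0.
  rewrite big_ord_recr/= eqxx big1 ?add0r// => i _.
  by rewrite ltn_eqF// mulr0.
have iK : mu.-integrable setT (EFin \o (fun t => K * chi t)).
  exact: integrable_scale integrable_chi.
have B : nc (cint mu (fun t => csum (F ^~ t))) <= K * (pi *+ 2).
  apply: le_trans (nc_cint_le (cmeas_cint' jF) iK _) _; last first.
    by rewrite RintegralZl// Rintegral_chi1.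
  move=> t; change (nc (csum (F ^~ t)) <= K * chi t).
  have nz : nc (r%:C * cis t) = r by rewrite Normc.normcM nc_cis mulr1 ncR ger0_norm.
  have -> : csum (F ^~ t) = (chi t)%:C * cis (t * - q%:R) * ps a (r%:C * cis t).
    rewrite /ps -csumZ; last by apply: psok_csummable sa _; rewrite nz.
    by apply: eq_csum => n; rewrite /F mulr_natr cisMn exprMn; ring.
  by rewrite 2!Normc.normcM nc_cis mulr1 ncR ger0_norm// mulrC ler_wpM2r// aK.
move: B; rewrite -E -/(csum _) L 2!Normc.normcM ncX !ncR (ger0_norm r0).
by rewrite (ger0_norm (ltW pi2_gt0)) ler_pM2r.
Qed.

End cauchy_estimate.

(** * Continuation from two half-planes *)

Section continuation.
Context {R : realType}.
Implicit Types (A : R[i] -> R[i]) (m : nat -> R[i]) (z h : R[i]).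

(* [A] is analytic near the left half-plane, with radius of convergence at
   least 1/3 there, uniformly on bounded sets. *)
Definition left_analytic A := forall rho : R, exists K : R,
  forall z, cRe z <= 0 -> nc z <= rho -> exists alpha : nat -> R[i],
    (forall j, nc (alpha j) <= K * 3 ^+ j) /\
    forall h, nc h < 3^-1 -> A (z + h) = ps alpha h.

Lemma psok_lt m (rho s C : R) : 0 <= s -> s < rho ->
  (forall k, nc (m k) * rho ^+ k <= C) -> psok m s.
Proof. by move=> s0 sr mC; have [] := psok_geom s0 sr mC. Qed.

(** Continuation along the segment from 0 to [z], which stays in the half-plane. At each node the
    local expansion of [A] agrees with the recentred series on a disc of radius [e], so the
    coefficients coincide, so the two agree on radius [2 * e], which contains a disc of radius [e]
    about the next node. *)
Lemma left_analytic_recenter A m (rho C delta : R) :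
  left_analytic A -> 0 < delta ->
  (forall k, nc (m k) * rho ^+ k <= C) ->
  (forall h, nc h < delta -> A h = ps m h) ->
  exists K : R, forall z, nc z < rho -> cRe z <= 0 ->
    forall j, nc (recenter m z j) <= K * 3 ^+ j.
Proof.
move=> lA d0 mC Am; have [K HK] := lA rho; exists K => z zrho Rz0.
have z0 := nc_ge0 z.
(* [1/8] gives [2 * e < 3^-1], inside the local expansions of [A]; the second term gives
   [nc z + 2 * e < rho], inside the convergence of [m]; [delta] starts the chain at 0. *)
pose e := Num.min (Num.min (1/8) ((rho - nc z) / 3)) delta.
have e0 : 0 < e by rewrite !lt_min d0 divr_gt0 ?divr_gt0 ?subr_gt0.
have e8 : e <= 1/8 by rewrite !ge_min lexx.
have er : 3 * e <= rho - nc z.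
  suff : e <= (rho - nc z) / 3 by lra.
  by rewrite !ge_min lexx orbT.
have ed : e <= delta by rewrite !ge_min lexx !orbT.
clearbody e.
have [n n0 ne] : exists2 n : nat, (0 < n)%N & nc z <= e * n%:R.
  exists (Num.bound (nc z / e)).+1 => //.
  have := archi_boundP (divr_ge0 z0 (ltW e0)); rewrite ltr_pdivrMr// => /ltW/le_trans; apply.
  by rewrite mulrC ler_pM2l// ler_nat.
have n0R : 0 < n%:R :> R by rewrite ltr0n.
pose zz i : R[i] := (i%:R / n%:R)%:C * z.
have nzz i : (i <= n)%N -> nc (zz i) <= nc z.
  move=> ni; rewrite /zz Normc.normcM ncR ger0_norm ?divr_ge0//.
  by rewrite ler_piMl// ler_pdivrMr// mul1r ler_nat.
have Rzz i : cRe (zz i) <= 0.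
  by rewrite /zz cReM /= mul0r subr0 mulr_ge0_le0// divr_ge0.
have local i : (i <= n)%N -> (forall h, nc h < e -> A (zz i + h) = ps m (zz i + h)) ->
    (forall j, nc (recenter m (zz i) j) <= K * 3 ^+ j) /\
    forall h, nc h < 2 * e -> A (zz i + h) = ps m (zz i + h).
  move=> ni Ei.
  have [|alpha [aK aE]] := HK (zz i) (Rzz i); first by have := nzz _ ni; lra.
  have sm : psok m (nc z + 2 * e) by apply: psok_lt mC; lra.
  have [||sr rE _] := @ps_recenter _ m _ (zz i) (2 * e) sm.
  - by lra.
  - by have := nzz _ ni; lra.
  have sa : psok alpha (2 * e).
    apply: (@psok_lt _ 3^-1 _ K); [lra|lra|] => k.
    by rewrite exprVn ler_pdivrMr ?exprn_gt0.
  have ar : forall j, alpha j = recenter m (zz i) j.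
    apply: (@ps_inj _ _ _ e) => //; [by apply: psok_le sa _ _; lra|by apply: psok_le sr _ _; lra|].
    move=> x x0 xe; have nx : nc x%:C = x by rewrite ncR ger0_norm// ltW.
    rewrite -aE ?nx; last by lra.
    rewrite Ei; last by rewrite nx.
    rewrite rE; last by rewrite nx; lra.
    by [].
  split=> [j|h h2]; first by rewrite -ar.
  rewrite aE; last by lra.
  rewrite rE; last by lra.
  by apply: eq_csum => j; rewrite ar.
have chain i : (i <= n)%N -> forall h, nc h < e -> A (zz i + h) = ps m (zz i + h).
  elim: i => [_ h he|i IH ni h he].
    by rewrite /zz mul0r mul0r add0r Am// (lt_le_trans he).
  have [_ step] := local i (ltnW ni) (IH (ltnW ni)).
  have -> : zz i.+1 + h = zz i + ((n%:R^-1)%:C * z + h).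
    by rewrite /zz -natr1 mulrDl div1r rmorphD/=; ring.
  apply: step; apply: le_lt_trans (ncD _ _) _.
  rewrite Normc.normcM ncR ger0_norm ?invr_ge0// -[ltRHS](_ : e + e = _); last by ring.
  by rewrite ler_ltD// mulrC ler_pdivrMr.
have [bnd _] := local n (leqnn _) (chain n (leqnn _)).
have zn : zz n = z by rewrite /zz divff ?gt_eqF// rmorph1 mul1r.
by move=> j; rewrite -{1}zn.
Qed.

Lemma recenter_alternate m z j :
  csummable (fun k => m k * (z ^+ (k - j) *+ 'C(k, j))) ->
  recenter (fun k => (-1) ^+ k * m k) (- z) j = (-1) ^+ j * recenter m z j.
Proof.
move=> jr; rewrite /recenter -csumZ//; apply: eq_csum => k; have [kj|jk] := ltnP k j.
  by rewrite !bin_small// !mulr0n !mulr0.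
have s1 : (-1) ^+ (k - j) * (-1) ^+ (k - j) = 1 :> R[i].
  by rewrite -exprD addnn -mul2n exprM sqrrN !expr1n.
rewrite -[X in (-1) ^+ X](subnK jk) exprD [(- z) ^+ _]exprNn -mulr_natr -[in RHS]mulr_natr.
transitivity ((-1) ^+ (k - j) * (-1) ^+ (k - j) * ((-1) ^+ j * (m k * (z ^+ (k - j) * 'C(k, j)%:R)))).
  by ring.
by rewrite s1 mul1r.
Qed.

Lemma alternate_bound (a : nat -> R[i]) k : nc ((-1) ^+ k * a k) = nc (a k).
Proof. by rewrite Normc.normcM ncX ncN nc1 expr1n mul1r. Qed.

Lemma bootstrap_step A B m (rho C delta : R) :
  left_analytic A -> left_analytic B -> 0 < delta -> 3^-1 <= rho ->
  (forall h, nc h < delta -> A h = ps m h) ->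
  (forall h, nc h < delta -> B h = ps (fun k => (-1) ^+ k * m k) h) ->
  (forall k, nc (m k) * rho ^+ k <= C) ->
  exists C' : R, forall k, nc (m k) * (rho + 12^-1) ^+ k <= C'.
Proof.
move=> lA lB d0 rho3 Am Bm mC.
have [KA HA] := left_analytic_recenter lA d0 mC Am.
have [KB HB] : exists K : R, forall z, nc z < rho -> cRe z <= 0 ->
    forall j, nc (recenter (fun k => (-1) ^+ k * m k) z j) <= K * 3 ^+ j.
  apply: (left_analytic_recenter lB d0 _ Bm) => k.
  by rewrite alternate_bound; exact: mC.
pose K := Num.max KA KB.
have cs z j : nc z < rho -> csummable (fun k => m k * (z ^+ (k - j) *+ 'C(k, j))).
  move=> zr; have t0 : 0 < (rho - nc z) / 3 by lra.
  have sm : psok m ((nc z + 2 * rho) / 3).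
    by apply: psok_lt mC; have := nc_ge0 z; lra.
  by have [|_ _ /(_ j)] := ps_recenter sm t0 (z := z); first by lra.
have HK z : nc z < rho -> forall j, nc (recenter m z j) <= K * 3 ^+ j.
  move=> zr j; have [Rz|Rz] := leP (cRe z) 0.
    by apply: le_trans (HA _ zr Rz j) _; rewrite ler_wpM2r ?exprn_ge0// le_max lexx.
  have := HB (- z); rewrite ncN cReN oppr_le0 => /(_ zr (ltW Rz) j).
  rewrite recenter_alternate ?(alternate_bound (recenter m z)); last exact: cs.
  by move=> /le_trans; apply; rewrite ler_wpM2r ?exprn_ge0// le_max lexx orbT.
(* [r] stays below [rho], where the recentred coefficients are bounded, while [r + 6^-1] exceeds
   [rho]; [3^-1 <= rho] keeps [r] positive. *)
pose r := rho - 12^-1.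
have r0 : 0 < r by rewrite /r; lra.
have rr : r < rho by rewrite /r; lra.
(* For fixed [j] the recentred coefficient is itself a power series in [z], and Cauchy's estimate
   applies to it on the circle of radius [r]. *)
have bnd j i : nc (m (j + i)%N *+ 'C(j + i, j)) * r ^+ i <= K * 3 ^+ j.
  have sm : psok m ((r + rho) / 2) by apply: psok_lt mC; lra.
  have E z : nc z = r -> csummable (fun i => m (j + i)%N *+ 'C(j + i, j) * z ^+ i) /\
      recenter m z j = ps (fun i => m (j + i)%N *+ 'C(j + i, j)) z.
    move=> zr; have zrho : nc z < rho by rewrite zr.
    have [|s Es] := csum_shift (j := j) (cs z j zrho).
      by move=> k kj; rewrite bin_small// mulr0n mulr0.
    have e k : m (j + k)%N * (z ^+ (j + k - j) *+ 'C(j + k, j)) =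
        m (j + k)%N *+ 'C(j + k, j) * z ^+ k by rewrite addKn mulrnAr mulrnAl.
    split; last by rewrite /recenter Es; exact: eq_csum.
    by move: s; under eq_fun do rewrite e.
  apply: (@ps_coef_bound _ (fun i => m (j + i)%N *+ 'C(j + i, j)) r); first exact: ltW.
  - have nr : nc r%:C = r by rewrite ncR ger0_norm// ltW.
    have [/csummable_nc s _] := E _ nr.
    apply: rsummable_le s _ => k.
    by rewrite ger0_norm ?mulr_ge0 ?nc_ge0 ?exprn_ge0 ?(ltW r0)// [leRHS]Normc.normcM ncX nr.
  - by move=> z zr; rewrite -(E z zr).2; apply: HK; rewrite zr.
have K0 : 0 <= K by have := bnd 0%N 0%N; rewrite !expr0 !mulr1; apply: le_trans; exact: nc_ge0.
exists (2 * K) => k.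
have -> : rho + 12^-1 = r + 6^-1 by rewrite /r; lra.
(* Since [6^-1] is half of the uniform radius [3^-1], the term of index [i] of the binomial
   expansion is at most [K * 2^-1 ^+ i]. *)
rewrite exprDn mulr_sumr.
apply: (@le_trans _ _ (\sum_(i < k.+1) K * 2^-1 ^+ i)).
  apply: ler_sum => i _.
  have := bnd i (k - i)%N; rewrite subnKC ?leq_ord// normcMn => h.
  rewrite [leLHS](_ : _ = nc (m k) *+ 'C(k, i) * r ^+ (k - i) * 6^-1 ^+ i); last first.
    by rewrite mulrnAr !mulrnAl mulrA.
  apply: (@le_trans _ _ (K * 3 ^+ i * 6^-1 ^+ i)).
    by rewrite ler_wpM2r ?exprn_ge0.
  by rewrite -mulrA -exprMn (_ : 3 * 6^-1 = 2^-1)//; lra.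
rewrite -mulr_sumr mulrC ler_wpM2r//.
have g n : \sum_(i < n) (2^-1 : R) ^+ i = 2 - 2 * 2^-1 ^+ n.
  elim: n => [|n IH]; first by rewrite big_ord0 expr0; lra.
  by rewrite big_ord_recr/= IH exprS; lra.
by rewrite g gerBl mulr_ge0// exprn_ge0.
Qed.

(* [A] and [B] continue the same series along opposite half-planes; a series of radius
   [rho] is then known on a neighbourhood of the whole disc, which Cauchy's estimate on
   recentred expansions turns into the larger radius [rho + 12^-1]. *)
Lemma bootstrap A B m (K0 delta : R) :
  left_analytic A -> left_analytic B -> 0 < delta ->
  (forall h, nc h < delta -> A h = ps m h) ->
  (forall h, nc h < delta -> B h = ps (fun k => (-1) ^+ k * m k) h) ->
  (forall k, nc (m k) * 3^-1 ^+ k <= K0) ->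
  forall rho : R, exists C : R, forall k, nc (m k) * rho ^+ k <= C.
Proof.
move=> lA lB d0 Am Bm mK rho.
have H (n : nat) : exists C : R, forall k, nc (m k) * (3^-1 + n%:R / 12) ^+ k <= C.
  elim: n => [|n [C IH]]; first by exists K0 => k; rewrite mul0r addr0.
  have r3 : 3^-1 <= 3^-1 + n%:R / 12 :> R by rewrite lerDl divr_ge0.
  have [C' HC'] := bootstrap_step lA lB d0 r3 Am Bm IH.
  exists C' => k; apply: le_trans (HC' k); rewrite ler_wpM2l ?nc_ge0//.
  by rewrite -[n.+1%:R]natr1 mulrDl div1r addrA.
have [C HC] := H (Num.bound (`|rho| * 12)).
exists C => k; apply: le_trans (HC k); rewrite ler_wpM2l ?nc_ge0//.
apply: le_trans (ler_norm _) _; rewrite normrX lerXn2r ?nnegrE ?addr_ge0 ?divr_ge0//.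
apply: (@le_trans _ _ ((Num.bound (`|rho| * 12))%:R / 12)); last by rewrite lerDr.
by rewrite ler_pdivlMr// ltW// archi_boundP// mulr_ge0.
Qed.

End continuation.

(** * Laplace-type integrals as analytic functions on a half-plane *)

Section negative_binomial.
Context {R : realType}.
Implicit Types (u z : R[i]).

Let ones (n : nat) : R[i] := 1.

Let psok_ones r : 0 <= r -> r < 1 -> psok ones r.
Proof.
move=> r0 r1; have [] // := @psok_geom _ ones 1 r 1 r0 r1.
by move=> n; rewrite /ones nc1 expr1n mulr1.
Qed.

Let subr1_neq0 u : nc u < 1 -> 1 - u != 0.
Proof. by apply: contraTneq => /eqP; rewrite subr_eq0 => /eqP <-; rewrite nc1 ltxx. Qed.

Let ps_ones u : nc u < 1 -> ps ones u = (1 - u)^-1.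
Proof.
move=> u1; have r0 : 0 < (nc u + 1) / 2 by rewrite divr_gt0// ltr_wpDl ?nc_ge0.
have r1 : (nc u + 1) / 2 < 1 by lra.
have := @psS _ ones _ u r0 (psok_ones (ltW r0) r1).
have -> : nc u <= (nc u + 1) / 2 by lra.
move=> /(_ isT); rewrite -/ones {2}/ones => /eqP; rewrite -subr_eq -{1}[ps ones u]mul1r -mulrBl => /eqP E.
by apply: (mulfI (subr1_neq0 u1)); rewrite E divff ?subr1_neq0.
Qed.

(** Up to the factor [u ^+ i], this is the coefficient of index [i.+1] of the geometric series
    recentred at [u]. For [w = W / (1 - h * W)] the product [w ^+ 2 * (w - W) ^+ i] is [W ^+ i.+2]
    times this sum at [u = h * W], whence the shifts by one and two. *)
Lemma csum_negbin u i : nc u < 1 ->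
  csummable (fun n => 'C(n.+1, i.+1)%:R * u ^+ n) /\
  csum (fun n => 'C(n.+1, i.+1)%:R * u ^+ n) = u ^+ i / (1 - u) ^+ i.+2.
Proof.
move=> u1; have uu := subr1_neq0 u1.
pose t := (1 - nc u) / 4.
have t0 : 0 < t by rewrite /t; lra.
have d : 2 * t <= nc (1 - u).
  by have := ncD (1 - u) u; rewrite subrK nc1 /t; lra.
have so : psok ones (nc u + t) by apply: psok_ones; rewrite /t; have := nc_ge0 u; lra.
have [sr rE sc] := ps_recenter so t0 (lexx _).
pose b j : R[i] := (1 - u)^-1 ^+ j.+1.
have sb : psok b t.
  have [] // := @psok_geom _ b (nc (1 - u)^-1) t (nc (1 - u)) (ltW t0).
    by lra.
  move=> j; rewrite ncX Normc.normcV exprS -mulrA -exprMn mulVf ?expr1n ?mulr1//.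
  by rewrite nc_eq0.
have rb : forall j, recenter ones u j = b j.
  apply: (ps_inj t0 sr sb) => x x0 xt.
  have nx : nc x%:C = x by rewrite ncR ger0_norm// ltW.
  have nxt : nc x%:C <= t by rewrite nx ltW.
  rewrite -(rE _ nxt) ps_ones; last first.
    by apply: le_lt_trans (ncD _ _) _; rewrite nx; move: xt; rewrite /t; have := nc_ge0 u; lra.
  have nq : nc (x%:C / (1 - u)) < 1.
    by rewrite Normc.normcM nx Normc.normcV ltr_pdivrMr; lra.
  rewrite [RHS](_ : _ = (1 - u)^-1 * ps ones (x%:C / (1 - u))).
    rewrite ps_ones// -invfM; congr (_^-1).
    by rewrite mulrBr mulr1 mulrCA divff// mulr1; ring.
  rewrite /ps -csumZ; last first.
    by apply: (@psok_csummable _ _ (nc (x%:C / (1 - u)))) => //; exact: psok_ones (nc_ge0 _) nq.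
  by apply: eq_csum => n; rewrite /b /ones exprS exprMn; ring.
have := rb i.+1; rewrite /recenter.
have [sS ->] := csum_peel (sc i.+1).
rewrite /= bin0n/= mulr0n mulr0 add0r => E.
have e n : u ^+ i * (ones n.+1 * (u ^+ (n.+1 - i.+1) *+ 'C(n.+1, i.+1))) = 'C(n.+1, i.+1)%:R * u ^+ n.
  have [ni|ni] := ltnP n i; first by rewrite bin_small// mulr0n !mulr0 mul0r.
  by rewrite mul1r subSS -mulr_natl mulrCA -exprD subnKC.
split; first by have := csummableZ (u ^+ i) sS; under eq_fun do rewrite e.
rewrite -(eq_csum e) csumZ// E /b; congr (_ * _).
by rewrite exprVn.
Qed.

Lemma rsum_negbin (x : R) i : 0 <= x -> x < 1 ->
  rsummable (fun n => 'C(n.+1, i.+1)%:R * x ^+ n) /\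
  rsum (fun n => 'C(n.+1, i.+1)%:R * x ^+ n) = x ^+ i / (1 - x) ^+ i.+2.
Proof.
move=> x0 x1; have n1 : nc x%:C < 1 by rewrite ncR ger0_norm.
have [s E] := csum_negbin i n1.
have e n : 'C(n.+1, i.+1)%:R * x%:C ^+ n = ('C(n.+1, i.+1)%:R * x ^+ n)%:C.
  by rewrite rmorphM/= rmorphXn rmorph_nat.
split.
  apply: rsummable_le (csummable_nc s) _ => n.
  by rewrite e ncR.
apply: complexI; rewrite -[LHS]cint_real -[LHS](eq_cint _ e) -/(csum _) E.
by rewrite -!rmorphXn -rmorphB -rmorphXn/= -fmorphV -rmorphM.
Qed.

End negative_binomial.

Section exponential_family.
Context d (T : measurableType d) {R : realType}.
Variable mu : {sigma_finite_measure set T -> \bar R}.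
Variables (P : T -> R[i]) (S : T -> R).
Hypothesis mP : cmeas P.
Hypothesis mS : measurable_fun setT S.
Hypothesis S0 : forall t, 0 <= S t.
Hypothesis iP : forall l : R, 0 < l ->
  mu.-integrable setT (EFin \o (fun t => nc (P t) * expR (- (l * S t)))).

Let L (l : R) := \int[mu]_t (nc (P t) * expR (- (l * S t))).

(* With [w = (1 - z)^-1] this is the integral of [P * w ^+ 2 * exp (- S w)]; [Re z <= 0]
   corresponds to the disc with diameter the segment from 0 to 1, in which [Re w > 0]. *)
Definition exp_family (z : R[i]) : R[i] :=
  cint mu (fun t => P t * ((1 - z)^-1 ^+ 2 * cexp (- ((S t)%:C * (1 - z)^-1)))).

Let L_ge0 l : 0 <= L l.
Proof. by apply: Rintegral_ge0 => t _; rewrite mulr_ge0 ?nc_ge0 ?expR_ge0. Qed.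

Lemma cmeas_cexp (f : T -> R[i]) : cmeas f -> cmeas (fun t => cexp (f t)).
Proof.
move=> [f1 f2]; rewrite /cexp; apply: cmeasM.
  by apply: cmeas_real; apply: measurableT_comp.
by split => /=; apply: measurableT_comp => //; apply: continuous_measurable_fun;
  [exact: continuous_cos|exact: continuous_sin].
Qed.

(** Taylor coefficients at [W] of the Laplace transform, the integral of [P * exp (- S w)] as a
    function of [w]. *)
Let laplace_coef (W : R[i]) (i : nat) : R[i] :=
  cint mu (fun t => P t * cexp (- ((S t)%:C * W)) * ((- (S t)%:C) ^+ i * ifact i)).

Let expn_le (s x : R) i : 0 < s -> 0 <= x -> x ^+ i / i`!%:R <= s ^- i * expR (s * x).
Proof.
move=> s0 x0; have sx : 0 <= s * x by rewrite mulr_ge0// ltW.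
have [sm <-] := rsum_exp sx.
rewrite ler_pdivlMl ?exprn_gt0// mulrA -exprMn.
by apply: (@term_le_rsum _ (fun k => (s * x) ^+ k / k`!%:R)) => // k; rewrite divr_ge0// exprn_ge0.
Qed.

Let mexp (W : R[i]) : cmeas (fun t => P t * cexp (- ((S t)%:C * W))).
Proof.
apply: cmeasM => //; apply: cmeas_cexp; apply: cmeasN; apply: cmeasM.
  exact: cmeas_real.
exact: cmeas_cst.
Qed.

Let mlap W i : cmeas (fun t => P t * cexp (- ((S t)%:C * W)) * ((- (S t)%:C) ^+ i * ifact i)).
Proof.
apply: cmeasM => //; apply: cmeasM; last exact: cmeas_cst.
by apply: cmeasX; apply: cmeasN; exact: cmeas_real.
Qed.

(** The part [s] of [cRe W] pays for the power of [S], through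
    [x ^+ i / i! <= s ^- i * expR (s * x)]; the part [l] is kept for integrability. *)
Let lap_dom (W : R[i]) (s l : R) i t : 0 < s -> s + l <= cRe W ->
  nc (P t * cexp (- ((S t)%:C * W)) * ((- (S t)%:C) ^+ i * ifact i)) <=
  s ^- i * (nc (P t) * expR (- (l * S t))).
Proof.
move=> s0 slW; rewrite Normc.normcM [nc (P t * _)]Normc.normcM nc_cexp.
rewrite [nc (_ ^+ _ * _)]Normc.normcM ncX ncN !ncR (ger0_norm (S0 t)).
rewrite (ger0_norm (_ : 0 <= _^-1)) ?invr_ge0//.
have -> : cRe (- ((S t)%:C * W)) = - (S t * cRe W) by rewrite cReN cReM /= mul0r subr0.
rewrite -mulrA [leRHS]mulrCA ler_wpM2l ?nc_ge0//.
apply: (@le_trans _ _ (expR (- (S t * cRe W)) * (s ^- i * expR (s * S t)))).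
  by rewrite ler_wpM2l ?expR_ge0//; exact: expn_le.
rewrite mulrCA ler_wpM2l ?invr_ge0 ?exprn_ge0 ?(ltW s0)// -expRD ler_expR.
have := ler_wpM2r (S0 t) slW; lra.
Qed.

Let integrable_exp (W : R[i]) (l : R) : 0 < l -> l <= cRe W ->
  cintegrable mu (fun t => P t * cexp (- ((S t)%:C * W))).
Proof.
move=> l0 lW; apply: (integrable_cintegrable _ (iP l0)) => // t.
rewrite Normc.normcM nc_cexp ler_wpM2l ?nc_ge0// ler_expR cReN cReM /= mul0r subr0.
by rewrite lerN2 mulrC ler_wpM2l.
Qed.

Let nc_laplace_coef (W : R[i]) (s l : R) i : 0 < s -> 0 < l -> s + l <= cRe W ->
  nc (laplace_coef W i) <= s ^- i * L l.
Proof.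
move=> s0 l0 slW; rewrite -RintegralZl//; last exact: iP.
apply: nc_cint_le => //; first exact/integrable_scale/iP.
by move=> t; exact: lap_dom.
Qed.

Let laplace_expansion (W w : R[i]) (s l : R) : 0 < s -> 0 < l -> s + l <= cRe W ->
  nc (w - W) < s ->
  cint mu (fun t => P t * cexp (- ((S t)%:C * w))) = ps (laplace_coef W) (w - W).
Proof.
move=> s0 l0 slW ws.
pose q := nc (w - W) / s.
have q0 : 0 <= q by rewrite divr_ge0 ?nc_ge0// ltW.
have q1 : q < 1 by rewrite ltr_pdivrMr// mul1r.
pose F i t := P t * cexp (- ((S t)%:C * W)) * ((- (S t)%:C) ^+ i * ifact i) * (w - W) ^+ i.
pose G i t := q ^+ i * (nc (P t) * expR (- (l * S t))).
have FG i t : nc (F i t) <= G i t.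
  rewrite /F /G Normc.normcM ncX.
  apply: le_trans (ler_wpM2r _ (lap_dom i t s0 slW)) _; first by rewrite exprn_ge0 ?nc_ge0.
  by rewrite mulrAC ler_wpM2r ?mulr_ge0 ?nc_ge0 ?expR_ge0// mulrC -expr_div_n.
have iG i : mu.-integrable setT (EFin \o G i) by exact/integrable_scale/iP.
have eG i : \int[mu]_t G i t <= L l * q ^+ i.
  by rewrite RintegralZl//; [rewrite mulrC|exact: iP].
have sH : rsummable (fun i => L l * q ^+ i) by exact: rsummableZ (rsum_geom q0 q1).1.
pose m : {sigma_finite_measure set nat -> \bar R} := @counting nat R.
have mF i : cmeas (F i) by apply: cmeasM => //; exact: cmeas_cst.
have jF : cintegrable (m \x mu)%E (fun z => F z.1 z.2).
  by apply: (@cintegrable_prod_dom _ _ _ _ _ m mu F G _ _ FG iG eG sH); exact: cmeas_natX.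
have E := cint_swap jF.
transitivity (cint mu (fun t => csum (F ^~ t))).
  apply: eq_cint => t.
  have -> : - ((S t)%:C * w) = - ((S t)%:C * W) + - (S t)%:C * (w - W) by ring.
  rewrite cexpD mulrA (cexp_ps (_ * _)) /ps -csumZ; last first.
    by apply: psok_csummable (psok_ifact (nc_ge0 _)).1 (lexx _).
  by apply: eq_csum => i; rewrite /F exprMn; ring.
rewrite -E; apply: eq_csum => i.
rewrite mulrC -cintZ; first by apply: eq_cint => t; rewrite /F mulrC.
apply: (@integrable_cintegrable _ _ _ _ _ (fun t => s ^- i * (nc (P t) * expR (- (l * S t))))) => //.
  exact/integrable_scale/iP.
by move=> t; exact: lap_dom.
Qed.

(** Let [W] and [w] be the values of [(1 - z)^-1] at the centre and at [z + h]. The integral is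
    expanded in powers of [w - W], each power (times [w ^+ 2]) in powers of [h] by the negative
    binomial series, and the double series is exchanged. *)
Lemma left_analytic_exp_family : left_analytic exp_family.
Proof.
move=> rho0; pose rho := Num.max 0 rho0.
have rho_ge0 : 0 <= rho by rewrite le_max lexx.
(* [nc (1 - z) <= 1 + rho] gives [4 * l <= nc W ^+ 2], and [nc W ^+ 2 <= cRe W]; a quarter of
   [nc W ^+ 2] is left for [l] and three quarters go to [s]. *)
pose l := (4 * (1 + rho) ^+ 2)^-1.
have l0 : 0 < l by rewrite invr_gt0 mulr_gt0// exprn_gt0// ltr_wpDr.
exists (27 / 4 * L l) => z Rz zr0.
have zr : nc z <= rho by rewrite le_max zr0 orbT.
pose W := (1 - z)^-1; pose x := nc W.
have z1 : 1 <= nc (1 - z).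
  apply: le_trans (le_trans (ler_norm _) (Re_le_nc _)).
  by rewrite cReD cReN /=; lra.
have z1r : nc (1 - z) <= 1 + rho by apply: le_trans (ncB _ _) _; rewrite nc1; lra.
have nz : 1 - z != 0 by rewrite -nc_gt0; lra.
have x0 : 0 < x by rewrite /x Normc.normcV invr_gt0; lra.
have x1 : x <= 1 by rewrite /x Normc.normcV invf_le1; lra.
have xl : 4 * l <= x ^+ 2.
  rewrite /l /x Normc.normcV invfM mulrA divff// mul1r exprVn lef_pV2 ?posrE ?exprn_gt0//; try lra.
  by rewrite lerXn2r// nnegrE; lra.
have RW : x ^+ 2 <= cRe W.
  have -> : cRe W = cRe (1 - z) * x ^+ 2.
    have e : W = conjc (1 - z) * (x ^+ 2)%:C.
      apply: (mulfI nz); rewrite /W divff// mulrA mulc_conj -rmorphM/= -exprMn.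
      by rewrite /x Normc.normcV divff ?expr1n// nc_eq0.
    by rewrite {1}e cReM /= mulr0 subr0; case: (1 - z).
  by rewrite ler_peMl ?exprn_ge0 ?(ltW x0)// cReD cReN /=; lra.
pose s := 3 / 4 * x ^+ 2.
have s0 : 0 < s by rewrite mulr_gt0// exprn_gt0.
have slW : s + l <= cRe W by rewrite /s; lra.
pose lc := laplace_coef W.
have lcB i : nc (lc i) <= s ^- i * L l by exact: nc_laplace_coef.
pose F i n : R[i] := lc i * W ^+ i.+2 * ('C(n.+1, i.+1)%:R * W ^+ n).
pose G i n : R := nc (lc i) * x ^+ i.+2 * ('C(n.+1, i.+1)%:R * (x / 3) ^+ n).
(* The ratio [2 / 3] is [x * (x / 3) * (3 / 2) / s], where [3 / 2] bounds [(1 - x / 3)^-1]; [9 / 4]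
   is the square of that bound. The sum is [27 / 4 * L l], the constant announced above. *)
pose H i : R := L l * (9 / 4) * (2 / 3) ^+ i.
have q0 : 0 <= x / 3 by lra.
have q1 : x / 3 < 1 by lra.
have G0 i n : 0 <= G i n.
  apply: mulr_ge0; last by rewrite mulr_ge0// exprn_ge0.
  by apply: mulr_ge0; [exact: nc_ge0|exact/exprn_ge0/ltW].
have sG i : rsummable (G i) by exact: rsummableZ (rsum_negbin i q0 q1).1.
have GH i : rsum (G i) <= H i.
  rewrite /rsum RintegralZl//; last exact: (rsum_negbin i q0 q1).1.
  rewrite -/(rsum _) (rsum_negbin i q0 q1).2.
  have nb : x ^+ i.+2 * ((x / 3) ^+ i / (1 - x / 3) ^+ i.+2) <= s ^+ i * (9 / 4 * (2 / 3) ^+ i).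
    apply: (@le_trans _ _ (x ^+ i.+2 * ((x / 3) ^+ i * (3 / 2) ^+ i.+2))).
      rewrite ler_wpM2l ?exprn_ge0 ?(ltW x0)// ler_wpM2l ?exprn_ge0//.
      rewrite -exprVn lerXn2r// ?nnegrE ?invr_ge0; try lra.
      by rewrite invf_ple ?posrE; lra.
    have -> : x ^+ i.+2 * ((x / 3) ^+ i * (3 / 2) ^+ i.+2) =
        x ^+ 2 * (9 / 4) * (x * (x / 3) * (3 / 2)) ^+ i.
      rewrite !exprMn -(addn2 i) !exprD.
      by move: (x ^+ i) (3^-1 ^+ i) (3 ^+ i) (2^-1 ^+ i) => a b c e; lra.
    have -> : x * (x / 3) * (3 / 2) = s * (2 / 3) by rewrite /s; lra.
    rewrite exprMn mulrCA ler_wpM2l ?exprn_ge0 ?(ltW s0)//.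
    by rewrite ler_wpM2r ?exprn_ge0// ler_piMl// exprn_ile1// ltW.
  rewrite -mulrA; apply: (@le_trans _ _ (s ^- i * L l * (s ^+ i * (9 / 4 * (2 / 3) ^+ i)))).
    apply: ler_pM => //; first exact: nc_ge0.
    have q1' : 0 <= 1 - x / 3 by lra.
    by rewrite mulr_ge0 ?exprn_ge0 ?(ltW x0)// divr_ge0// exprn_ge0.
  rewrite (_ : s ^- i * L l * _ = (s ^- i * s ^+ i) * H i); last by rewrite /H; ring.
  by rewrite mulVf ?mul1r// expf_neq0// gt_eqF.
have h0 : 0 <= 2 / 3 :> R by lra.
have h1 : 2 / 3 < 1 :> R by lra.
have sH : rsummable H by exact: rsummableZ (rsum_geom h0 h1).1.
have eH : rsum H = 27 / 4 * L l.
  rewrite /rsum RintegralZl//; last exact: (rsum_geom h0 h1).1.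
  by rewrite -/(rsum _) (rsum_geom h0 h1).2; field.
have FG h : nc h <= 3^-1 -> forall i n, nc (F i n * h ^+ n) <= G i n.
  move=> h3 i n; rewrite /F /G Normc.normcM [nc (lc i * _ * _)]Normc.normcM [nc (lc i * _)]Normc.normcM.
  rewrite [nc (_%:R * _)]Normc.normcM !ncX nc_nat -/x -mulrA.
  apply: ler_wpM2l; first by apply: mulr_ge0; [exact: nc_ge0|exact/exprn_ge0/ltW].
  rewrite -mulrA; apply: ler_wpM2l => //; rewrite -exprMn.
  apply: lerXn2r; rewrite ?nnegrE ?mulr_ge0 ?nc_ge0 ?(ltW x0)//.
  exact: ler_wpM2l (ltW x0) _ _ h3.
have n3 : nc (3^-1)%:C = 3^-1 :> R by rewrite ncR ger0_norm.
have sF n : csummable (fun i => F i n).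
  have := rsummableZ (3 ^+ n) sH; move/csummable_le; apply=> i.
  have := FG (3^-1)%:C; rewrite n3 => /(_ (lexx _) i n).
  rewrite Normc.normcM ncX n3 exprVn ler_pdivrMr ?exprn_gt0// mulrC => /le_trans; apply.
  rewrite ler_wpM2l ?exprn_ge0//; apply: le_trans (GH i).
  exact: (term_le_rsum _ (G0 i) (sG i)).
exists (fun n => csum (F ^~ n)); split.
  move=> n; rewrite -eH mulrC -[3 ^+ n](ger0_norm (exprn_ge0 _ _))//.
  rewrite -RintegralZl//.
  apply: nc_csum; first exact: rsummableZ.
  move=> i; have := FG (3^-1)%:C; rewrite n3 => /(_ (lexx _) i n).
  rewrite Normc.normcM ncX n3 exprVn ler_pdivrMr ?exprn_gt0// mulrC => /le_trans; apply.
  rewrite ger0_norm ?exprn_ge0// ler_wpM2l ?exprn_ge0//; apply: le_trans (GH i).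
  exact: (term_le_rsum _ (G0 i) (sG i)).
move=> h h3.
have uW : nc (h * W) < 1.
  rewrite Normc.normcM; apply: le_lt_trans (_ : 3^-1 < 1); last by lra.
  by apply: le_trans (ler_pM _ _ (ltW h3) x1) _; rewrite ?nc_ge0// mulr1.
have u1 : 1 - h * W != 0.
  by apply: contraTneq uW => /eqP; rewrite subr_eq0 => /eqP <-; rewrite nc1 ltxx.
pose w := (1 - (z + h))^-1.
have wE : w = W / (1 - h * W).
  have e : 1 - (z + h) = (1 - z) * (1 - h * W).
    by rewrite mulrBr mulr1 /W mulrCA divff// mulr1; ring.
  by rewrite /w e invfM.
have wW : w - W = h * W ^+ 2 / (1 - h * W) by rewrite wE; field.
(* [nc (1 - h * W)] exceeds [2 / 3], so [nc (w - W)] is less than [x ^+ 2 / 2], below [s]. *)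
have wWs : nc (w - W) < s.
  rewrite wW Normc.normcM [nc (h * _)]Normc.normcM Normc.normcV ncX -/x.
  have lo : 2 / 3 < nc (1 - h * W).
    have := ncD (1 - h * W) (h * W); rewrite subrK nc1.
    have : nc (h * W) < 3^-1.
      by rewrite Normc.normcM -/x; apply: le_lt_trans h3; rewrite ler_piMr ?nc_ge0.
    lra.
  rewrite ltr_pdivrMr; last by lra.
  rewrite /s; have := exprn_gt0 2 x0; move: (nc h) (nc_ge0 h) h3 (nc (1 - _)) lo (x ^+ 2) => a a0 a3 b b0 y y0.
  nra.
rewrite /exp_family -/w.
have -> : cint mu (fun t => P t * (w ^+ 2 * cexp (- ((S t)%:C * w)))) =
    w ^+ 2 * ps lc (w - W).
  rewrite -(laplace_expansion s0 l0 slW wWs) -cintZ.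
    by apply: eq_cint => t; ring.
  apply: integrable_exp l0 _.
  have := le_trans (ler_norm _) (Re_le_nc (W - w)).
  rewrite cReD cReN -ncN opprB; lra.
rewrite /ps -csumZ; last first.
  apply: (@psok_csummable _ _ (nc (w - W))) => //.
  have [] // := @psok_geom _ lc (L l) _ s (nc_ge0 _) wWs.
  by move=> i; rewrite mulrC -ler_pdivlMl ?exprn_gt0.
have [E _] := csum_swap (FG h (ltW h3)) sG GH sH.
transitivity (csum (fun i => csum (fun n => F i n * h ^+ n))); last first.
  rewrite E; apply: eq_csum => n; rewrite [RHS]mulrC -(csumZ _ (sF n)).
  by apply: eq_csum => i; rewrite mulrC.
apply: eq_csum => i; have [sn en] := csum_negbin i uW.
transitivity (lc i * W ^+ i.+2 * csum (fun n => 'C(n.+1, i.+1)%:R * (h * W) ^+ n)).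
  rewrite en wW wE -[((1 - h * W) ^+ i.+2)^-1]exprVn.
  move: (1 - h * W)^-1 => D.
  rewrite [(h * W ^+ 2 * D) ^+ i]exprMn [(h * W ^+ 2) ^+ i]exprMn [(h * W) ^+ i]exprMn.
  rewrite [(W ^+ 2) ^+ i]exprAC -(addn2 i) [W ^+ (i + 2)]exprD [D ^+ (i + 2)]exprD.
  by move: (W ^+ i) (D ^+ i) (h ^+ i) (lc i) => a b c e; ring.
rewrite -(csumZ _ sn); apply: eq_csum => n; rewrite /F exprMn; ring.
Qed.

End exponential_family.

Section entire.
Context {R : realType}.

Lemma ps_neg (a : nat -> R[i]) z : ps (fun k => (-1) ^+ k * a k) z = ps a (- z).
Proof. by apply: eq_csum => k; rewrite [(- z) ^+ k]exprNn; ring. Qed.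

(** Only values on a short real segment tie [A] and [B] to [e]. The signs come from [z = - x]: the
    Taylor coefficients at 0 are [(-1) ^+ k * e k] for [A] and [e k] for [B], as [bootstrap]
    requires. *)
Lemma left_analytic_entire (A B : R[i] -> R[i]) (e : nat -> R[i]) (r : R) :
  left_analytic A -> left_analytic B -> 0 < r -> psok e r ->
  (forall x, 0 < x -> x < r -> A (- x%:C) = ps e x%:C) ->
  (forall x, 0 < x -> x < r -> B (- x%:C) = ps e (- x%:C)) ->
  forall rho : R, exists C : R, forall k, nc (e k) * rho ^+ k <= C.
Proof.
move=> lA lB r0 se Ae Be rho.
have [KA /(_ 0 (lexx _))] := lA 0; rewrite nc0 => /(_ (lexx _))[al [alK Aal]].
have [KB /(_ 0 (lexx _))] := lB 0; rewrite nc0 => /(_ (lexx _))[be [beK Bbe]].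
pose q := Num.min r 4^-1.
have q0 : 0 < q by rewrite lt_min; apply/andP; split => //; lra.
have qr : q <= r by rewrite ge_min lexx.
have q3 : q < 3^-1 by rewrite gt_min; apply/orP; right; lra.
have ok K (a : nat -> R[i]) : (forall j, nc (a j) <= K * 3 ^+ j) -> psok a q.
  move=> aK; have [] // := @psok_geom _ a K q 3^-1 (ltW q0) q3.
  by move=> n; rewrite exprVn ler_pdivrMr ?exprn_gt0.
have ok' K (a : nat -> R[i]) : (forall j, nc (a j) <= K * 3 ^+ j) ->
    psok (fun k => (-1) ^+ k * a k) q.
  by move=> aK; apply: (ok K) => j; rewrite alternate_bound.
have seq := psok_le se (ltW q0) qr.
have nx x : 0 < x -> x < q -> nc (- x%:C) < 3^-1 :> R.
  by move=> x0 xq; rewrite ncN ncR ger0_norm ?ltW//; lra.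
have E1 : forall j, (fun k => (-1) ^+ k * al k) j = e j.
  apply: (ps_inj q0 (ok' _ _ alK) seq) => x x0 xq.
  by rewrite ps_neg -Aal ?nx// add0r Ae//; lra.
have seq' : psok (fun k => (-1) ^+ k * e k) q.
  by move: seq; rewrite /psok; under [in X in _ -> X]eq_fun do rewrite alternate_bound.
have E2 : forall j, (fun k => (-1) ^+ k * be k) j = (fun k => (-1) ^+ k * e k) j.
  apply: (ps_inj q0 (ok' _ _ beK) seq') => x x0 xq.
  by rewrite !ps_neg -Bbe ?nx// add0r Be//; lra.
have s1 k : (-1) ^+ k * (-1) ^+ k = 1 :> R[i].
  by rewrite -exprD addnn -mul2n exprM sqrrN !expr1n.
have E3 j : be j = (-1) ^+ j * al j.
  by rewrite E1 -[be j]mul1r -(s1 j) -mulrA E2 mulrA s1 mul1r.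
have i3 : 0 < 3^-1 :> R by rewrite invr_gt0.
have [|||C HC] := @bootstrap _ A B al KA 3^-1 lA lB i3 _ _ _ rho.
- by move=> h h3; have := Aal h h3; rewrite add0r.
- move=> h h3; have := Bbe h h3; rewrite add0r => ->.
  by apply: eq_csum => j; rewrite E3.
- by move=> k; rewrite exprVn ler_pdivrMr ?exprn_gt0.
by exists C => k; rewrite -E1 alternate_bound.
Qed.

End entire.

Section shifts.
Context {R : realType}.
Implicit Types (u : nat -> R).

Lemma rsum_unpeel u : rsummable (fun k => u k.+1) ->
  rsummable u /\ rsum u = u 0%N + rsum (fun k => u k.+1).
Proof.
move=> sS; suff su : rsummable u by split=> //; have [] := rsum_peel su.
have sa : rsummable (fun k => `|u k.+1|) by exact: integrable_norm sS.
have h := ge0_rsum_cvg (fun k => normr_ge0 _) sa.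
have h' : series (fun k => `|u k|) @ \oo --> `|u 0%N| + rsum (fun k => `|u k.+1|).
  rewrite -cvg_shiftS.
  have -> : (fun n => series (fun k => `|u k|) n.+1) =
      (fun n => `|u 0%N| + series (fun k => `|u k.+1|) n).
    by apply/funext => n; rewrite /series /= big_nat_recl.
  by apply: cvgD => //; exact: cvg_cst.
have [sn _] := ge0_rsummable (fun k => normr_ge0 (u k)) h'.
by apply: rsummable_le sn _.
Qed.

Lemma rsum_unshift u j : (forall k, (k < j)%N -> u k = 0) ->
  rsummable (fun k => u (j + k)%N) ->
  rsummable u /\ rsum u = rsum (fun k => u (j + k)%N).
Proof.
elim: j u => [|j IH] u u0 su; first by split.
have [sS eS] := IH _ (fun k kj => u0 k.+1 kj) su.
by have [? ->] := rsum_unpeel sS; rewrite u0// add0r eS.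
Qed.

End shifts.

(** * Hermite polynomials and Gaussian integrals *)

Section hermite.
Context {R : realType}.
Implicit Types (x y r : R) (n k : nat).

(** Carrying two consecutive Hermite polynomials turns the three-term recurrence into a structural
    recursion. *)
Fixpoint herm2 x n : R * R :=
  if n is n'.+1 then
    let: (a, b) := herm2 x n' in (b, 2 * x * b - 2 * n'.+1%:R * a)
  else (1, 2 * x).

Definition herm n x : R := (herm2 x n).1.

Lemma herm0 x : herm 0 x = 1. Proof. by []. Qed.

Lemma herm1 x : herm 1 x = 2 * x. Proof. by []. Qed.

Lemma hermSS n x : herm n.+2 x = 2 * x * herm n.+1 x - 2 * n.+1%:R * herm n x.
Proof. by rewrite /herm /=; case: (herm2 x n). Qed.

Lemma is_derive_herm n x : is_derive x (1 : R) (herm n.+1) (2 * n.+1%:R * herm n x).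
Proof.
suff : is_derive x (1 : R) (herm n.+1) (2 * n.+1%:R * herm n x) /\
  is_derive x (1 : R) (herm n.+2) (2 * n.+2%:R * herm n.+1 x) by case.
elim: n => [|n [IH1 IH2]].
  have h1 : is_derive x (1 : R) (herm 1) (2 * 1 * herm 0 x).
    rewrite (_ : herm 1 = fun x => 2 * x); last by apply/funext => y.
    by apply: is_derive_eq; rewrite /GRing.scale /= herm0; ring.
  split=> //.
  rewrite (_ : herm 2 = fun x => 2 * x * herm 1 x - 2); last first.
    by apply/funext => y; rewrite hermSS herm0; ring.
  by apply: is_derive_eq; rewrite /GRing.scale /= herm0 herm1; ring.
split=> //.
rewrite (_ : herm n.+3 = fun x => 2 * x * herm n.+2 x - 2 * n.+2%:R * herm n.+1 x); last first.
  by apply/funext => y; rewrite hermSS.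
apply: is_derive_eq; rewrite /GRing.scale /= hermSS -!natr1; ring.
Qed.

Lemma herm_rodrigues n x : derive1n n (fun y : R => expR (- y ^+ 2)) x =
  (-1) ^+ n * herm n x * expR (- x ^+ 2).
Proof.
elim: n x => [|n IH] x; first by rewrite derive1n0 herm0 expr0 !mul1r.
rewrite derive1nS.
have -> : derive1n n (fun y : R => expR (- y ^+ 2)) = (fun y => (-1) ^+ n * herm n y * expR (- y ^+ 2)).
  by apply/funext.
rewrite derive1E.
case: n {IH} => [|n].
  have -> : (fun y => (-1) ^+ 0 * herm 0 y * expR (- y ^+ 2)) = (fun y : R => expR (- y ^+ 2)).
    by apply/funext => y; rewrite herm0 expr0 !mul1r.
  apply: derive_val; apply: is_derive_eq; rewrite /GRing.scale /= herm1; ring.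
have h := is_derive_herm n x.
apply: derive_val; apply: is_derive_eq; rewrite /GRing.scale /= hermSS !exprS; ring.
Qed.

(* The coefficient of [z ^ n] in [exp (- z ^ 2) * exp (2 x z)] contributed by
   the [k]-th term of the first series. *)
Let term x k n : R := if (k.*2 <= n)%N then
  (-1) ^+ k / k`!%:R * ((2 * x) ^+ (n - k.*2) / (n - k.*2)`!%:R) else 0.

Let fact_neq0 n : n`!%:R != 0 :> R. Proof. by rewrite pnatr_eq0 -lt0n fact_gt0. Qed.

Let termS x k n : ((n.+1)%:R - (k.*2)%:R) * term x k n.+1 = 2 * x * term x k n.
Proof.
rewrite /term; have [kn|nk] := leqP k.*2 n.
  rewrite (leqW kn) subSn// factS natrM exprS -natrB ?leqW// subSn//.
  have := fact_neq0 k; have := fact_neq0 (n - k.*2).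
  have : (n - k.*2).+1%:R != 0 :> R by rewrite pnatr_eq0.
  move: (_ ^+ (n - _)) => a ? ? ?; field; by apply/and3P.
have [kn|_] := leqP k.*2 n.+1; last by rewrite !mulr0.
have -> : k.*2 = n.+1 by apply/eqP; rewrite eqn_leq kn.
by rewrite subrr mul0r mulr0.
Qed.

Let termD x k n : (k.+1.*2)%:R * term x k.+1 n.+2 = - 2 * term x k n.
Proof.
rewrite /term doubleS !ltnS; case: ifP => kn; last by rewrite !mulr0.
rewrite !subSS factS natrM exprS.
have -> : (k.*2.+2)%:R = 2 * k.+1%:R :> R by rewrite -doubleS -muln2 natrM mulrC.
have k0 : k.+1%:R != 0 :> R by rewrite pnatr_eq0.
have := fact_neq0 k; have := fact_neq0 (n - k.*2).
move: (_ ^+ (n - _)) => a ? ?; field; by apply/and3P.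
Qed.

Let term0 x k n : (n < k.*2)%N -> term x k n = 0.
Proof. by move=> nk; rewrite /term leqNgt nk. Qed.

Let sum_term x n N : (n < N)%N -> \sum_(k < N) term x k n = \sum_(k < n.+1) term x k n.
Proof.
move=> nN; rewrite -!(big_mkord xpredT (fun k => term x k n)) (@big_cat_nat _ _ _ n.+1)//=.
rewrite [X in _ + X]big1_seq ?addr0// => k /=.
rewrite mem_index_iota => /andP[nk _]; rewrite term0//.
by rewrite -addnn ltn_addr.
Qed.

(** Both sides obey the same three-term recurrence: the factor [n.+2] is split as
    [(n.+2 - 2k) + 2k], the first part lowering the power of [2 * x] ([termS]), the second shifting
    [k] ([termD]). *)
Lemma herm_sum x n : herm n x / n`!%:R = \sum_(k < n.+1) term x k n.
Proof.
suff : herm n x / n`!%:R = \sum_(k < n.+1) term x k n /\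
       herm n.+1 x / n.+1`!%:R = \sum_(k < n.+2) term x k n.+1 by case.
elim: n => [|n [IH1 IH2]].
  rewrite herm0 herm1 !big_ord_recr !big_ord0 /term /= !expr0 expr1 (factS 0) !fact0 muln1.
  by split; field.
split=> //.
have e : n.+2%:R * (\sum_(k < n.+3) term x k n.+2) =
    2 * x * (\sum_(k < n.+2) term x k n.+1) - 2 * \sum_(k < n.+1) term x k n.
  rewrite -(@sum_term x n.+1 n.+3)// -(@sum_term x n n.+2)// !mulr_sumr.
  transitivity (\sum_(k < n.+3) 2 * x * term x k n.+1 + \sum_(k < n.+3) (k.*2)%:R * term x k n.+2).
    by rewrite -big_split; apply: eq_bigr => k _ /=; rewrite -termS -mulrDl subrK.
  congr (_ + _); rewrite big_ord_recl /= mul0r add0r -sumrN.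
  by apply: eq_bigr => k _; rewrite /bump /= add1n termD mulNr.
have n0 : n.+2%:R != 0 :> R by rewrite pnatr_eq0.
apply: (mulfI n0); rewrite e -IH1 -IH2 hermSS !factS !natrM.
have := fact_neq0 n; have : n.+1%:R != 0 :> R by rewrite pnatr_eq0.
by move=> ? ?; field; apply/and3P.
Qed.

Let G x r k n : R := if (k.*2 <= n)%N then
  (r ^+ 2) ^+ k / k`!%:R * ((2 * `|x| * r) ^+ (n - k.*2) / (n - k.*2)`!%:R) else 0.

Let G_ge0 x r k n : 0 <= r -> 0 <= G x r k n.
Proof.
move=> r0; rewrite /G; case: ifP => // _.
by rewrite mulr_ge0// divr_ge0// exprn_ge0// ?exprn_ge0// !mulr_ge0.
Qed.

Let norm_term x r k n : 0 <= r -> `|term x k n| * r ^+ n = G x r k n.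
Proof.
move=> r0; rewrite /term /G; case: ifP => kn; last by rewrite normr0 mul0r.
rewrite !normrM !normrX normrN1 expr1n !normfV !(ger0_norm (ler0n _ _)).
have -> : r ^+ n = r ^+ (n - k.*2) * (r ^+ 2) ^+ k by rewrite -exprM mul2n -exprD subnK.
rewrite [(2 * `|x| * r) ^+ _]exprMn.
have -> : `|2 * x| = 2 * `|x| by rewrite normrM ger0_norm.
by move: ((2 * `|x|) ^+ _) (r ^+ (n - _)) ((r ^+ 2) ^+ k) => a b c; ring.
Qed.

Let rsum_G x r k : 0 <= r -> rsummable (G x r k) /\
  rsum (G x r k) = expR (2 * `|x| * r) * ((r ^+ 2) ^+ k / k`!%:R).
Proof.
move=> r0; have x0 : 0 <= 2 * `|x| * r by rewrite !mulr_ge0.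
have [s e] := rsum_exp x0.
have E n : G x r k (k.*2 + n)%N = (r ^+ 2) ^+ k / k`!%:R * ((2 * `|x| * r) ^+ n / n`!%:R).
  by rewrite /G leq_addr addKn.
have [||sG eG] := @rsum_unshift R (G x r k) k.*2.
- by move=> n nk; rewrite /G leqNgt nk.
- by under eq_fun do rewrite E; exact: rsummableZ.
by split=> //; rewrite eG (eq_rsum E) /rsum RintegralZl// -/(rsum _) e mulrC.
Qed.

Let rsum_H x r : 0 <= r ->
  rsummable (fun k => expR (2 * `|x| * r) * ((r ^+ 2) ^+ k / k`!%:R)) /\
  rsum (fun k => expR (2 * `|x| * r) * ((r ^+ 2) ^+ k / k`!%:R)) = expR (2 * `|x| * r + r ^+ 2).
Proof.
move=> r0; have [s e] := rsum_exp (sqr_ge0 r).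
by split; [exact: rsummableZ|rewrite /rsum RintegralZl// -/(rsum _) e -expRD].
Qed.

(** Absolute values in the double series of the generating function leave the same series with all
    signs positive. Its sum is the right-hand side, and each coefficient is bounded by the whole
    sum. *)
Lemma herm_gf_dom x r n : 0 <= r -> `|herm n x| / n`!%:R * r ^+ n <= expR (2 * `|x| * r + r ^+ 2).
Proof.
move=> r0; have [sH eH] := rsum_H x r0.
rewrite -[n`!%:R](ger0_norm (ler0n _ _)) -normfV -normrM herm_sum.
have sG : rsummable (fun k => G x r k n).
  apply: rsummable_le sH _ => k; rewrite ger0_norm ?G_ge0//.
  by have [s <-] := rsum_G x k r0; apply: (term_le_rsum _ _ s) => m; exact: G_ge0.
apply: (@le_trans _ _ (\sum_(k < n.+1) G x r k n)).
  rewrite -[r ^+ n](ger0_norm (exprn_ge0 _ r0)) -normrM mulr_suml.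
  apply: le_trans (ler_norm_sum _ _ _) _; apply: ler_sum => k _.
  by rewrite normrM [`|r ^+ n|]ger0_norm ?exprn_ge0// norm_term.
have [|_ <-] := @rsum_finite R (fun k => G x r k n) n.+1.
  move=> k nk; rewrite /G; case: leqP => // kn.
  by have := leq_trans nk (leq_trans (leq_addr k k) (_ : k + k <= n)%N); rewrite addnn ltnn => /(_ kn).
rewrite -eH; apply: le_rsum => // k.
by have [s <-] := rsum_G x k r0; apply: (term_le_rsum _ _ s) => m; exact: G_ge0.
Qed.

Lemma psok_herm x r : 0 <= r -> psok (fun n => (herm n x / n`!%:R)%:C) r.
Proof.
move=> r0; have r1 : r < r + 1 by rewrite ltrDl.
have [] // := @psok_geom _ (fun n => (herm n x / n`!%:R)%:C) (expR (2 * `|x| * (r + 1) + (r + 1) ^+ 2)) r _ r0 r1.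
move=> n; rewrite ncR normrM normfV [X in _ / X]ger0_norm//.
by apply: herm_gf_dom; rewrite addr_ge0.
Qed.

Lemma herm_gf x (z : R[i]) :
  cexp ((2 * x)%:C * z - z ^+ 2) = ps (fun n => (herm n x / n`!%:R)%:C) z.
Proof.
have z0 := nc_ge0 z; set r := nc z in z0.
pose F k n : R[i] := (term x k n)%:C * z ^+ n.
have FG k n : nc (F k n) <= G x r k n.
  by rewrite /F Normc.normcM ncR ncX norm_term.
have sG k := (rsum_G x k z0).1.
have eG k : rsum (G x r k) <= expR (2 * `|x| * r) * ((r ^+ 2) ^+ k / k`!%:R).
  by rewrite (rsum_G x k z0).2.
have [E _] := csum_swap FG sG eG (rsum_H x z0).1.
transitivity (csum (fun k => csum (F k))); last first.
  rewrite E; apply: eq_csum => n; rewrite herm_sum.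
  have [|_ ->] := @csum_finite R (F ^~ n) n.+1.
    move=> k nk; have nk2 : (n < k.*2)%N by rewrite -addnn ltn_addr.
    by rewrite /F (term0 x nk2) mul0r.
  by rewrite rmorph_sum/= mulr_suml.
have -> : cexp ((2 * x)%:C * z - z ^+ 2) = cexp ((2 * x)%:C * z) * ps ifact (- z ^+ 2).
  by rewrite cexpD -cexp_ps.
rewrite /ps -csumZ; last exact: psok_csummable (psok_ifact (nc_ge0 _)).1 (lexx _).
apply: eq_csum => k.
have sF : csummable (F k) by apply: csummable_le (sG k) (FG k).
have [|_ ->] := csum_shift (j := k.*2) sF.
  by move=> n nk; rewrite /F (term0 x nk) mul0r.
rewrite cexp_ps /ps mulrC -csumZ; last exact: psok_csummable (psok_ifact (nc_ge0 _)).1 (lexx _).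
apply: eq_csum => n; rewrite /F /term leq_addr addKn /ifact [(- z ^+ 2) ^+ k]exprNn.
rewrite -[(z ^+ 2) ^+ k]exprM mul2n [((2 * x)%:C * z) ^+ n]exprMn exprD.
rewrite -[(2 * x)%:C ^+ n]rmorphXn.
have -> : (-1) ^+ k = ((-1) ^+ k)%:C :> R[i] by rewrite rmorphXn rmorphN1.
move: ((2 * x) ^+ n) ((-1) ^+ k : R) (z ^+ k.*2) (z ^+ n) => a b c e.
by rewrite !rmorphM /=; ring.
Qed.

Lemma herm_norm_gt0 n : 0 < pi `^ (- 4^-1) * ((2 ^ n * n`!)%N%:R) `^ (- 2^-1) :> R.
Proof.
by rewrite mulr_gt0// powR_gt0 ?pi_gt0// ltr0n muln_gt0 expn_gt0 fact_gt0.
Qed.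

Lemma hermite_funE n x : hermite_fun n x =
  pi `^ (- 4^-1) * ((2 ^ n * n`!)%N%:R) `^ (- 2^-1) * (herm n x * expR (- (2^-1 * x ^+ 2))).
Proof.
rewrite /hermite_fun herm_rodrigues.
have -> : expR (- x ^+ 2) = expR (- (2^-1 * x ^+ 2)) * expR (- (2^-1 * x ^+ 2)).
  by rewrite -expRD; congr expR; lra.
have e : expR (2^-1 * x ^+ 2) * expR (- (2^-1 * x ^+ 2)) = 1 by rewrite -expRD subrr expR0.
have s : (-1) ^+ n * (-1) ^+ n = 1 :> R by rewrite -exprD addnn -mul2n exprM sqrrN !expr1n.
set c := pi `^ _ * _; set E := expR (- _).
transitivity ((-1) ^+ n * (-1) ^+ n * (expR (2^-1 * x ^+ 2) * E) * (c * (herm n x * E))).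
  by rewrite /c; ring.
by rewrite s e !mul1r.
Qed.

End hermite.

Section sum_integral_swap.
Context d (T : measurableType d) {R : realType}.
Variable mu : {sigma_finite_measure set T -> \bar R}.

Lemma cint_csum_swap (F : nat -> T -> R[i]) (H : T -> R) :
  (forall n, cmeas (F n)) ->
  (forall t, rsummable (fun n => nc (F n t)) /\ rsum (fun n => nc (F n t)) <= H t) ->
  mu.-integrable setT (EFin \o H) ->
  cint mu (fun t => csum (F ^~ t)) = csum (fun n => cint mu (F n)) /\
  csummable (fun n => cint mu (F n)).
Proof.
move=> mF FH iH.
pose m : {sigma_finite_measure set nat -> \bar R} := @counting nat R.
have mF' : cmeas (fun z : T * nat => F z.2 z.1).
  have [m1 m2] := cmeas_natX mF.
  by split; [exact: (measurableT_comp m1 (@measurable_swap _ _ T nat))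
            |exact: (measurableT_comp m2 (@measurable_swap _ _ T nat))].
have jF : cintegrable (mu \x m)%E (fun z => F z.2 z.1).
  apply: (@cintegrable_prod_dom _ _ _ _ _ mu m (fun t n => F n t) (fun t n => nc (F n t)) H) => //.
  - by move=> t; exact: (FH t).1.
  - by move=> t; exact: (FH t).2.
split; first by have := @cint_swap _ _ _ _ _ mu m (fun t n => F n t) jF.
by have := @cintegrable_fubini_G _ _ _ _ _ mu m (fun t n => F n t) jF.
Qed.

End sum_integral_swap.

Section gaussian.
Context {R : realType}.
Local Notation mu := (@lebesgue_measure R).
Local Notation cmeasR := (@cmeas _ (measurableTypeR R) R).
Implicit Types (a b c x y r : R) (z : R[i]).

Lemma gaussian_real a b : 0 < a ->
  mu.-integrable setT (EFin \o (fun x => expR (b * x - a * x ^+ 2))) /\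
  \int[mu]_x expR (b * x - a * x ^+ 2) = Num.sqrt (pi / a) * expR (b ^+ 2 / (4 * a)).
Proof.
move=> a0; pose s := Num.sqrt (2 * a)^-1; pose m := b / (2 * a).
have a2 : 0 < (2 * a)^-1 by rewrite invr_gt0 mulr_gt0.
have s0 : s != 0 by rewrite gt_eqF// sqrtr_gt0.
have ss : s ^+ 2 = (2 * a)^-1 by rewrite sqr_sqrtr// ltW.
pose K := Num.sqrt (pi / a) * expR (b ^+ 2 / (4 * a)).
have K0 : Num.sqrt (pi / a) != 0 by rewrite gt_eqF// sqrtr_gt0 divr_gt0// pi_gt0.
have E x : expR (b * x - a * x ^+ 2) = K * normal_pdf m s x.
  rewrite /normal_pdf (negPf s0) /normal_peak /normal_fun /K ss.
  have -> : (2 * a)^-1 * pi *+ 2 = pi / a :> R by field; rewrite gt_eqF.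
  rewrite mulrACA -mulrA mulrCA mulrA mulVf// mul1r -expRD; congr expR.
  by rewrite /m; field; rewrite gt_eqF.
have iE := integrable_scale K (integrable_normal_pdf m s).
split.
  by apply: eq_integrable iE => // x _; rewrite /= E.
transitivity (\int[mu]_x (K * normal_pdf m s x)); first by apply: eq_Rintegral => x _.
rewrite RintegralZl//; last exact: integrable_normal_pdf.
by rewrite /Rintegral integral_normal_pdf mulr1.
Qed.

Lemma gaussian_abs a c : 0 < a ->
  mu.-integrable setT (EFin \o (fun x => expR (c * `|x| - a * x ^+ 2))).
Proof.
move=> a0; have [i1 _] := gaussian_real c a0; have [i2 _] := gaussian_real (- c) a0.
have := integrableD measurableT i1 i2; apply: le_integrable => //.
  apply/measurable_EFinP; apply: measurableT_comp => //.
  apply: measurable_funB; apply: measurable_funM => //.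
move=> x _ /=; rewrite lee_fin (ger0_norm (expR_ge0 _)) (ger0_norm (addr_ge0 (expR_ge0 _) (expR_ge0 _))).
by case: (ger0P x) => _; rewrite ?mulrN ?mulNr ?lerDl ?lerDr ?expR_ge0.
Qed.

Lemma cmeas_cexp_lin z : cmeasR (fun x : R => cexp (z * x%:C)).
Proof.
apply: cmeas_cexp; apply: cmeasM; first exact: cmeas_cst.
by apply: cmeas_real; exact: measurable_id.
Qed.

Lemma cmeas_polyX n : cmeasR (fun x : R => x%:C ^+ n).
Proof. by apply: cmeasX; apply: cmeas_real; exact: measurable_id. Qed.

Section exponential_moments.
Variable phi : R -> R[i].
Hypothesis mphi : cmeasR phi.
Hypothesis iphi : forall r, 0 <= r ->
  mu.-integrable setT (EFin \o (fun x => nc (phi x) * expR (r * `|x|))).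

Let dom n x : 0 <= x -> x ^+ n / n`!%:R <= expR x.
Proof.
move=> x0; have [s <-] := rsum_exp x0.
by apply: (@term_le_rsum _ (fun k => x ^+ k / k`!%:R)) => // k; rewrite divr_ge0// exprn_ge0.
Qed.

Lemma cintegrable_moment n : cintegrable mu (fun x => phi x * x%:C ^+ n).
Proof.
apply: (integrable_cintegrable _ (integrable_scale n`!%:R (iphi ler01))).
- by apply: cmeasM => //; exact: cmeas_polyX.
- move=> x; rewrite Normc.normcM ncX ncR mulrCA ler_wpM2l ?nc_ge0//.
  by rewrite -ler_pdivrMl ?ltr0n ?fact_gt0// mulrC mul1r; exact: dom.
Qed.

Lemma cintegrable_cexp_lin z : cintegrable mu (fun x => phi x * cexp (z * x%:C)).
Proof.
apply: (integrable_cintegrable _ (iphi (nc_ge0 z))).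
- by apply: cmeasM => //; exact: cmeas_cexp_lin.
- move=> x; rewrite Normc.normcM nc_cexp ler_wpM2l ?nc_ge0// ler_expR.
  apply: le_trans (le_trans (ler_norm _) (Re_le_nc _)) _.
  by rewrite Normc.normcM ncR.
Qed.

(** The transform is entire and determined by the moments; Gaussian integrals with complex [z] are
    thereby reduced to real [z]. *)
Lemma cint_cexp_lin z :
  cint mu (fun x => phi x * cexp (z * x%:C)) =
    ps (fun n => ifact n * cint mu (fun x => phi x * x%:C ^+ n)) z /\
  forall r, 0 <= r -> psok (fun n => ifact n * cint mu (fun x => phi x * x%:C ^+ n)) r.
Proof.
have main w : cint mu (fun x => phi x * cexp (w * x%:C)) =
    ps (fun n => ifact n * cint mu (fun x => phi x * x%:C ^+ n)) w /\
    csummable (fun n => ifact n * cint mu (fun x => phi x * x%:C ^+ n) * w ^+ n).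
  pose F n x := ifact n * w ^+ n * (phi x * x%:C ^+ n).
  have mF n : cmeasR (F n).
    by apply: cmeasM; [exact: cmeas_cst|apply: cmeasM => //; exact: cmeas_polyX].
  have FH x : rsummable (fun n => nc (F n x)) /\
      rsum (fun n => nc (F n x)) <= nc (phi x) * expR (nc w * `|x|).
    have wx : 0 <= nc w * `|x| by rewrite mulr_ge0 ?nc_ge0.
    have [s e] := rsum_exp wx.
    have E n : nc (F n x) = nc (phi x) * ((nc w * `|x|) ^+ n / n`!%:R).
      rewrite /F Normc.normcM [nc (ifact n * _)]Normc.normcM [nc (phi x * _)]Normc.normcM !ncX !ncR.
      by rewrite ger0_norm ?invr_ge0// exprMn; ring.
    split; first by under eq_fun do rewrite E; exact: rsummableZ.
    by rewrite (eq_rsum E) /rsum RintegralZl// -/(rsum _) e.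
  have [E s] := @cint_csum_swap _ _ _ mu F _ mF FH (iphi (nc_ge0 w)).
  have Fn n : cint mu (F n) = ifact n * cint mu (fun x => phi x * x%:C ^+ n) * w ^+ n.
    by rewrite cintZ; [rewrite mulrAC|exact: cintegrable_moment].
  split; last by move: s; under eq_fun do rewrite Fn.
  rewrite /ps -(eq_csum Fn) -E; apply: eq_cint => x.
  rewrite cexp_ps /ps -csumZ; last exact: psok_csummable (psok_ifact (nc_ge0 _)).1 (lexx _).
  by apply: eq_csum => n; rewrite /F exprMn; ring.
split; first exact: (main z).1.
move=> r r0; have := csummable_nc (main r%:C).2.
have nr : nc r%:C = r by rewrite ncR ger0_norm.
by rewrite /psok; under eq_fun do rewrite Normc.normcM ncX nr.
Qed.

End exponential_moments.

Section gaussian_moments.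
Variable a : R.
Hypothesis a0 : 0 < a.

Definition gauss x : R[i] := (expR (- (a * x ^+ 2)))%:C.

Lemma cmeas_gauss : cmeasR gauss.
Proof.
apply: cmeas_real; apply: measurableT_comp => //; apply: measurable_funN.
by apply: measurable_funM => //; exact: measurable_funX.
Qed.

Lemma integrable_gauss_exp r :
  mu.-integrable setT (EFin \o (fun x => nc (gauss x) * expR (r * `|x|))).
Proof.
suff -> : (fun x => nc (gauss x) * expR (r * `|x|)) = (fun x => expR (r * `|x| - a * x ^+ 2)).
  exact: gaussian_abs.
by apply/funext => x; rewrite /gauss ncR ger0_norm ?expR_ge0// -expRD addrC.
Qed.

(** [i / (2 sqrt a)], chosen so that the Hermite generating function at [x = 0], taken at
    [kappa * z], is [exp (z ^+ 2 / (4 a))]; the Taylor coefficients of the Gaussian transform are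
    thus multiples of [herm n 0]. *)
Let kappa : R[i] := 0 +i* (2 * Num.sqrt a)^-1.

Let kappa2 : kappa ^+ 2 = - ((4 * a)^-1)%:C.
Proof.
have sa : Num.sqrt a != 0 by rewrite gt_eqF// sqrtr_gt0.
have e : (2 * Num.sqrt a)^-1 * (2 * Num.sqrt a)^-1 = (4 * a)^-1.
  by rewrite -{3}(sqr_sqrtr (ltW a0)); field.
by rewrite expr2; apply: complex_eqP => /=; rewrite ?e; ring.
Qed.

Let gcoef n : R[i] := (Num.sqrt (pi / a))%:C * ((herm n 0 / n`!%:R)%:C * kappa ^+ n).

Let psok_gcoef r : 0 <= r -> psok gcoef r.
Proof.
move=> r0; apply: psokZ.
have kr : 0 <= nc kappa * r by rewrite mulr_ge0 ?nc_ge0.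
have := psok_herm 0 kr; rewrite /psok; congr rsummable; apply/funext => n.
by rewrite [in RHS]Normc.normcM ncX exprMn mulrA.
Qed.

Let ps_gcoef z : ps gcoef z = (Num.sqrt (pi / a))%:C * cexp (z ^+ 2 * ((4 * a)^-1)%:C).
Proof.
have -> : cexp (z ^+ 2 * ((4 * a)^-1)%:C) = cexp ((2 * 0)%:C * (kappa * z) - (kappa * z) ^+ 2).
  by rewrite exprMn kappa2 mulr0 mul0r sub0r mulNr opprK mulrC.
rewrite herm_gf /ps -csumZ; last first.
  exact: psok_csummable (psok_herm 0 (nc_ge0 _)) (lexx _).
by apply: eq_csum => n; rewrite /gcoef exprMn !mulrA.
Qed.

Let moment n := ifact n * cint mu (fun x => gauss x * x%:C ^+ n).

(** Both power series take the same values at real arguments, by [gaussian_real]. *)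
Let moment_gcoef n : moment n = gcoef n.
Proof.
have igauss r (_ : 0 <= r) := integrable_gauss_exp r.
have sm := (cint_cexp_lin cmeas_gauss igauss 0).2 1 ler01.
apply: (ps_inj ltr01 sm (psok_gcoef ler01)) => x x0 x1.
rewrite -(cint_cexp_lin cmeas_gauss igauss x%:C).1 ps_gcoef -rmorphXn -rmorphM cexpR -rmorphM.
have [_ <-] := gaussian_real x a0.
rewrite -[RHS]cint_real; apply: eq_cint => y.
by rewrite -rmorphM cexpR -rmorphM -expRD addrC.
Qed.

Lemma gaussian_integral z :
  cint mu (fun x => gauss x * cexp (z * x%:C)) =
  (Num.sqrt (pi / a))%:C * cexp (z ^+ 2 * ((4 * a)^-1)%:C).
Proof.
have igauss r (_ : 0 <= r) := integrable_gauss_exp r.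
rewrite (cint_cexp_lin cmeas_gauss igauss z).1 -ps_gcoef.
exact: eq_csum (fun n => congr1 ( *%R ^~ _) (moment_gcoef n)).
Qed.

Let gaussian_moment n : cint mu (fun x => gauss x * x%:C ^+ n) =
  (Num.sqrt (pi / a))%:C * ((herm n 0)%:C * kappa ^+ n).
Proof.
have i0 : ifact n != 0 :> R[i].
  by rewrite -nc_eq0 ncR normr_eq0 invr_eq0 pnatr_eq0 -lt0n fact_gt0.
apply: (mulfI i0); have := moment_gcoef n; rewrite /moment => ->.
by rewrite /gcoef /ifact rmorphM /=; ring.
Qed.

Lemma gaussian_moment0 : cint mu (fun x => gauss x * x%:C ^+ 0) = (Num.sqrt (pi / a))%:C.
Proof. by rewrite gaussian_moment herm0 expr0 !mulr1. Qed.

Lemma gaussian_moment1 : cint mu (fun x => gauss x * x%:C ^+ 1) = 0.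
Proof. by rewrite gaussian_moment herm1 mulr0 mul0r mulr0. Qed.

Lemma gaussian_momentSS n : cint mu (fun x => gauss x * x%:C ^+ n.+2) =
  (n.+1%:R / (2 * a))%:C * cint mu (fun x => gauss x * x%:C ^+ n).
Proof.
rewrite !gaussian_moment 2!exprS [kappa * (kappa * _)]mulrA -expr2 kappa2 hermSS mulr0 mul0r sub0r.
have -> : n.+1%:R / (2 * a) = (2 * n.+1%:R) * (4 * a)^-1 by field; rewrite gt_eqF.
by rewrite rmorphN !rmorphM /=; ring.
Qed.

Lemma gaussian_second_moment :
  cint mu (fun x => gauss x * x%:C ^+ 2) = (Num.sqrt (pi / a) / (2 * a))%:C.
Proof.
have := moment_gcoef 2; rewrite /moment /gcoef kappa2 hermSS herm0 /ifact => E.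
have i2 : (2`!%:R^-1)%:C != 0 :> R[i] by rewrite -nc_eq0 ncR normr_eq0 invr_eq0 pnatr_eq0.
apply: (mulfI i2); rewrite E -rmorphN -!rmorphM; congr (_%:C).
have an0 : a != 0 by rewrite gt_eqF.
have -> : 2`!%:R = 2 :> R by [].
by field.
Qed.

(** The derivative in [z] of [gaussian_integral], carried out on Taylor coefficients; the recurrence
    for [herm n 0] replaces the differentiation. *)
Lemma gaussian_first_moment z :
  cint mu (fun x => gauss x * x%:C * cexp (z * x%:C)) =
  z * ((Num.sqrt (pi / a) / (2 * a))%:C * cexp (z ^+ 2 * ((4 * a)^-1)%:C)).
Proof.
have mg : cmeasR (fun x => gauss x * x%:C).
  apply: cmeasM; first exact: cmeas_gauss.
  by apply: cmeas_real; exact: measurable_id.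
have ig r : 0 <= r -> mu.-integrable setT (EFin \o (fun x => nc (gauss x * x%:C) * expR (r * `|x|))).
  move=> r0; apply: integrable_dom (integrable_gauss_exp (r + 1)) _.
    apply: measurable_funM; first exact: measurable_nc.
    by apply: measurableT_comp => //; apply: measurable_funM.
  move=> x; rewrite ger0_norm ?mulr_ge0 ?nc_ge0 ?expR_ge0//.
  rewrite Normc.normcM -mulrA ler_wpM2l ?nc_ge0// mulrDl expRD mulrC ler_wpM2l ?expR_ge0//.
  by rewrite ncR mul1r; apply: le_trans (expR_ge1Dx _); rewrite lerDr.
have [-> ok] := cint_cexp_lin mg ig z.
set b := (fun n => _) in ok *.
have bE n : b n.+1 = (2 * a)^-1%:C * gcoef n.
  have e : b n.+1 = n.+2%:R * moment n.+2.
    rewrite /b /moment; have -> : ifact n.+1 = n.+2%:R * ifact n.+2 :> R[i].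
      rewrite natrC -rmorphM; congr (_%:C); rewrite (factS n.+1) natrM.
      have f0 : n.+1`!%:R != 0 :> R by rewrite pnatr_eq0 -lt0n fact_gt0.
      have n2 : n.+2%:R != 0 :> R by rewrite pnatr_eq0.
      by rewrite invfM mulrA divff ?mul1r.
    rewrite -mulrA; congr (_ * (_ * _)); apply: eq_cint => x.
    by rewrite -mulrA -exprS.
  rewrite e moment_gcoef /gcoef 2!exprS [kappa * (kappa * _)]mulrA -expr2 kappa2.
  have hs : n.+2%:R * (herm n.+2 0 / n.+2`!%:R) * (4 * a)^-1 = - ((2 * a)^-1 * (herm n 0 / n`!%:R)).
    rewrite hermSS !factS !natrM.
    have f0 : n`!%:R != 0 :> R by rewrite pnatr_eq0 -lt0n fact_gt0.
    have n1 : n.+1%:R != 0 :> R by rewrite pnatr_eq0.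
    have n2 : n.+2%:R != 0 :> R by rewrite pnatr_eq0.
    have an0 : a != 0 by rewrite gt_eqF.
    by field; apply/and4P.
  transitivity (- ((Num.sqrt (pi / a))%:C * (n.+2%:R * (herm n.+2 0 / n.+2`!%:R) * (4 * a)^-1)%:C * kappa ^+ n)).
    by rewrite natrC !rmorphM /=; ring.
  by rewrite hs rmorphN !rmorphM /=; ring.
have b0 : b 0%N = 0.
  have -> : b 0%N = moment 1.
    rewrite /b /moment /ifact (factS 0) mul1n.
    by congr (_ * _); apply: eq_cint => x; rewrite expr0 mulr1 expr1.
  by rewrite moment_gcoef /gcoef herm1 mulr0 mul0r mul0r mulr0.
have z1 : 0 < nc z + 1 by rewrite ltr_wpDl ?nc_ge0.
rewrite (psS z1 (ok _ (ltW z1))) ?lerDl// b0 add0r; congr (_ * _).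
rewrite /ps (eq_csum (fun n => congr1 ( *%R ^~ (z ^+ n)) (bE n))).
rewrite -/(ps (fun n => (2 * a)^-1%:C * gcoef n) z) (psZ _ (psok_gcoef (nc_ge0 z)) (lexx _)).
by rewrite ps_gcoef rmorphM /=; ring.
Qed.

End gaussian_moments.
End gaussian.

(** * Bargmann transform and the Fourier transform *)

Section square_integrable.
Context {R : realType}.
Local Notation mu := (@lebesgue_measure R).
Local Notation cmeasR := (@cmeas _ (measurableTypeR R) R).
Implicit Types (f g : R -> R[i]).

Lemma normc_poweR2 f x : (`|(nc (f x))%:E| `^ 2 = (nc (f x) ^+ 2)%:E)%E.
Proof. by rewrite abse_EFin ger0_norm ?nc_ge0// poweR_EFin powR_mulrn ?nc_ge0. Qed.

Lemma cLfun2P f : cLfun 2%:E f <->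
  cmeasR f /\ mu.-integrable setT (EFin \o (fun x => nc (f x) ^+ 2)).
Proof.
have E : (\int[mu]_x `|(nc (f x))%:E| `^ 2 = \int[mu]_x (nc (f x) ^+ 2)%:E)%E.
  by apply: eq_integral => x _; rewrite normc_poweR2.
have A : (\int[mu]_x `|(nc (f x) ^+ 2)%:E| = \int[mu]_x (nc (f x) ^+ 2)%:E)%E.
  by apply: eq_integral => x _; rewrite abse_EFin ger0_norm ?sqr_ge0.
split=> [[mf foo]|[mf /integrableP[m2 foo]]]; split=> //.
- apply/integrableP; split.
    by apply/measurable_EFinP; apply: measurable_funX; exact: measurable_nc mf.
  by rewrite /= A -E -poweR_Lnorm// poweR_lty.
- by rewrite /cLnorm unlock E poweR_lty// -A.
Qed.

Lemma cLfun1P f : cLfun 1%:E f <-> cintegrable mu f.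
Proof.
have A : (\int[mu]_x `|(nc (f x))%:E| = \int[mu]_x `|nc (f x)|%:E)%E by [].
split=> [[mf foo]|[mf /integrableP[m1 foo]]].
- split=> //; apply/integrableP; split; first exact/measurable_EFinP/measurable_nc.
  by move: foo; rewrite /cLnorm Lnorm1.
- by split=> //; rewrite /cLnorm Lnorm1.
Qed.

Lemma cintegrable_mul f g : cmeasR f -> cmeasR g ->
  mu.-integrable setT (EFin \o (fun x => nc (f x) ^+ 2)) ->
  mu.-integrable setT (EFin \o (fun x => nc (g x) ^+ 2)) ->
  cintegrable mu (fun x => f x * g x).
Proof.
move=> mf mg if2 ig2; have iS := integrableD measurableT if2 ig2.
apply: (integrable_cintegrable _ iS); first exact: cmeasM mf mg.
move=> x; rewrite Normc.normcM.
have := sqr_ge0 (nc (f x) - nc (g x)); have := sqr_ge0 (nc (f x) + nc (g x)).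
move: (nc (f x)) (nc (g x)) => a b; rewrite !expr2 => ? ?; nra.
Qed.

Lemma nc_cint_mul f g (e B : R) : cmeasR f -> cmeasR g ->
  mu.-integrable setT (EFin \o (fun x => nc (f x) ^+ 2)) ->
  mu.-integrable setT (EFin \o (fun x => nc (g x) ^+ 2)) ->
  (cLnorm 2%:E f <= e%:E)%E -> (cLnorm 2%:E g <= B%:E)%E ->
  nc (cint mu (fun x => f x * g x)) <= e * B.
Proof.
move=> mf mg if2 ig2 fe gB; have j := cintegrable_mul mf mg if2 ig2.
apply: le_trans (nc_cint j) _; rewrite -lee_fin.
have [_ ij] := j; rewrite /Rintegral fineK; last exact: integrable_fin_num.
have p2 : 0 < 2 :> R by [].
have pq : 2^-1 + 2^-1 = 1 :> R by lra.
have := hoelder mu (measurable_nc mf) (measurable_nc mg) p2 p2 pq.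
rewrite Lnorm1 => h.
apply: (@le_trans _ _ (cLnorm 2%:E f * cLnorm 2%:E g)%E); last first.
  by rewrite EFinM lee_pmul// Lnorm_ge0.
apply: le_trans h; rewrite le_eqVlt; apply/orP; left; apply/eqP.
apply: eq_integral => x _.
by rewrite Normc.normcM abse_EFin ger0_norm ?mulr_ge0 ?nc_ge0.
Qed.

End square_integrable.

Section coherent_states.
Context {R : realType}.
Local Notation mu := (@lebesgue_measure R).
Local Notation cmeasR := (@cmeas _ (measurableTypeR R) R).
Implicit Types (f g : R -> R[i]) (x y r c : R) (z : R[i]).

(* The generating function of the functions [herm n x * expR (- (x ^+ 2 / 2)) / n`!]. *)
Definition coh z x : R[i] :=
  cexp ((2 * x)%:C * z - z ^+ 2) * (expR (- (2^-1 * x ^+ 2)))%:C.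

(** Enough decay to pair [f] with every coherent state. It holds on L^2, and is verified directly
    for the sum of a Hermite series and its difference with [f]. *)
Definition tame f := cmeasR f /\ forall c, 0 <= c ->
  mu.-integrable setT (EFin \o (fun x => nc (f x) * expR (c * `|x| - 2^-1 * x ^+ 2))).

(* Hermite coefficient without the normalising constant of the Hermite functions. *)
Definition hc f n : R[i] := cint mu (fun x => f x * (herm n x * expR (- (2^-1 * x ^+ 2)))%:C).

Lemma measurable_herm n : measurable_fun setT (@herm R n).
Proof.
suff : measurable_fun setT (@herm R n) /\ measurable_fun setT (@herm R n.+1) by case.
elim: n => [|n [IH1 IH2]].
  split; first by rewrite (_ : herm 0 = fun=> 1)//; exact: measurable_cst.
  rewrite (_ : herm 1 = fun x => 2 * x); last by apply/funext => x; rewrite herm1.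
  exact: measurable_funM.
split=> //; rewrite (_ : herm n.+2 = fun x => 2 * x * herm n.+1 x - 2 * n.+1%:R * herm n x); last first.
  by apply/funext => x; rewrite hermSS.
by apply: measurable_funB; apply: measurable_funM.
Qed.

Lemma measurable_gaussian a : measurable_fun setT (fun x : R => expR (- (a * x ^+ 2))).
Proof.
apply: measurableT_comp => //; apply: measurable_funN.
exact: measurable_funM.
Qed.

Lemma bargmann f z : tame f ->
  [/\ forall n, cintegrable mu (fun x => f x * (herm n x * expR (- (2^-1 * x ^+ 2)))%:C),
      cint mu (fun x => f x * coh z x) = ps (fun n => ifact n * hc f n) z &
      forall r, 0 <= r -> psok (fun n => ifact n * hc f n) r].
Proof.
move=> [mf tf].
have mhw n : cmeasR (fun x => f x * (herm n x * expR (- (2^-1 * x ^+ 2)))%:C).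
  apply: cmeasM => //; apply: cmeas_real; apply: measurable_funM; first exact: measurable_herm.
  exact: measurable_gaussian.
have hw n x : nc (f x * (herm n x * expR (- (2^-1 * x ^+ 2)))%:C) <=
    n`!%:R * expR 1 * (nc (f x) * expR (2 * `|x| - 2^-1 * x ^+ 2)).
  have := @herm_gf_dom _ x 1 n ler01; rewrite expr1n !mulr1 ler_pdivrMr ?ltr0n ?fact_gt0// => h.
  rewrite Normc.normcM ncR normrM [`|expR _|]ger0_norm ?expR_ge0//.
  rewrite [leRHS]mulrCA ler_wpM2l ?nc_ge0// [expR (2 * _ - _)]expRD [leRHS]mulrA ler_wpM2r ?expR_ge0//.
  by apply: le_trans h _; rewrite le_eqVlt; apply/orP; left; apply/eqP; rewrite expr1n expRD; ring.
have jh n : cintegrable mu (fun x => f x * (herm n x * expR (- (2^-1 * x ^+ 2)))%:C).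
  exact: (integrable_cintegrable (mhw n) (integrable_scale _ (tf 2 _)) (hw n)).
have main w : cint mu (fun x => f x * coh w x) = ps (fun n => ifact n * hc f n) w /\
    csummable (fun n => ifact n * hc f n * w ^+ n).
  pose F n x := ifact n * w ^+ n * (f x * (herm n x * expR (- (2^-1 * x ^+ 2)))%:C).
  have mF n : cmeasR (F n) by apply: cmeasM => //; exact: cmeas_cst.
  pose r := nc w; have r0 : 0 <= r by exact: nc_ge0.
  have r1 : r < r + 1 by rewrite ltrDl.
  (* Bounding the generating function at radius [r + 1] leaves a geometric series of ratio
     [r / (r + 1)]. *)
  pose H x := (1 - r / (r + 1))^-1 * expR ((r + 1) ^+ 2) *
    (nc (f x) * expR (2 * (r + 1) * `|x| - 2^-1 * x ^+ 2)).
  have EF n x : nc (F n x) = (nc (f x) * expR (- (2^-1 * x ^+ 2))) *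
      (nc (herm n x / n`!%:R)%:C * r ^+ n).
    rewrite /F Normc.normcM [nc (ifact n * _)]Normc.normcM [nc (f x * _)]Normc.normcM ncX !ncR.
    by rewrite !normrM [`|expR _|]ger0_norm ?expR_ge0//; ring.
  have FH x : rsummable (fun n => nc (F n x)) /\ rsum (fun n => nc (F n x)) <= H x.
    have [|s e] := @psok_geom _ (fun n => (herm n x / n`!%:R)%:C)
        (expR (2 * `|x| * (r + 1) + (r + 1) ^+ 2)) r (r + 1) r0 r1.
      move=> n; rewrite ncR normrM [ `|_^-1| ]ger0_norm//.
      by apply: herm_gf_dom; rewrite addr_ge0.
    split; first by under eq_fun do rewrite EF; exact: rsummableZ.
    rewrite (eq_rsum (EF ^~ x)) /rsum RintegralZl// -/(rsum _).
    apply: le_trans (ler_wpM2l _ e) _; first by rewrite mulr_ge0 ?nc_ge0 ?expR_ge0.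
    rewrite /H expRD expRD le_eqVlt; apply/orP; left; apply/eqP.
    have -> : 2 * `|x| * (r + 1) = 2 * (r + 1) * `|x| by ring.
    by ring.
  have iH : mu.-integrable setT (EFin \o H).
    by apply: integrable_scale; apply: tf; rewrite mulr_ge0// addr_ge0.
  have [E s] := @cint_csum_swap _ _ _ mu F H mF FH iH.
  have Fn n : cint mu (F n) = ifact n * hc f n * w ^+ n.
    by rewrite cintZ; [rewrite mulrAC|exact: jh].
  split; last by move: s; under eq_fun do rewrite Fn.
  rewrite /ps -(eq_csum Fn) -E; apply: eq_cint => x.
  rewrite /coh herm_gf [ps _ w * _]mulrC mulrA /ps -csumZ; last first.
    exact: psok_csummable (psok_herm x r0) (lexx _).
  apply: eq_csum => n; rewrite /F /ifact !rmorphM /=; ring.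
split=> //; first exact: (main z).1.
move=> r r0; have := csummable_nc (main r%:C).2.
have nr : nc r%:C = r by rewrite ncR ger0_norm.
by rewrite /psok; under eq_fun do rewrite Normc.normcM ncX nr.
Qed.

Lemma hermite_coefE f n : tame f -> hermite_coef f n =
  (pi `^ (- 4^-1) * ((2 ^ n * n`!)%N%:R) `^ (- 2^-1))%:C * hc f n.
Proof.
move=> tf; have [jh _ _] := bargmann 0 tf.
rewrite -cintZ; last exact: jh.
apply: eq_cint => x; rewrite hermite_funE; set c := _ * _ `^ _; set h := _ * expR _.
by rewrite rmorphM mulrCA.
Qed.

Lemma tame_L2 f : cLfun 2%:E f -> tame f.
Proof.
move=> /cLfun2P[mf if2]; split=> // c c0.
have ig := gaussian_abs (2 * c) (ltr01 : 0 < 1 :> R).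
have iS : mu.-integrable setT (EFin \o (fun x => nc (f x) ^+ 2 + expR (2 * c * `|x| - 1 * x ^+ 2))).
  by have := integrableD measurableT if2 ig.
apply: (integrable_dom _ iS).
  apply: measurable_funM; first exact: measurable_nc mf.
  apply: measurableT_comp => //; apply: measurable_funB; apply: measurable_funM => //.
move=> x /=; rewrite ger0_norm ?mulr_ge0 ?nc_ge0 ?expR_ge0//.
have -> : expR (2 * c * `|x| - 1 * x ^+ 2) = expR (c * `|x| - 2^-1 * x ^+ 2) ^+ 2.
  by rewrite -expRM_natl; congr expR; lra.
have := sqr_ge0 (nc (f x) - expR (c * `|x| - 2^-1 * x ^+ 2)).
have := nc_ge0 (f x); have := expR_ge0 (c * `|x| - 2^-1 * x ^+ 2).
move: (nc (f x)) (expR _) => a b; rewrite !expr2 => *; nra.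
Qed.

End coherent_states.

Section product_measurability.
Context d1 d2 (T1 : measurableType d1) (T2 : measurableType d2) {R : realType}.

Lemma cmeas_fst (f : T1 -> R[i]) : cmeas f -> cmeas (fun z : T1 * T2 => f z.1).
Proof.
by move=> [f1 f2]; split; [exact: (measurableT_comp f1 (@measurable_fst _ _ T1 T2))
                          |exact: (measurableT_comp f2 (@measurable_fst _ _ T1 T2))].
Qed.

Lemma cmeas_snd (f : T2 -> R[i]) : cmeas f -> cmeas (fun z : T1 * T2 => f z.2).
Proof.
by move=> [f1 f2]; split; [exact: (measurableT_comp f1 (@measurable_snd _ _ T1 T2))
                          |exact: (measurableT_comp f2 (@measurable_snd _ _ T1 T2))].
Qed.

End product_measurability.

Section fourier_transform.
Context {R : realType}.
Local Notation mu := (@lebesgue_measure R).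
Local Notation TR := (measurableTypeR R).
Local Notation cmeasR := (@cmeas _ (measurableTypeR R) R).
Implicit Types (f g : R -> R[i]) (x y r c : R) (z : R[i]).

Definition k0 : R := (2 * pi) `^ (- 2^-1).

Lemma k0_sqrt : k0 * Num.sqrt (pi / 2^-1) = 1.
Proof.
have p0 : 0 < 2 * pi :> R by rewrite mulr_gt0// pi_gt0.
rewrite /k0 powRN powR12_sqrt ?(ltW p0)// invrK [pi * 2]mulrC mulVf//.
by rewrite gt_eqF// sqrtr_gt0.
Qed.

Lemma k0_gt0 : 0 < k0.
Proof. by rewrite powR_gt0// mulr_gt0// pi_gt0. Qed.

Lemma fourierL1E f xi : fourierL1 f xi = k0%:C * cint mu (fun t => f t * cis (- (t * xi))).
Proof. by congr (_ * _); apply: eq_cint => t; rewrite /cis cosN sinN. Qed.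

Lemma cmeas_cis_prod : cmeas (fun z : TR * TR => cis (- (z.1 * z.2))).
Proof.
have m : measurable_fun setT (fun z : TR * TR => - (z.1 * z.2)).
  by apply: measurable_funN; apply: measurable_funM; [exact: measurable_fst|exact: measurable_snd].
by split; [exact: (measurableT_comp (continuous_measurable_fun (@continuous_cos R)) m)
          |exact: (measurableT_comp (continuous_measurable_fun (@continuous_sin R)) m)].
Qed.

Lemma cmeas_cis (h : R -> R) : measurable_fun (setT : set TR) h -> cmeasR (fun x => cis (h x)).
Proof.
by move=> m; split; [exact: (measurableT_comp (continuous_measurable_fun (@continuous_cos R)) m)
                    |exact: (measurableT_comp (continuous_measurable_fun (@continuous_sin R)) m)].
Qed.

Lemma cintegrable_cis f xi : cintegrable mu f -> cintegrable mu (fun t => f t * cis (- (t * xi))).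
Proof.
move=> jf; apply: (cintegrable_le _ jf).
  apply: cmeasM; first by case: jf.
  by apply: cmeas_cis; apply: measurable_funN; exact: measurable_funM.
by move=> t; rewrite Normc.normcM nc_cis mulr1.
Qed.

Lemma cintegrable_kernel f g : cintegrable mu f -> cintegrable mu g ->
  cintegrable (mu \x mu)%E (fun p => f p.1 * g p.2 * cis (- (p.1 * p.2))).
Proof.
move=> jf jg; have [mf jf'] := jf; have [mg jg'] := jg.
apply: (@cintegrable_prod_dom _ _ _ _ _ mu mu (fun x y => f x * g y * cis (- (x * y)))
  (fun x y => nc (f x) * nc (g y)) (fun x => (\int[mu]_y nc (g y)) * nc (f x))).
- apply: cmeasM; last exact: cmeas_cis_prod.
  by apply: cmeasM; [exact: cmeas_fst|exact: cmeas_snd].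
- by move=> x y; rewrite !Normc.normcM nc_cis mulr1.
- by move=> x; exact: integrable_scale.
- by move=> x; rewrite RintegralZl// mulrC.
- exact: integrable_scale.
Qed.

(** The multiplication formula. It is used with [g] a coherent state or a Gaussian packet, whose
    transform is explicit, and once with [g] built from [fourierL1 f] itself. *)
Lemma fourierL1_mult f g : cintegrable mu f -> cintegrable mu g ->
  cint mu (fun xi => fourierL1 f xi * g xi) = cint mu (fun t => f t * fourierL1 g t).
Proof.
move=> jf jg; have jF := cintegrable_kernel jf jg.
have sw := @cint_swap _ _ _ _ _ mu mu (fun x y => f x * g y * cis (- (x * y))) jF.
have E1 t : cint mu (fun xi => f t * g xi * cis (- (t * xi))) = f t * cint mu (fun xi => g xi * cis (- (xi * t))).
  rewrite -cintZ; last exact: cintegrable_cis.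
  by apply: eq_cint => xi; rewrite mulrA [xi * t]mulrC.
have E2 xi : cint mu (fun t => f t * g xi * cis (- (t * xi))) = cint mu (fun t => f t * cis (- (t * xi))) * g xi.
  rewrite [RHS]mulrC -cintZ; last exact: cintegrable_cis.
  by apply: eq_cint => t; rewrite mulrA [g xi * f t]mulrC.
have j1 := @cintegrable_fubini_F _ _ _ _ _ mu mu (fun x y => f x * g y * cis (- (x * y))) jF.
have j2 := @cintegrable_fubini_G _ _ _ _ _ mu mu (fun x y => f x * g y * cis (- (x * y))) jF.
transitivity (k0%:C * cint mu (fun y => cint mu (fun x => f x * g y * cis (- (x * y))))).
  rewrite -(cintZ k0%:C j2); apply: eq_cint => xi.
  by rewrite fourierL1E -[LHS]mulrA E2.
rewrite -sw -(cintZ k0%:C j1); apply: eq_cint => t.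
by rewrite E1 fourierL1E [LHS]mulrCA.
Qed.

(** The Fourier kernel of [f] is not integrable over the plane; the weight [gauss 1 xi] makes Fubini
    available and is divided out afterwards. *)
Lemma cmeas_fourierL1 f : cintegrable mu f -> cmeasR (fourierL1 f).
Proof.
move=> jf; have jg : cintegrable mu (gauss (1 : R)).
  have e0 : mu.-integrable setT (EFin \o (fun x : R => nc (gauss 1 x) * expR (0 * `|x|))).
    exact: integrable_gauss_exp.
  apply: (integrable_cintegrable _ e0); first exact: cmeas_gauss.
  by move=> x; rewrite mul0r expR0 mulr1.
have m := @cmeas_cint' _ _ _ _ _ mu mu (fun x y => f x * gauss 1 y * cis (- (x * y))) (cintegrable_kernel jf jg).
have mh : cmeasR (fun x => (k0 * expR (x ^+ 2))%:C).
  apply: cmeas_real; apply: measurable_funM => //; apply: measurableT_comp => //.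
have := cmeasM mh m; congr cmeas; apply/funext => xi.
rewrite fourierL1E rmorphM -mulrA; congr (_ * _).
have -> : cint mu (fun x => f x * gauss 1 xi * cis (- (x * xi))) = gauss 1 xi * cint mu (fun t => f t * cis (- (t * xi))).
  rewrite -cintZ; last exact: cintegrable_cis.
  by apply: eq_cint => x; rewrite [f x * _]mulrC mulrA.
by rewrite mulrA /gauss -rmorphM -expRD mul1r subrr expR0 mul1r.
Qed.

Lemma nc_fourierL1 f xi : cintegrable mu f -> nc (fourierL1 f xi) <= k0 * \int[mu]_t nc (f t).
Proof.
move=> jf; rewrite fourierL1E Normc.normcM ncR (ger0_norm (ltW k0_gt0)) ler_wpM2l ?(ltW k0_gt0)//.
apply: le_trans (nc_cint (cintegrable_cis xi jf)) _.
apply: le_Rintegral => //; first by have [] := cintegrable_cis xi jf.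
  by have [] := jf.
by move=> t _; rewrite Normc.normcM nc_cis mulr1.
Qed.

Definition iunit : R[i] := 0 +i* 1.

Lemma iunit2 : iunit * iunit = - 1.
Proof. by apply: complex_eqP => /=; ring. Qed.

Lemma cohE z x : coh z x = cexp (- z ^+ 2) * (gauss (2^-1) x * cexp (2 * z * x%:C)).
Proof.
rewrite /coh /gauss addrC cexpD.
have -> : 2 * z * x%:C = (2 * x)%:C * z by rewrite [in RHS]rmorphM /= -(natrC 2); ring.
by rewrite -mulrA; congr (_ * _); exact: mulrC.
Qed.

(** By completing the square: the transform acts on coherent states as a quarter turn of the
    parameter. Comparing Taylor coefficients in [z] yields the eigenvalues [(- iunit) ^+ n] of
    [hc_fourier]. *)
Lemma fourierL1_coh z xi : fourierL1 (coh z) xi = coh (- iunit * z) xi.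
Proof.
have a0 : 0 < 2^-1 :> R by [].
have ig r (_ : 0 <= r) := @integrable_gauss_exp R _ a0 r.
pose w := 2 * z - iunit * xi%:C.
have E t : coh z t * cis (- (t * xi)) = cexp (- z ^+ 2) * (gauss (2^-1) t * cexp (w * t%:C)).
  rewrite cohE -[LHS]mulrA -[gauss _ _ * _ * _]mulrA -[cis _]cexpI -cexpD.
  congr (_ * (_ * cexp _)).
  have -> : 0 +i* - (t * xi) = - (iunit * xi%:C * t%:C) :> R[i] by apply: complex_eqP => /=; ring.
  by rewrite /w; ring.
have jw : cintegrable mu (fun t => gauss (2^-1) t * cexp (w * t%:C)).
  exact: cintegrable_cexp_lin (cmeas_gauss _) ig _.
rewrite fourierL1E; transitivity (k0%:C * (cexp (- z ^+ 2) *
    ((Num.sqrt (pi / 2^-1))%:C * cexp (w ^+ 2 * ((4 * 2^-1)^-1)%:C)))).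
  by congr (_ * _); rewrite -(gaussian_integral a0 w) -(cintZ _ jw); exact: eq_cint.
rewrite mulrCA [k0%:C * _]mulrA -rmorphM k0_sqrt mul1r -cexpD.
rewrite /coh -cexpR -cexpD; congr cexp.
have -> : (4 * 2^-1)^-1 = 2^-1 :> R by lra.
have -> : (2 * xi)%:C = 2 * xi%:C :> R[i] by rewrite rmorphM /= -(natrC 2).
have -> : (- (2^-1 * xi ^+ 2))%:C = - (2^-1 * xi%:C ^+ 2) :> R[i].
  by rewrite rmorphN rmorphM rmorphXn fmorphV /= -(natrC 2).
have -> : 2^-1%:C = 2^-1 :> R[i] by rewrite fmorphV /= -(natrC 2).
rewrite /w; move: xi%:C => X; have := iunit2; move: iunit => I I2.
have -> : - z ^+ 2 + (2 * z - I * X) ^+ 2 * 2^-1 = - (2 * I * X * z) + z ^+ 2 + (I * I) * (X ^+ 2) * 2^-1 by field.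
have -> : (- I * z) ^+ 2 = (I * I) * z ^+ 2 by ring.
rewrite I2; ring.
Qed.

Lemma nc_coh z x : nc (coh z x) <= expR (nc z ^+ 2) * expR (2 * nc z * `|x| - 2^-1 * x ^+ 2).
Proof.
rewrite /coh Normc.normcM nc_cexp ncR [ `|expR _| ]ger0_norm ?expR_ge0// -!expRD ler_expR addrA.
rewrite lerD2r cReD cReN [leLHS]addrC; apply: lerD.
  by rewrite -ncX -ncN -cReN; apply: le_trans (Re_le_nc _); exact: ler_norm.
apply: le_trans (ler_norm _) _; apply: le_trans (Re_le_nc _) _.
by rewrite Normc.normcM ncR normrM ger0_norm// mulrAC.
Qed.

Lemma cmeas_coh z : cmeasR (coh z).
Proof.
have -> : coh z = fun x => cexp (- z ^+ 2) * (gauss (2^-1) x * cexp (2 * z * x%:C)).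
  by apply/funext => x; exact: cohE.
apply: cmeasM; first exact: cmeas_cst.
by apply: cmeasM; [exact: cmeas_gauss|exact: cmeas_cexp_lin].
Qed.

Lemma cintegrable_coh z : cintegrable mu (coh z).
Proof.
have a0 : 0 < 2^-1 :> R by [].
exact: (integrable_cintegrable (cmeas_coh z)
  (integrable_scale _ (gaussian_abs (2 * nc z) a0)) (nc_coh z)).
Qed.

Lemma coh_L2 z : cLfun 2%:E (coh z).
Proof.
apply/cLfun2P; split; first exact: cmeas_coh.
apply: (integrable_dom _ (integrable_scale (expR (nc z ^+ 2) ^+ 2)
  (gaussian_abs (4 * nc z) (ltr01 : 0 < 1 :> R)))).
  by apply: measurable_funX; exact: measurable_nc (cmeas_coh z).
move=> x; rewrite ger0_norm ?sqr_ge0//.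
have -> : expR (4 * nc z * `|x| - 1 * x ^+ 2) = expR (2 * nc z * `|x| - 2^-1 * x ^+ 2) ^+ 2.
  by rewrite -expRM_natl; congr expR; lra.
by rewrite -exprMn lerXn2r ?nnegrE ?nc_ge0 ?mulr_ge0 ?expR_ge0//; exact: nc_coh.
Qed.

Lemma cLnorm_fin f : cLfun 2%:E f -> exists2 B : R, 0 <= B & (cLnorm 2%:E f <= B%:E)%E.
Proof.
move=> [_ foo]; exists (fine (cLnorm 2%:E f)); first by rewrite fine_ge0// Lnorm_ge0.
by rewrite fineK// ge0_fin_numE// Lnorm_ge0.
Qed.

Lemma cintegrable_coh_mul f z : cLfun 2%:E f -> cintegrable mu (fun x => f x * coh z x).
Proof.
by move=> /cLfun2P[mf if2]; have /cLfun2P[mc ic] := coh_L2 z; exact: cintegrable_mul.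
Qed.

(** The multiplication formula gives the identity for the approximants [u k], and both sides are
    continuous in L^2 by Hoelder's inequality. The hypothesis is the relation [is_fourierL2] because
    [fourier] merely selects one of its solutions. *)
Lemma is_fourierL2_coh f g z : cLfun 2%:E f -> is_fourierL2 f g ->
  cint mu (fun x => g x * coh z x) = cint mu (fun x => f x * coh (- iunit * z) x).
Proof.
move=> Lf [Lg [u [Lu uf ug]]].
have [B1 B10 hB1] := cLnorm_fin (coh_L2 z).
have [B2 B20 hB2] := cLnorm_fin (coh_L2 (- iunit * z)).
apply/eqP; rewrite -subr_eq0 -nc_eq0 eq_le nc_ge0 andbT.
apply/ler_addgt0Pr => e e0; rewrite add0r.
(* The two errors add up to at most [e1 * (B1 + B2)]; the added 1 makes the divisor positive. *)
pose e1 := e / (B1 + B2 + 1).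
have e10 : 0 < e1 by rewrite divr_gt0// ltr_wpDl// addr_ge0.
have nz : nbhs 0%E [set y : \bar R | (y < e1%:E)%E].
  by apply: open_ereal_lt'; rewrite lte_fin.
have [k _ hk] : \forall k \near \oo, (cLnorm 2%:E (fun x => u k x - f x)%R < e1%:E)%E /\
    (cLnorm 2%:E (fun xi => fourierL1 (u k) xi - g xi)%R < e1%:E)%E.
  by near=> k; split; near: k; [exact: uf nz|exact: ug nz].
have [h1 h2] := hk k (leqnn k).
have [/cLfun1P ju Lu2] := Lu k.
have L1 : cLfun 2%:E (fun x => u k x - f x).
  split; last exact: lt_trans h1 (ltry _).
  by case: Lu2 => mu2 _; case: Lf => mf _; exact: (cmeasB mu2 mf).
have L2 : cLfun 2%:E (fun x => fourierL1 (u k) x - g x).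
  split; last exact: lt_trans h2 (ltry _).
  by case: Lg => mg _; exact: (cmeasB (cmeas_fourierL1 ju) mg).
have j1 := cintegrable_coh_mul (- iunit * z) L1.
have j2 := cintegrable_coh_mul z L2.
have jf := cintegrable_coh_mul (- iunit * z) Lf.
have jg := cintegrable_coh_mul z Lg.
have E1 : cint mu (fun x => u k x * coh (- iunit * z) x) =
    cint mu (fun x => (u k x - f x) * coh (- iunit * z) x) + cint mu (fun x => f x * coh (- iunit * z) x).
  by rewrite -(cintD j1 jf); apply: eq_cint => x; rewrite -mulrDl subrK.
have E2 : cint mu (fun x => fourierL1 (u k) x * coh z x) =
    cint mu (fun x => (fourierL1 (u k) x - g x) * coh z x) + cint mu (fun x => g x * coh z x).
  by rewrite -(cintD j2 jg); apply: eq_cint => x; rewrite -mulrDl subrK.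
have E3 : cint mu (fun x => fourierL1 (u k) x * coh z x) = cint mu (fun x => u k x * coh (- iunit * z) x).
  rewrite (fourierL1_mult ju (cintegrable_coh z)); apply: eq_cint => x.
  by rewrite fourierL1_coh.
have {L1} /cLfun2P[m1 i1] := L1; have {L2} /cLfun2P[m2 i2] := L2.
have /cLfun2P[mc ic] := coh_L2 z; have /cLfun2P[mc' ic'] := coh_L2 (- iunit * z).
have b1 := nc_cint_mul m1 mc' i1 ic' (ltW h1) hB2.
have b2 := nc_cint_mul m2 mc i2 ic (ltW h2) hB1.
have -> : cint mu (fun x => g x * coh z x) - cint mu (fun x => f x * coh (- iunit * z) x) =
    cint mu (fun x => (u k x - f x) * coh (- iunit * z) x)
    - cint mu (fun x => (fourierL1 (u k) x - g x) * coh z x).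
  move: E3; rewrite E1 E2; move: (cint _ _) (cint _ _) (cint _ _) (cint _ _) => a b c d E.
  by apply/eqP; rewrite subr_eq addrAC -E addrAC subrr add0r.
apply: le_trans (ncB _ _) _; apply: le_trans (lerD b1 b2) _.
rewrite -mulrDr /e1 -mulrA ler_piMr ?(ltW e0)// mulrC ler_pdivrMr ?mul1r ?ltr_wpDl ?addr_ge0//.
by rewrite [B2 + B1]addrC lerDl.
Unshelve. all: by end_near.
Qed.

Lemma ps_coef_unique (a b : nat -> R[i]) : psok a 1 -> psok b 1 ->
  (forall z, ps a z = ps b z) -> forall n, a n = b n.
Proof. by move=> sa sb E; apply: (ps_inj ltr01 sa sb) => x _ _; exact: E. Qed.

Lemma ifact_neq0 n : ifact n != 0 :> R[i].
Proof. by rewrite -nc_eq0 /ifact ncR normr_eq0 invr_eq0 pnatr_eq0 -lt0n fact_gt0. Qed.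

Lemma hc_fourier f g n : cLfun 2%:E f -> is_fourierL2 f g ->
  hc g n = (- iunit) ^+ n * hc f n.
Proof.
move=> Lf Fg; have [Lg _] := Fg.
have [_ Ef sf] := bargmann 0 (tame_L2 Lf); have [_ Eg sg] := bargmann 0 (tame_L2 Lg).
have nI : nc (- iunit) = 1 by rewrite ncN /iunit /= expr0n add0r expr1n sqrtr1.
have sf' : psok (fun n => ifact n * ((- iunit) ^+ n * hc f n)) 1.
  have := sf _ ler01; rewrite /psok; congr rsummable; apply/funext => k.
  by rewrite [nc (ifact k * (_ * _))]Normc.normcM [nc (_ ^+ k * _)]Normc.normcM ncX nI expr1n mul1r -Normc.normcM.
apply: (mulfI (ifact_neq0 n)); move: n; apply: (ps_coef_unique (sg _ ler01) sf').
move=> z; have [_ <- _] := bargmann z (tame_L2 Lg).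
rewrite (is_fourierL2_coh z Lf Fg); have [_ -> _] := bargmann (- iunit * z) (tame_L2 Lf).
by apply: eq_csum => n; rewrite exprMn -!mulrA; congr (_ * _); rewrite mulrCA.
Qed.

End fourier_transform.

(** * Completeness of the Hermite functions *)

Section half_line_masses.
Context {R : realType}.
Local Notation mu := (@lebesgue_measure R).
Local Notation TR := (measurableTypeR R).
Local Notation cmeasR := (@cmeas _ (measurableTypeR R) R).
Implicit Types (h : R -> R) (a t x y : R).

Definition bell a t y : R := expR (- (a * (t - y) ^+ 2)).

Lemma bell_ge0 a t y : 0 <= bell a t y. Proof. exact: expR_ge0. Qed.

Lemma bell_integral a t : 0 < a ->
  mu.-integrable setT (EFin \o bell a t) /\ \int[mu]_y bell a t y = Num.sqrt (pi / a).
Proof.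
move=> a0; have [i e] := gaussian_real (2 * a * t) a0.
have E : bell a t = fun y => expR (- (a * t ^+ 2)) * expR (2 * a * t * y - a * y ^+ 2).
  by apply/funext => y; rewrite /bell -expRD; congr expR; ring.
rewrite E; split; first exact: integrable_scale.
rewrite RintegralZl// e mulrCA -expRD; have -> : - (a * t ^+ 2) + (2 * a * t) ^+ 2 / (4 * a) = 0.
  by field; rewrite gt_eqF.
by rewrite expR0 mulr1.
Qed.

Definition half x y : R := \1_[set` `]-oo, x]] y.

Lemma halfE x y : half x y = (y <= x)%R%:R.
Proof. by rewrite /half indicE; congr (_%:R); congr nat_of_bool; apply/idP/idP; rewrite inE/= in_itv/=. Qed.

Lemma measurable_half x : measurable_fun (setT : set TR) (half x).
Proof. exact: measurable_indic. Qed.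

(** The indicator of the half-line smoothed by a Gaussian, not normalised: the limiting height is
    [Num.sqrt (pi / a)]. *)
Definition mass a x t : R := \int[mu]_y (bell a t y * half x y).

Lemma measurable_bell_prod a : measurable_fun setT (fun p : TR * TR => bell a p.1 p.2).
Proof.
apply: measurableT_comp => //; apply: measurable_funN.
apply: measurable_funM => //; apply: measurable_funX.
by apply: measurable_funB; [exact: measurable_fst|exact: measurable_snd].
Qed.

Lemma measurable_bell a t : measurable_fun (setT : set TR) (bell a t).
Proof.
apply: measurableT_comp => //; apply: measurable_funN.
by apply: measurable_funM => //; apply: measurable_funX; apply: measurable_funB.
Qed.

Lemma bell_half_integrable a x t : 0 < a ->
  mu.-integrable setT (EFin \o (fun y => bell a t y * half x y)).
Proof.
move=> a0; apply: (integrable_dom _ (bell_integral t a0).1).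
  by apply: measurable_funM; [exact: measurable_bell|exact: measurable_half].
move=> y; rewrite halfE normrM (ger0_norm (bell_ge0 _ _ _)) ger0_norm ?ler0n//.
by rewrite ler_piMr ?bell_ge0// lern1 leq_b1.
Qed.

Lemma mass_ge0 a x t : 0 <= mass a x t.
Proof. by apply: Rintegral_ge0 => y _; rewrite mulr_ge0 ?bell_ge0// halfE ler0n. Qed.

Lemma mass_le a x t : 0 < a -> mass a x t <= Num.sqrt (pi / a).
Proof.
move=> a0; have [i <-] := bell_integral t a0; apply: le_Rintegral => //.
  exact: bell_half_integrable.
by move=> y _; rewrite ler_piMr ?bell_ge0// halfE lern1 leq_b1.
Qed.

Let tail a t y s : 0 < a -> (t - y) ^+ 2 >= s ^+ 2 ->
  bell a t y <= expR (- (a / 2 * s ^+ 2)) * bell (a / 2) t y.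
Proof. by move=> a0 h; rewrite /bell -expRD ler_expR; nra. Qed.

Lemma sqrt_half a : 0 < a -> Num.sqrt (pi / (a / 2)) = Num.sqrt 2 * Num.sqrt (pi / a).
Proof.
by move=> a0; rewrite -sqrtrM//; congr Num.sqrt; rewrite invf_div; ring.
Qed.

(** In both cases the error integrates [bell] over points at distance at least [|t - x|] from [t].
    Half of the exponent gives the decay; the other half is integrated, which produces
    [Num.sqrt 2]. *)
Lemma mass_tail a x t : 0 < a ->
  `|mass a x t - Num.sqrt (pi / a) * half x t| <=
  Num.sqrt 2 * Num.sqrt (pi / a) * expR (- (a / 2 * (t - x) ^+ 2)).
Proof.
move=> a0; have a20 : 0 < a / 2 by rewrite divr_gt0.
have [i e] := bell_integral t a0; have [i2 e2] := bell_integral t a20.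
have ih := bell_half_integrable x t a0.
rewrite [leRHS]mulrC -sqrt_half// -e2 -RintegralZl//.
rewrite halfE; case: (lerP t x) => tx.
- rewrite mulr1 -e distrC /mass -RintegralB//.
  rewrite ger0_norm; last first.
    apply: Rintegral_ge0 => y _; rewrite subr_ge0 halfE ler_piMr ?bell_ge0//.
    by rewrite lern1 leq_b1.
  apply: le_Rintegral => //.
  + by have := integrableB measurableT i ih.
  + exact: integrable_scale.
  move=> y _; rewrite halfE; case: (lerP y x) => yx.
    by rewrite mulr1 subrr mulr_ge0 ?bell_ge0 ?expR_ge0.
  by rewrite mulr0 subr0; apply: tail => //; nra.
- rewrite mulr0 subr0 ger0_norm ?mass_ge0//; apply: le_Rintegral => //.
    exact: integrable_scale.
  move=> y _; rewrite halfE; case: (lerP y x) => yx; last first.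
    by rewrite mulr0 mulr_ge0 ?bell_ge0 ?expR_ge0.
  by rewrite mulr1; apply: tail => //; nra.
Qed.

Lemma mass_orthogonal a x h : 0 < a -> mu.-integrable setT (EFin \o h) ->
  (forall y, \int[mu]_t (h t * bell a t y) = 0) -> \int[mu]_t (h t * mass a x t) = 0.
Proof.
move=> a0 ih h0.
have mh : measurable_fun (setT : set TR) h by apply/measurable_EFinP; exact: measurable_int ih.
have j : cintegrable (mu \x mu)%E (fun p => (h p.1 * (bell a p.1 p.2 * half x p.2))%:C).
  apply: (@cintegrable_prod_dom _ _ _ _ _ mu mu (fun t y => (h t * (bell a t y * half x y))%:C)
    (fun t y => `|h t| * bell a t y) (fun t => Num.sqrt (pi / a) * `|h t|)).
  - apply: cmeas_real; apply: measurable_funM.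
      exact: (measurableT_comp mh (@measurable_fst _ _ TR TR)).
    apply: measurable_funM; first exact: measurable_bell_prod.
    exact: (measurableT_comp (measurable_half x) (@measurable_snd _ _ TR TR)).
  - move=> t y; rewrite ncR normrM ler_wpM2l// halfE normrM (ger0_norm (bell_ge0 _ _ _)).
    by rewrite ger0_norm ?ler0n// ler_piMr ?bell_ge0// lern1 leq_b1.
  - by move=> t; exact: integrable_scale (bell_integral t a0).1.
  - by move=> t; have [i e] := bell_integral t a0; rewrite RintegralZl// e mulrC.
  - by apply: integrable_scale; exact: integrable_norm ih.
have E : \int[mu]_t \int[mu]_y (h t * (bell a t y * half x y)) =
    \int[mu]_y \int[mu]_t (h t * (bell a t y * half x y)).
  exact: (congr1 (@complex.Re R)
    (@cint_swap _ _ _ _ _ mu mu (fun t y => (h t * (bell a t y * half x y))%:C) j)).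
transitivity (\int[mu]_t \int[mu]_y (h t * (bell a t y * half x y))).
  apply: eq_Rintegral => t _; have ib := bell_half_integrable x t a0.
  by rewrite /mass -RintegralZl.
rewrite E -[RHS](congr1 (@complex.Re R) (cint0 mu)) /=; apply: eq_Rintegral => y _.
have ihb : mu.-integrable setT (EFin \o (fun t => h t * bell a t y)).
  apply: (integrable_dom _ (integrable_norm ih)).
    apply: measurable_funM; first exact: mh.
    exact: (measurableT_comp (measurable_bell_prod a) (pair2_measurable y)).
  move=> t; rewrite normrM (ger0_norm (bell_ge0 _ _ _)) /=; apply: ler_piMr; first exact: normr_ge0.
  by rewrite -expR0 ler_expR oppr_le0; exact: mulr_ge0 (ltW a0) (sqr_ge0 _).
transitivity (\int[mu]_t (half x y * (h t * bell a t y))).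
  by apply: eq_Rintegral => t _; ring.
by rewrite RintegralZl; [rewrite h0 mulr0|exact: measurableT|exact: ihb].
Qed.

Lemma measurable_mass a x : measurable_fun (setT : set TR) (mass a x).
Proof.
have m : measurable_fun setT (fun p : TR * TR => (bell a p.1 p.2 * half x p.2)%:E).
  apply/measurable_EFinP; apply: measurable_funM; first exact: measurable_bell_prod.
  exact: (measurableT_comp (measurable_half x) (@measurable_snd _ _ TR TR)).
apply: measurableT_comp => //.
apply: (measurable_fun_fubini_tonelli_F _ m) => p.
by rewrite lee_fin mulr_ge0 ?bell_ge0// halfE ler0n.
Qed.

Lemma cvg_harmonic_le (u : nat -> R) (l C : R) :
  (forall n, `|u n - l| <= C * n.+1%:R^-1) -> u @ \oo --> l.
Proof.
move=> h.
have c0 : (C * @harmonic R n @[n --> \oo] --> 0).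
  by rewrite -[X in _ --> X](mulr0 C); apply: cvgM; [exact: cvg_cst|exact: cvg_harmonic].
apply: (@squeeze_cvgr _ _ _ _ (fun n => l - C * harmonic n) (fun n => l + C * harmonic n)).
- by apply: nearW => n; rewrite -ler_distlC distrC; exact: h.
- by rewrite -[X in _ --> X]subr0; apply: cvgB => //; exact: cvg_cst.
- by rewrite -[X in _ --> X]addr0; apply: cvgD => //; exact: cvg_cst.
Qed.

(** Dominated convergence along [a = n.+1]: the normalised [mass] tends to the indicator except at
    [t = x], and its integrals against [h] vanish by Fubini. *)
Lemma half_line_zero x h : mu.-integrable setT (EFin \o h) ->
  (forall a y, 0 < a -> \int[mu]_t (h t * bell a t y) = 0) ->
  \int[mu]_t (h t * half x t) = 0.
Proof.
move=> ih h0.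
have mh : measurable_fun (setT : set TR) h by apply/measurable_EFinP; exact: measurable_int ih.
pose s (n : nat) : R := Num.sqrt (pi / n.+1%:R).
have s0 n : 0 < s n by rewrite sqrtr_gt0 divr_gt0 ?pi_gt0.
pose f_ (n : nat) t := (h t * (mass n.+1%:R x t / s n))%:E.
pose f t := (h t * half x t)%:E.
have mf_ n : measurable_fun setT (f_ n).
  apply/measurable_EFinP; apply: measurable_funM => //.
  by apply: measurable_funM => //; exact: measurable_mass.
have mf : measurable_fun setT f.
  by apply/measurable_EFinP; apply: measurable_funM => //; exact: measurable_half.
have ig : mu.-integrable setT (fun t => (`|h t|)%:E) by exact: integrable_norm ih.
have hf n t : `|h t * (mass n.+1%:R x t / s n)| <= `|h t|.
  rewrite normrM ler_piMr// [ `|_ / _| ]ger0_norm ?divr_ge0 ?mass_ge0 ?(ltW (s0 n))//.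
  by rewrite ler_pdivrMr// mul1r; exact: mass_le.
have f_g : {ae mu, forall t n, setT t -> (`|f_ n t| <= (`|h t|)%:E)%E}.
  by apply: aeW => t n _; rewrite lee_fin; exact: hf.
have f_f : {ae mu, forall t, setT t -> f_ ^~ t @ \oo --> f t}.
  exists [set x]; split; [exact: measurable_set1|exact: lebesgue_measure_set1|].
  move=> t /= /not_implyP[_ nt]; apply: contrapT => tx; apply: nt.
  have d0 : 0 < (t - x) ^+ 2 by rewrite exprn_even_gt0//= subr_eq0; exact/eqP.
  apply: cvg_EFin; first by near=> n.
  rewrite (_ : fine \o f_ ^~ t = fun n => h t * (mass n.+1%:R x t / s n)); last exact/funext.
  apply: cvgM; first exact: cvg_cst.
  (* The rate comes from [expR (- u) <= u^-1] at [u = n.+1 / 2 * (t - x) ^+ 2]. *)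
  apply: (@cvg_harmonic_le _ _ (Num.sqrt 2 * (2 / (t - x) ^+ 2))) => n.
  rewrite -[half x t](@mulfK _ (s n)) ?gt_eqF// -mulrBl normrM normfV (gtr0_norm (s0 n)) ler_pdivrMr//.
  rewrite [half x t * _]mulrC; apply: le_trans (mass_tail _ _ _) _ => //.
  rewrite [leLHS]mulrAC ler_wpM2r ?(ltW (s0 n))// -[leRHS]mulrA ler_wpM2l ?sqrtr_ge0//.
  set d := (t - x) ^+ 2 in d0 *; have N0 : 0 < n.+1%:R :> R by [].
  move: n.+1%:R N0 => N N0; have u0 : 0 < N / 2 * d by rewrite mulr_gt0// divr_gt0.
  have -> : 2 / d / N = (N / 2 * d)^-1 by field; rewrite !gt_eqF.
  rewrite expRN lef_pV2 ?posrE ?expR_gt0//.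
  by apply: le_trans (expR_ge1Dx _); rewrite lerDr.
have [jf _ cv] := @dominated_convergence _ _ _ mu setT measurableT f_ f _ mf_ mf f_f ig f_g.
have ifn n : mu.-integrable setT (f_ n).
  apply: (integrable_dom _ (integrable_norm ih)); last by move=> t; exact: hf.
  by apply/measurable_EFinP; exact: mf_.
have ihm n : mu.-integrable setT (EFin \o (fun t => h t * mass n.+1%:R x t)).
  have -> : (fun t => h t * mass n.+1%:R x t) = fun t => s n * (h t * (mass n.+1%:R x t / s n)).
    by apply/funext => t; field; rewrite gt_eqF.
  exact: integrable_scale (ifn n).
have z n : (\int[mu]_t f_ n t = 0)%E.
  rewrite -(fineK (integrable_fin_num measurableT (ifn n))); congr EFin.
  transitivity (\int[mu]_t ((s n)^-1 * (h t * mass n.+1%:R x t))).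
    by apply: eq_Rintegral => t _; ring.
  rewrite RintegralZl; [|exact: measurableT|exact: ihm].
  by rewrite mass_orthogonal ?mulr0// => y; exact: h0.
have E : (\int[mu]_t f t = 0)%E.
  apply/esym; apply: cvg_unique cv; first exact: ereal_hausdorff.
  by rewrite (_ : [sequence _]_n = fun=> 0%E); [exact: cvg_cst|apply/funext => n; exact: z].
by rewrite /Rintegral E.
Unshelve. all: by end_near.
Qed.

(** The primitive of [h] vanishes identically, and its derivative is [h] almost everywhere by
    Lebesgue differentiation. *)
Lemma half_lines_ae0 h : mu.-integrable setT (EFin \o h) ->
  (forall x, \int[mu]_t (h t * half x t) = 0) -> {ae mu, forall x, h x = 0}.
Proof.
move=> ih h0.
have lh : locally_integrable setT h by apply: open_integrable_locally ih; exact: openT.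
have ih' y : mu.-integrable `]-oo, y] (EFin \o h) by apply: integrableS ih.
have := FTC1Ny ih' lh; apply: filterS; first exact: (ae_filter_ringOfSetsType mu).
move=> x.
rewrite (_ : (fun _ => \int[_]_(_ in _) _) = cst 0); first by rewrite derive1_cst => -[_ <-].
apply/funext => y; rewrite Rintegral_mkcond -[RHS](h0 y); apply: eq_Rintegral => t _.
rewrite halfE patchE; case: (lerP t y) => ty.
  by rewrite mem_set ?mulr1//= in_itv/=.
by rewrite memNset ?mulr0//= in_itv/= leNgt ty.
Qed.

End half_line_masses.

Section fourier_injectivity.
Context {R : realType}.
Local Notation mu := (@lebesgue_measure R).
Local Notation cmeasR := (@cmeas _ (measurableTypeR R) R).
Implicit Types (f g : R -> R[i]) (a b t x y : R) (z : R[i]).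

Lemma fourierL1_bell_packet b y t : 0 < b ->
  fourierL1 (fun xi => gauss b xi * cexp (iunit * y%:C * xi%:C)) t =
  (k0 * Num.sqrt (pi / b) * bell (4 * b)^-1 t y)%:C.
Proof.
move=> b0; rewrite fourierL1E.
transitivity (k0%:C * ((Num.sqrt (pi / b))%:C * cexp ((iunit * (y - t)%:C) ^+ 2 * ((4 * b)^-1)%:C))).
  congr (_ * _); rewrite -(gaussian_integral b0); apply: eq_cint => xi.
  rewrite -[LHS]mulrA -[cis _]cexpI -cexpD; congr (_ * cexp _).
  by apply: complex_eqP => /=; ring.
have -> : (k0 * Num.sqrt (pi / b) * bell (4 * b)^-1 t y)%:C =
    (k0 * Num.sqrt (pi / b))%:C * (bell (4 * b)^-1 t y)%:C by rewrite [LHS]rmorphM.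
rewrite mulrA -rmorphM; congr (_ * _).
rewrite /bell -cexpR; congr cexp; rewrite exprMn expr2 iunit2.
by rewrite -rmorphXn mulN1r mulNr -rmorphM -rmorphN; congr (_%:C); ring.
Qed.

Lemma cintegrable_packet b y : 0 < b ->
  cintegrable mu (fun xi => gauss b xi * cexp (iunit * y%:C * xi%:C)).
Proof.
move=> b0; apply: cintegrable_cexp_lin; first exact: cmeas_gauss.
by move=> r _; exact: integrable_gauss_exp.
Qed.

(** Every Gaussian [bell a] centred at [y] is a multiple of the transform of a packet, so by the
    multiplication formula its integral against [f] vanishes; Gaussians then give half-lines. *)
Lemma fourierL1_eq0 f : cintegrable mu f -> (forall xi, fourierL1 f xi = 0) ->
  {ae mu, forall x, f x = 0}.
Proof.
move=> jf f0; have [mf _] := jf.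
have bell0 a y : 0 < a -> cint mu (fun t => f t * (bell a t y)%:C) = 0.
  move=> a0; pose b := (4 * a)^-1; have b0 : 0 < b by rewrite invr_gt0 mulr_gt0.
  have ab : (4 * b)^-1 = a by rewrite /b; field; rewrite gt_eqF.
  have := fourierL1_mult jf (cintegrable_packet y b0).
  under eq_cint do rewrite f0 mul0r; rewrite cint0 => /esym H.
  pose k : R := k0 * Num.sqrt (pi / b).
  have kn0 : k%:C != 0 :> R[i].
    by rewrite -nc_eq0 ncR normr_eq0 gt_eqF// mulr_gt0 ?k0_gt0// sqrtr_gt0 divr_gt0 ?pi_gt0.
  have jb : cintegrable mu (fun t => f t * (bell a t y)%:C).
    apply: (cintegrable_le _ jf).
      by apply: cmeasM => //; apply: cmeas_real; exact: (measurableT_comp (measurable_bell_prod a) (pair2_measurable y)).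
    move=> t; rewrite Normc.normcM ncR (ger0_norm (bell_ge0 _ _ _)) ler_piMr ?nc_ge0//.
    by rewrite -expR0 ler_expR oppr_le0; exact: mulr_ge0 (ltW a0) (sqr_ge0 _).
  transitivity (k%:C^-1 * (k%:C * cint mu (fun t => f t * (bell a t y)%:C))).
    by rewrite mulKf.
  rewrite -(cintZ _ jb) (_ : cint mu _ = 0) ?mulr0// -[RHS]H.
  by apply: eq_cint => t; rewrite fourierL1_bell_packet// ab -/k (rmorphM _ k) mulrCA.
have ir := cintegrable_Re jf; have ii := cintegrable_Im jf.
have hr : {ae mu, forall x, cRe (f x) = 0}.
  apply: half_lines_ae0 => // x; apply: half_line_zero => // a y a0.
  rewrite -[RHS](congr1 (@complex.Re R) (bell0 a y a0)) /=; apply: eq_Rintegral => t _.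
  by rewrite cReM /= mulr0 subr0.
have hi : {ae mu, forall x, cIm (f x) = 0}.
  apply: half_lines_ae0 => // x; apply: half_line_zero => // a y a0.
  rewrite -[RHS](congr1 (@complex.Im R) (bell0 a y a0)) /=; apply: eq_Rintegral => t _.
  by rewrite cImM /= mulr0 add0r.
have FF := ae_filter_ringOfSetsType mu.
by apply: filterS2 hr hi => x r0 i0; apply: complex_eqP; rewrite ?r0 ?i0.
Qed.

Lemma coh_complete f : tame f -> (forall z, cint mu (fun x => f x * coh z x) = 0) ->
  {ae mu, forall x, f x = 0}.
Proof.
move=> [mf tf] f0.
pose E x : R[i] := (expR (- (2^-1 * x ^+ 2)))%:C.
have mfE : cmeasR (fun x => f x * E x).
  by apply: cmeasM => //; apply: cmeas_real; exact: measurable_gaussian.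
have jf : cintegrable mu (fun x => f x * E x).
  apply: (integrable_cintegrable mfE (tf 0 (lexx _))) => x.
  by rewrite Normc.normcM ncR ger0_norm ?expR_ge0// mul0r add0r.
have := fourierL1_eq0 jf; set H := (X in X -> _) => K.
have {K} : {ae mu, forall x, f x * E x = 0}.
  (* At this imaginary [z] the state [coh z] is a plane wave of frequency [xi] times the Gaussian
     [E], up to the constant [cexp (- z ^+ 2)]. *)
  apply: K => xi; pose z := - (iunit * (2^-1 * xi)%:C).
  have jz : cintegrable mu (fun x => f x * coh z x).
    apply: (integrable_cintegrable _ (integrable_scale (expR (nc z ^+ 2)) (tf (2 * nc z) _))).
    - by apply: cmeasM => //; exact: cmeas_coh.
    - by rewrite mulr_ge0 ?nc_ge0.
    - by move=> x; rewrite Normc.normcM mulrCA ler_wpM2l ?nc_ge0//; exact: nc_coh.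
  rewrite fourierL1E (_ : cint mu _ = 0) ?mulr0//.
  rewrite -[RHS](mulr0 (cexp (z ^+ 2))) -(f0 z) -(cintZ _ jz); apply: eq_cint => x.
  rewrite -mulrA [RHS]mulrCA; congr (_ * _); rewrite /coh mulrA -cexpD mulrC; congr (_ * _).
  rewrite -cexpI; congr cexp; rewrite addrC subrK /z.
  by apply: complex_eqP => /=; rewrite ?cReM ?cImM /=; field.
have FF := ae_filter_ringOfSetsType mu.
apply: filterS => x /eqP; rewrite mulf_eq0 => /orP[/eqP//|].
by rewrite -nc_eq0 ncR normr_eq0 gt_eqF// expR_gt0.
Qed.

End fourier_injectivity.

Section measurable_sums.
Context d (T : measurableType d) {R : realType}.
Variable mu : {sigma_finite_measure set T -> \bar R}.

Lemma cmeas_csum (F : nat -> T -> R[i]) (H : T -> R) :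
  (forall n, cmeas (F n)) ->
  (forall t, rsummable (fun n => nc (F n t)) /\ rsum (fun n => nc (F n t)) <= H t) ->
  mu.-integrable setT (EFin \o H) -> cmeas (fun t => csum (F ^~ t)).
Proof.
move=> mF FH iH.
pose m : {sigma_finite_measure set nat -> \bar R} := @counting nat R.
have mF' : cmeas (fun z : T * nat => F z.2 z.1).
  have [m1 m2] := cmeas_natX mF.
  by split; [exact: (measurableT_comp m1 (@measurable_swap _ _ T nat))
            |exact: (measurableT_comp m2 (@measurable_swap _ _ T nat))].
have jF : cintegrable (mu \x m)%E (fun z => F z.2 z.1).
  apply: (@cintegrable_prod_dom _ _ _ _ _ mu m (fun t n => F n t) (fun t n => nc (F n t)) H) => //.
  - by move=> t; exact: (FH t).1.
  - by move=> t; exact: (FH t).2.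
by have := @cmeas_cint _ _ _ _ _ mu m (fun t n => F n t) jF.
Qed.

End measurable_sums.

(** * Growth of the Hermite functions and sums of Hermite series *)

Section hermite_bounds.
Context {R : realType}.
Local Notation mu := (@lebesgue_measure R).
Local Notation cmeasR := (@cmeas _ (measurableTypeR R) R).
Implicit Types (f g : R -> R[i]) (x y r c e : R) (z w : R[i]) (n : nat).

Definition hnorm n : R := pi `^ (- 4^-1) * ((2 ^ n * n`!)%N%:R) `^ (- 2^-1).

Lemma powR_sqr_opp (u v : R) : 0 <= u -> (u `^ (- v)) ^+ 2 = (u `^ (v *+ 2))^-1.
Proof.
move=> u0; rewrite -powR_mulrn ?powR_ge0// -powRrM -powRN; congr powR.
by rewrite mulrC mulr2n; ring.
Qed.

Lemma pi_quarter : (pi `^ (- 4^-1) : R) ^+ 2 = (Num.sqrt pi)^-1.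
Proof.
rewrite powR_sqr_opp ?pi_ge0// -powR12_sqrt ?pi_ge0//.
by congr (_ `^ _)^-1; rewrite mulr2n; lra.
Qed.

Lemma hnorm_sqr n : hnorm n ^+ 2 = (Num.sqrt pi)^-1 / (2 ^+ n * n`!%:R).
Proof.
rewrite /hnorm exprMn pi_quarter powR_sqr_opp// natrM natrX; congr (_ * _^-1).
rewrite (_ : 2^-1 *+ 2 = 1) ?powRr1 ?mulr_ge0 ?exprn_ge0//.
by rewrite mulr2n; lra.
Qed.

Lemma fact_leq_expn n : (n`! <= n ^ n)%N.
Proof.
elim: n => // n IH; rewrite factS expnS leq_mul// (leq_trans IH)//.
by case: n {IH} => // n; rewrite leq_exp2r.
Qed.

(* Cauchy estimate for the generating function on the circle of radius [sqrt n]. *)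
Lemma hermite_fun_bound e n x : 0 < e -> `|hermite_fun n x| <=
  pi `^ (- 4^-1) * expR ((1 + e^-1) * n%:R) * expR (- (2^-1 - e) * x ^+ 2).
Proof.
move=> e0; rewrite hermite_funE -/(hnorm n).
have N0 : 0 < hnorm n by exact: herm_norm_gt0.
have c0 : 0 < pi `^ (- 4^-1) :> R by rewrite powR_gt0// pi_gt0.
pose s : R := Num.sqrt n%:R; have s0 : 0 <= s by exact: sqrtr_ge0.
have s2 : s ^+ 2 = n%:R by rewrite sqr_sqrtr.
set X := expR (2 * `|x| * s + s ^+ 2).
have f0 : 0 < n`!%:R :> R by rewrite ltr0n fact_gt0.
(* Squaring avoids the root in [hnorm]: the square of [s ^+ n] is [n ^ n >= n!], which cancels one
   of the two factorials. *)
have H2 : herm n x ^+ 2 <= n`!%:R * X ^+ 2.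
  have h := herm_gf_dom x n s0; rewrite -/X in h.
  have : (`|herm n x| / n`!%:R * s ^+ n) ^+ 2 <= X ^+ 2.
    by rewrite lerXn2r// nnegrE ?expR_ge0// mulr_ge0 ?divr_ge0// exprn_ge0.
  rewrite exprMn -exprM mulnC exprM s2 -natrX => h2.
  rewrite -real_normK ?num_real//.
  have : (`|herm n x| / n`!%:R) ^+ 2 * n`!%:R <= X ^+ 2.
    by apply: le_trans h2; rewrite ler_wpM2l ?sqr_ge0// ler_nat fact_leq_expn.
  rewrite expr_div_n; move: (_ ^+ 2) (X ^+ 2) n`!%:R f0 => a b g g0.
  by rewrite (_ : a / g ^+ 2 * g = a / g) ?ler_pdivrMr 1?mulrC//; field; rewrite gt_eqF.
have N2 : hnorm n * `|herm n x| <= pi `^ (- 4^-1) * X.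
  rewrite -(@ler_pXn2r _ 2)// ?nnegrE ?mulr_ge0 ?expR_ge0 ?(ltW N0) ?(ltW c0)//.
  rewrite exprMn [leRHS]exprMn pi_quarter hnorm_sqr real_normK ?num_real//.
  rewrite -mulrA ler_wpM2l ?invr_ge0 ?sqrtr_ge0// mulrC ler_pdivrMr ?mulr_gt0 ?exprn_gt0//.
  apply: le_trans H2 _; rewrite mulrC ler_wpM2l ?sqr_ge0// ler_peMl ?(ltW f0)//.
  by rewrite exprn_ege1// ler1n.
rewrite normrM (gtr0_norm N0) normrM (gtr0_norm (expR_gt0 _)) mulrA.
have XE : X * expR (- (2^-1 * x ^+ 2)) <= expR ((1 + e^-1) * n%:R) * expR (- (2^-1 - e) * x ^+ 2).
  rewrite /X -!expRD ler_expR s2.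
  have : 2 * `|x| * s <= e * x ^+ 2 + e^-1 * n%:R.
    rewrite -s2 -[x ^+ 2]real_normK ?num_real//.
    have : 0 <= e^-1 * (e * `|x| - s) ^+ 2 by rewrite mulr_ge0 ?sqr_ge0// invr_ge0 ltW.
    have -> : e^-1 * (e * `|x| - s) ^+ 2 = e * `|x| ^+ 2 + e^-1 * s ^+ 2 - 2 * `|x| * s.
      by field; rewrite gt_eqF.
    by rewrite subr_ge0.
  by lra.
apply: (@le_trans _ _ (pi `^ (- 4^-1) * X * expR (- (2^-1 * x ^+ 2)))).
  by rewrite ler_wpM2r ?expR_ge0.
by rewrite -mulrA -[leRHS]mulrA ler_wpM2l ?(ltW c0).
Qed.

Lemma coh_tame z : tame (coh z).
Proof. exact: tame_L2 (coh_L2 z). Qed.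

(** Orthogonality of the Hermite functions in generating form: [coh z] paired with [coh w] gives
    [sqrt pi * exp (2 z w)], whose expansion in [w] is compared with that of [bargmann]. *)
Lemma hc_coh z n : hc (coh z) n = (Num.sqrt pi)%:C * (2 * z) ^+ n.
Proof.
have [_ _ sz] := bargmann 0 (coh_tame z).
have sp : psok (fun k => ifact k * ((Num.sqrt pi)%:C * (2 * z) ^+ k)) 1.
  have := rsummableZ (Num.sqrt pi) (psok_ifact (nc_ge0 (2 * z))).1.
  rewrite /psok; congr rsummable; apply/funext => k.
  rewrite [nc (ifact k * (_ * _))]Normc.normcM [nc ((Num.sqrt pi)%:C * _)]Normc.normcM
    [nc (Num.sqrt pi)%:C]ncR ncX expr1n mulr1.
  by rewrite (ger0_norm (sqrtr_ge0 _)) mulrCA.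
apply: (mulfI (ifact_neq0 n)); move: n; apply: (ps_coef_unique (sz _ ler01) sp) => w.
have [_ <- _] := bargmann w (coh_tame z).
have ig r (_ : 0 <= r) := @integrable_gauss_exp R _ ltr01 r.
have jw : cintegrable mu (fun x => gauss 1 x * cexp ((2 * z + 2 * w) * x%:C)).
  exact: cintegrable_cexp_lin (cmeas_gauss _) ig _.
transitivity (cexp (- z ^+ 2 - w ^+ 2) * ((Num.sqrt (pi / 1))%:C *
    cexp ((2 * z + 2 * w) ^+ 2 * ((4 * 1)^-1)%:C))).
  rewrite -(gaussian_integral ltr01) -(cintZ _ jw); apply: eq_cint => x.
  rewrite !cohE [(2 * z + 2 * w) * _]mulrDl [cexp (_ * _ + _ * _)]cexpD [cexp (- _ - _)]cexpD.
  have -> : gauss 1 x = gauss 2^-1 x * gauss 2^-1 x :> R[i].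
    by rewrite /gauss -rmorphM -expRD; congr (expR _)%:C; lra.
  move: (cexp _) (cexp _) (cexp _) (cexp _) (gauss _ _) => a b c d e; ring.
rewrite divr1 mulrCA -cexpD.
have -> : - z ^+ 2 - w ^+ 2 + (2 * z + 2 * w) ^+ 2 * (4 * 1)^-1%:C = 2 * z * w.
  by rewrite mulr1 fmorphV /= -(natrC 4); field.
rewrite cexp_ps /ps -csumZ; last exact: psok_csummable (psok_ifact (nc_ge0 _)).1 (lexx _).
by apply: eq_csum => k; rewrite exprMn mulrCA !mulrA.
Qed.

Lemma cintegrable_coh_tame f z : tame f -> cintegrable mu (fun x => f x * coh z x).
Proof.
move=> [mf tf].
apply: (integrable_cintegrable _ (integrable_scale (expR (nc z ^+ 2)) (tf (2 * nc z) _))).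
- by apply: cmeasM => //; exact: cmeas_coh.
- by rewrite mulr_ge0 ?nc_ge0.
- by move=> x; rewrite Normc.normcM mulrCA ler_wpM2l ?nc_ge0//; exact: nc_coh.
Qed.

Let E x : R := expR (- (2^-1 * x ^+ 2)).

Lemma coef_decay_bound f : cLfun 2%:E f ->
  (forall r, 0 < r -> exists2 C, 0 < C &
     forall n, nc (hermite_coef f n) <= C * expR (- r * n%:R)) ->
  forall e, 0 < e -> gaussian_bound e f.
Proof.
move=> Lf dec; have tf := tame_L2 Lf; have [mf _] := tf.
pose t n x : R[i] := hermite_coef f n * (hermite_fun n x)%:C.
have mt n : cmeasR (t n).
  apply: cmeasM; first exact: cmeas_cst.
  rewrite (_ : (fun x => (hermite_fun n x)%:C) = fun x => (hnorm n * (herm n x * E x))%:C); last first.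
    by apply/funext => x; rewrite hermite_funE.
  apply: cmeas_real; apply: measurable_funM => //; apply: measurable_funM; first exact: measurable_herm.
  exact: measurable_gaussian.
have bound e : 0 < e -> exists2 C, 0 < C & forall x, rsummable (fun n => nc (t n x)) /\
    rsum (fun n => nc (t n x)) <= C * expR (- (2^-1 - e) * x ^+ 2).
  move=> e0; pose A := 1 + e^-1; have A0 : 0 < A by rewrite ltr_wpDl// invr_gt0.
  (* The Hermite functions grow at most like [expR (A * n)]; decay at rate [A + 1] leaves a
     geometric series of ratio [expR (- 1)]. *)
  have [C C0 hC] := dec (A + 1) (addr_gt0 A0 ltr01).
  pose q : R := expR (- 1); have q0 : 0 <= q by exact: expR_ge0.
  have q1 : q < 1 by rewrite -expR0 ltr_expR oppr_lt0.
  have [sq eq] := rsum_geom q0 q1.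
  pose K := C * pi `^ (- 4^-1); have K0 : 0 < K by rewrite mulr_gt0// powR_gt0// pi_gt0.
  have tq n x : nc (t n x) <= K * expR (- (2^-1 - e) * x ^+ 2) * q ^+ n.
    rewrite /t Normc.normcM ncR.
    have := ler_pM (nc_ge0 _) (normr_ge0 _) (hC n) (hermite_fun_bound n x e0).
    move=> /le_trans; apply; rewrite /K /q -expRM_natl le_eqVlt; apply/orP; left; apply/eqP.
    have -> : - (A + 1) * n%:R = - (A * n%:R) + n%:R * - 1 by ring.
    rewrite -/A expRD [expR (- (A * _))]expRN.
    by field; rewrite gt_eqF ?expR_gt0.
  have st x : rsummable (fun n => nc (t n x)).
    by apply: rsummable_le (rsummableZ _ sq) _ => n; rewrite ger0_norm ?nc_ge0//; exact: tq.
  exists (K * (1 - q)^-1); first by rewrite mulr_gt0// invr_gt0 subr_gt0.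
  move=> x; split=> //; apply: le_trans (le_rsum (st x) (rsummableZ _ sq) (tq ^~ x)) _.
  by rewrite /rsum RintegralZl// -/(rsum _) eq mulrAC.
pose F x := csum (t ^~ x).
(* Any fixed [e] below [2^-1] would do here: one such bound makes [F] measurable and tame and
   justifies the termwise pairing with [coh z]. *)
have e4 : 0 < 4^-1 :> R by [].
have [C4 C40 b4] := bound _ e4.
have iG c : mu.-integrable setT (EFin \o (fun x => C4 * expR (c * `|x| - 4^-1 * x ^+ 2))).
  exact: integrable_scale (gaussian_abs c e4).
have ncF e C x : (rsummable (fun n => nc (t n x)) /\
    rsum (fun n => nc (t n x)) <= C * expR (- (2^-1 - e) * x ^+ 2)) ->
    nc (F x) <= C * expR (- (2^-1 - e) * x ^+ 2).
  by move=> [s h]; apply: le_trans h; exact: nc_csum.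
have mF : cmeasR F.
  have b x : rsummable (fun n => nc (t n x)) /\
      rsum (fun n => nc (t n x)) <= C4 * expR (0 * `|x| - 4^-1 * x ^+ 2).
    have [s h] := b4 x; split=> //; apply: le_trans h _.
    by rewrite ler_pM2l// ler_expR; lra.
  exact: (@cmeas_csum _ _ _ mu t _ mt b (iG 0)).
have tF : tame F.
  split=> // c c0; apply: (integrable_dom _ (iG c)).
    apply: measurable_funM; first exact: measurable_nc mF.
    apply: measurableT_comp => //; apply: measurable_funB; apply: measurable_funM => //.
  move=> x; rewrite ger0_norm ?mulr_ge0 ?nc_ge0 ?expR_ge0//.
  apply: le_trans (ler_wpM2r (expR_ge0 _) (ncF _ _ _ (b4 x))) _.
  by rewrite -mulrA -expRD ler_pM2l// ler_expR; nra.
have EF z : cint mu (fun x => F x * coh z x) = cint mu (fun x => f x * coh z x).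
  pose T n x := t n x * coh z x.
  have mT n : cmeasR (T n) by apply: cmeasM => //; exact: cmeas_coh.
  pose H x := C4 * expR (- (2^-1 - 4^-1) * x ^+ 2) * (expR (nc z ^+ 2) * expR (2 * nc z * `|x| - 2^-1 * x ^+ 2)).
  have TH x : rsummable (fun n => nc (T n x)) /\ rsum (fun n => nc (T n x)) <= H x.
    have [s h] := b4 x.
    have -> : (fun n => nc (T n x)) = fun n => nc (coh z x) * nc (t n x).
      by apply/funext => n; rewrite Normc.normcM mulrC.
    split; first exact: rsummableZ.
    rewrite /rsum RintegralZl// -/(rsum _) mulrC /H.
    by apply: ler_pM => //; [apply: Rintegral_ge0 => n _; exact: nc_ge0|exact: nc_ge0|exact: nc_coh].
  have iH : mu.-integrable setT (EFin \o H).
    have -> : H = fun x => expR (nc z ^+ 2) * C4 * expR (2 * nc z * `|x| - (4^-1 + 2^-1) * x ^+ 2).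
      apply/funext => x; rewrite /H.
      have -> : 2 * nc z * `|x| - (4^-1 + 2^-1) * x ^+ 2 =
        - (2^-1 - 4^-1) * x ^+ 2 + (2 * nc z * `|x| - 2^-1 * x ^+ 2) by lra.
      by rewrite [expR (- _ * _ + _)]expRD; ring.
    by apply: integrable_scale; apply: gaussian_abs; lra.
  have [E1 _] := @cint_csum_swap _ _ _ mu T H mT TH iH.
  have [_ -> _] := bargmann z tf.
  transitivity (cint mu (fun x => csum (T ^~ x))).
    apply: eq_cint => x; rewrite /F mulrC -csumZ; last exact: csummable_le (b4 x).1 (fun n => lexx _).
    by apply: eq_csum => n; rewrite mulrC.
  rewrite E1; apply: eq_csum => n.
  have [jh _ _] := bargmann z (coh_tame z).
  (* Termwise, [hnorm n ^+ 2 * sqrt pi * 2 ^+ n = 1 / n!] turns the pairing of [t n] with [coh z]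
     into the term of index [n] in the series of [f]. *)
  transitivity (hermite_coef f n * (hnorm n)%:C * hc (coh z) n).
    rewrite -(cintZ _ (jh n)); apply: eq_cint => x.
    by rewrite /T /t hermite_funE (rmorphM _ (hnorm n)) -/(hnorm n); ring.
  rewrite hc_coh hermite_coefE// -/(hnorm n) exprMn.
  transitivity (((hnorm n) ^+ 2 * Num.sqrt pi * 2 ^+ n)%:C * hc f n * z ^+ n).
    by rewrite !rmorphM !rmorphXn /= -(natrC 2); ring.
  congr (_ * _ * _); rewrite /ifact hnorm_sqr; congr (_%:C).
  have f0 : n`!%:R != 0 :> R by rewrite pnatr_eq0 -lt0n fact_gt0.
  have t0 : 2 ^+ n != 0 :> R by rewrite expf_neq0.
  have p0 : Num.sqrt pi != 0 :> R by rewrite gt_eqF// sqrtr_gt0 pi_gt0.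
  by field; rewrite f0 t0 p0.
have tD : tame (fun x => f x - F x).
  have [_ tf'] := tf; have [_ tF'] := tF.
  split; first exact: cmeasB.
  move=> c c0.
  have iS : mu.-integrable setT (EFin \o (fun x => nc (f x) * expR (c * `|x| - 2^-1 * x ^+ 2) +
      nc (F x) * expR (c * `|x| - 2^-1 * x ^+ 2))).
    by have := integrableD measurableT (tf' c c0) (tF' c c0).
  apply: (integrable_dom _ iS).
    apply: measurable_funM; first exact: measurable_nc (cmeasB mf mF).
    apply: measurableT_comp => //; apply: measurable_funB; apply: measurable_funM => //.
  move=> x; rewrite ger0_norm ?mulr_ge0 ?nc_ge0 ?expR_ge0// -mulrDl.
  by rewrite ler_wpM2r ?expR_ge0//; exact: ncB.
have ae0 : {ae mu, forall x, f x - F x = 0}.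
  apply: coh_complete => // z.
  have jf := cintegrable_coh_tame z tf; have jF := cintegrable_coh_tame z tF.
  rewrite -[RHS](subrr (cint mu (fun x => F x * coh z x))) [X in _ - X]EF.
  rewrite -[RHS]opprB -EF subrr oppr0.
  transitivity (cint mu (fun x => f x * coh z x - F x * coh z x)).
    by apply: eq_cint => x; rewrite mulrBl.
  by rewrite (cintB jf jF) EF subrr.
move=> e e0; have [C C0 b] := bound e e0; exists C => //.
have FF := ae_filter_ringOfSetsType mu.
by apply: filterS ae0 => x /eqP; rewrite subr_eq0 => /eqP ->; exact: ncF.
Qed.

End hermite_bounds.

(** * Square integrability of the Fourier transform *)

Section plancherel.
Context {R : realType}.
Local Notation mu := (@lebesgue_measure R).
Local Notation TR := (measurableTypeR R).
Local Notation cmeasR := (@cmeas _ (measurableTypeR R) R).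
Implicit Types (f g : R -> R[i]) (a t s x y e : R).

Lemma bellC a s t : bell a s t = bell a t s.
Proof. by rewrite /bell -sqrrN opprB. Qed.

Lemma bell_le1 a s t : 0 < a -> bell a s t <= 1.
Proof. by move=> a0; rewrite -expR0 ler_expR oppr_le0; exact: mulr_ge0 (ltW a0) (sqr_ge0 _). Qed.

Lemma bell_mul_integrable a t (h : R -> R) : 0 < a -> mu.-integrable setT (EFin \o h) ->
  mu.-integrable setT (EFin \o (fun s => h s * bell a s t)).
Proof.
move=> a0 ih.
have mh : measurable_fun (setT : set TR) h by apply/measurable_EFinP; exact: measurable_int ih.
apply: (integrable_dom _ (integrable_norm ih)).
  apply: measurable_funM => //.
  exact: (measurableT_comp (measurable_bell_prod a) (pair2_measurable t)).
move=> s; rewrite normrM (ger0_norm (bell_ge0 _ _ _)) ler_piMr//; exact: bell_le1.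
Qed.

Lemma bell_convolution a (h : R -> R) : 0 < a -> mu.-integrable setT (EFin \o h) ->
  mu.-integrable setT (EFin \o (fun t => \int[mu]_s (h s * bell a s t))) /\
  \int[mu]_t (\int[mu]_s (h s * bell a s t)) = Num.sqrt (pi / a) * \int[mu]_s h s.
Proof.
move=> a0 ih.
have mh : measurable_fun (setT : set TR) h by apply/measurable_EFinP; exact: measurable_int ih.
have j : cintegrable (mu \x mu)%E (fun p => (h p.1 * bell a p.1 p.2)%:C).
  apply: (@cintegrable_prod_dom _ _ _ _ _ mu mu (fun s t => (h s * bell a s t)%:C)
    (fun s t => `|h s| * bell a s t) (fun s => Num.sqrt (pi / a) * `|h s|)).
  - apply: cmeas_real; apply: measurable_funM; last exact: measurable_bell_prod.
    exact: (measurableT_comp mh (@measurable_fst _ _ TR TR)).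
  - by move=> s t; rewrite ncR normrM (ger0_norm (bell_ge0 _ _ _)).
  - by move=> s; exact: integrable_scale (bell_integral s a0).1.
  - by move=> s; have [i e] := bell_integral s a0; rewrite RintegralZl// e mulrC.
  - by apply: integrable_scale; exact: integrable_norm ih.
have j2 := @cintegrable_fubini_G _ _ _ _ _ mu mu (fun s t => (h s * bell a s t)%:C) j.
split; first exact: (cintegrable_Re j2).
have E : \int[mu]_s \int[mu]_t (h s * bell a s t) = \int[mu]_t \int[mu]_s (h s * bell a s t).
  exact: (congr1 (@complex.Re R) (@cint_swap _ _ _ _ _ mu mu (fun s t => (h s * bell a s t)%:C) j)).
transitivity (\int[mu]_s \int[mu]_t (h s * bell a s t)); first exact: esym E.
rewrite -RintegralZl; [|exact: measurableT|exact: ih].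
apply: eq_Rintegral => s _; have [i e] := bell_integral s a0.
by rewrite (RintegralZl _ measurableT i) e mulrC.
Qed.

Section damped.
Variable f : R -> R[i].
Hypothesis jf : cintegrable mu f.
Hypothesis if2 : mu.-integrable setT (EFin \o (fun x => nc (f x) ^+ 2)).

Let g := fourierL1 f.
Let B : R := k0 * \int[mu]_t nc (f t).
Let mg : cmeasR g. Proof. exact: cmeas_fourierL1. Qed.
Let gB xi : nc (g xi) <= B. Proof. exact: nc_fourierL1. Qed.
Let B0 : 0 <= B. Proof. exact: le_trans (nc_ge0 _) (gB 0). Qed.

Let mf : cmeasR f. Proof. by case: jf. Qed.
Let inf : mu.-integrable setT (EFin \o (fun x => nc (f x))). Proof. by case: jf. Qed.

(** Two uses of the multiplication formula bound the damped integral by a double integral of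
    [nc (f t) * nc (f s)] against a Gaussian kernel of total mass one. Then
    [2 u v <= u ^+ 2 + v ^+ 2] yields a bound uniform in [e]. *)
Lemma fourierL1_damped_L2 e : 0 < e ->
  mu.-integrable setT (EFin \o (fun xi => nc (g xi) ^+ 2 * expR (- (e * xi ^+ 2)))) /\
  \int[mu]_xi (nc (g xi) ^+ 2 * expR (- (e * xi ^+ 2))) <= \int[mu]_t nc (f t) ^+ 2.
Proof.
move=> e0; pose a := (4 * e)^-1; have a0 : 0 < a by rewrite invr_gt0 mulr_gt0.
have ie : mu.-integrable setT (EFin \o (fun x : R => expR (0 * `|x| - e * x ^+ 2))) by exact: gaussian_abs.
have iI : mu.-integrable setT (EFin \o (fun xi => nc (g xi) ^+ 2 * expR (- (e * xi ^+ 2)))).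
  apply: (integrable_dom _ (integrable_scale (B ^+ 2) ie)).
    apply: measurable_funM; last exact: measurable_gaussian.
    by apply: measurable_funX; exact: measurable_nc mg.
  move=> x; rewrite (ger0_norm (mulr_ge0 (sqr_ge0 _) (expR_ge0 _))).
  rewrite mul0r add0r; apply: ler_wpM2r; first exact: expR_ge0.
  by apply: lerXn2r; rewrite ?nnegrE; [exact: nc_ge0|exact: B0|exact: gB].
split; first exact: iI.
pose phi xi : R[i] := conjc (g xi) * gauss e xi.
have mphi : cmeasR phi by apply: cmeasM; [exact: cmeas_conj|exact: cmeas_gauss].
have jphi : cintegrable mu phi.
  apply: (integrable_cintegrable mphi (integrable_scale B ie)) => x.
  rewrite Normc.normcM nc_conj ncR (ger0_norm (expR_ge0 _)) mul0r add0r.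
  by rewrite ler_wpM2r ?expR_ge0.
pose psi t xi : R[i] := gauss e xi * cexp (iunit * t%:C * xi%:C).
have jgpsi t : cintegrable mu (fun xi => g xi * psi t xi).
  have [mp _] := cintegrable_packet t e0.
  apply: (integrable_cintegrable (cmeasM mg mp) (integrable_scale B (cintegrable_packet t e0).2)) => x.
  by rewrite Normc.normcM ler_wpM2r ?nc_ge0.
pose kap : R := k0 * (k0 * Num.sqrt (pi / e)).
have kap0 : 0 <= kap by rewrite !mulr_ge0 ?(ltW k0_gt0)// sqrtr_ge0.
have nphi t : nc (fourierL1 phi t) <= kap * \int[mu]_s (nc (f s) * bell a s t).
  rewrite fourierL1E Normc.normcM ncR (ger0_norm (ltW k0_gt0)) /kap -[leRHS]mulrA.
  rewrite ler_wpM2l ?(ltW k0_gt0)//.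
  have -> : cint mu (fun xi => phi xi * cis (- (xi * t))) = conjc (cint mu (fun xi => g xi * psi t xi)).
    rewrite -(cint_conj (jgpsi t)); apply: eq_cint => xi.
    rewrite /phi /psi cisN -cexpI.
    have -> : iunit * t%:C * xi%:C = 0 +i* (xi * t) by apply: complex_eqP => /=; ring.
    have gc : conjc (gauss e xi) = gauss e xi by rewrite /gauss /= oppr0.
    have cM (z w : R[i]) : conjc (z * w) = conjc z * conjc w.
      by case: z; case: w => *; apply: complex_eqP => /=; ring.
    by rewrite (cM (g xi)) (cM (gauss e xi)) gc mulrA.
  rewrite nc_conj (fourierL1_mult jf (cintegrable_packet t e0)).
  have iQ := bell_mul_integrable t a0 inf.
  have mfb : cmeasR (fun s => f s * (k0 * Num.sqrt (pi / e) * bell a s t)%:C).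
    apply: cmeasM => //; apply: cmeas_real; apply: measurable_funM => //.
    exact: (measurableT_comp (measurable_bell_prod a) (pair2_measurable t)).
  rewrite -RintegralZl; [|exact: measurableT|exact: iQ].
  have -> : cint mu (fun s => f s * fourierL1 (psi t) s) =
      cint mu (fun s => f s * (k0 * Num.sqrt (pi / e) * bell a s t)%:C).
    by apply: eq_cint => s; rewrite fourierL1_bell_packet// bellC.
  apply: (nc_cint_le mfb (integrable_scale _ iQ)) => s.
  rewrite Normc.normcM ncR ger0_norm ?mulr_ge0 ?bell_ge0 ?sqrtr_ge0 ?(ltW k0_gt0)//.
  by rewrite mulrCA.
have E : cint mu (fun xi => g xi * phi xi) = (\int[mu]_xi (nc (g xi) ^+ 2 * expR (- (e * xi ^+ 2))))%:C.
  by rewrite -[RHS]cint_real; apply: eq_cint => xi; rewrite /phi mulrA mulc_conj -rmorphM.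
have I0 : 0 <= \int[mu]_xi (nc (g xi) ^+ 2 * expR (- (e * xi ^+ 2))).
  by apply: Rintegral_ge0 => x _; rewrite mulr_ge0 ?sqr_ge0 ?expR_ge0.
rewrite -[leLHS](ger0_norm I0) -ncR -E (fourierL1_mult jf jphi).
have [iQ eQ] := bell_convolution a0 if2.
pose S : R := Num.sqrt (pi / a).
(* The normalisation of the kernel: [k0 ^+ 2 = (2 * pi)^-1], and the product of the two roots is
   [2 * pi] because [a = (4 * e)^-1]. *)
have kS : kap * S = 1.
  have k2 : k0 * k0 = (2 * pi)^-1 :> R.
    have p0 : 0 <= 2 * pi :> R by rewrite mulr_ge0// pi_ge0.
    by rewrite /k0 powRN powR12_sqrt// -invfM -expr2 sqr_sqrtr.
  rewrite /kap /S mulrA k2 -mulrA -sqrtrM ?divr_ge0 ?pi_ge0 ?(ltW e0)//.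
  have -> : pi / e * (pi / a) = (2 * pi) ^+ 2 by rewrite /a; field; rewrite gt_eqF.
  by rewrite sqrtr_sqr ger0_norm ?mulVf ?mulr_ge0 ?pi_ge0// gt_eqF// mulr_gt0// pi_gt0.
pose H t := kap * (2^-1 * (S * nc (f t) ^+ 2 + \int[mu]_s (nc (f s) ^+ 2 * bell a s t))).
have iSf : mu.-integrable setT (EFin \o (fun t => S * nc (f t) ^+ 2)) by exact: integrable_scale.
have iSQ : mu.-integrable setT (EFin \o (fun t => S * nc (f t) ^+ 2 + \int[mu]_s (nc (f s) ^+ 2 * bell a s t))).
  by have := integrableD measurableT iSf iQ.
have iH : mu.-integrable setT (EFin \o H) by do 2 apply: integrable_scale.
have fH t : nc (f t * fourierL1 phi t) <= H t.
  rewrite Normc.normcM; apply: le_trans (ler_wpM2l (nc_ge0 _) (nphi t)) _.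
  rewrite mulrCA /H ler_wpM2l//.
  have ib1 := bell_mul_integrable t a0 inf; have ib2 := bell_mul_integrable t a0 if2.
  have [ib eb] := bell_integral t a0.
  have ib' : mu.-integrable setT (EFin \o (fun s => nc (f t) ^+ 2 * bell a s t)).
    by under eq_fun do rewrite bellC; exact: integrable_scale.
  have -> : S * nc (f t) ^+ 2 = \int[mu]_s (nc (f t) ^+ 2 * bell a s t).
    rewrite mulrC /S -eb -RintegralZl; [|exact: measurableT|exact: ib].
    by apply: eq_Rintegral => s _; rewrite bellC.
  rewrite -RintegralZl; [|exact: measurableT|exact: ib1].
  rewrite -RintegralD; [|exact: measurableT|exact: ib'|exact: ib2].
  have isum : mu.-integrable setT (EFin \o (fun s => nc (f t) ^+ 2 * bell a s t + nc (f s) ^+ 2 * bell a s t)).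
    by have := integrableD measurableT ib' ib2.
  rewrite -RintegralZl; [|exact: measurableT|exact: isum].
  apply: le_Rintegral.
  - exact: measurableT.
  - exact: integrable_scale ib1.
  - exact: integrable_scale isum.
  move=> s _; have := sqr_ge0 (nc (f t) - nc (f s)); have := bell_ge0 a s t.
  move: (nc (f t)) (nc (f s)) (bell a s t) => u v b b0; rewrite sqrrB mulr2n => h.
  by have := mulr_ge0 b0 h; lra.
have mFL : cmeasR (fun t => f t * fourierL1 phi t).
  by apply: cmeasM => //; exact: cmeas_fourierL1.
apply: le_trans (nc_cint_le mFL iH fH) _.
rewrite /H RintegralZl; [|exact: measurableT|by apply: integrable_scale].
rewrite RintegralZl; [|exact: measurableT|exact: iSQ].
rewrite RintegralD; [|exact: measurableT|exact: iSf|exact: iQ].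
rewrite eQ RintegralZl; [|exact: measurableT|exact: if2].
rewrite -/S; set I := \int[mu]_t _.
have -> : kap * (2^-1 * (S * I + S * I)) = kap * S * I by lra.
by rewrite kS mul1r.
Qed.

(** Monotone convergence as the damping [n.+1%:R^-1] tends to 0. *)
Lemma fourierL1_L2 : cLfun 2%:E g.
Proof.
apply/cLfun2P; split; first exact: mg.
pose M : R := \int[mu]_t nc (f t) ^+ 2.
pose h (n : nat) xi : \bar R := (nc (g xi) ^+ 2 * expR (- (n.+1%:R^-1 * xi ^+ 2)))%:E.
have mh n : measurable_fun (setT : set TR) (h n).
  apply/measurable_EFinP; apply: measurable_funM; last exact: measurable_gaussian.
  by apply: measurable_funX; exact: measurable_nc mg.
have h0 n xi : setT xi -> (0 <= h n xi)%E.
  by move=> _; rewrite lee_fin mulr_ge0 ?sqr_ge0 ?expR_ge0.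
have nd xi : setT xi -> nondecreasing_seq (h ^~ xi).
  move=> _ m n mn; rewrite lee_fin ler_wpM2l ?sqr_ge0// ler_expR lerN2 ler_wpM2r ?sqr_ge0//.
  by rewrite lef_pV2 ?posrE// ler_nat ltnS.
have lim xi : limn (h ^~ xi) = (nc (g xi) ^+ 2)%:E.
  apply/cvg_lim => //; apply: cvg_EFin; first by near=> n.
  rewrite (_ : fine \o h ^~ xi = fun n => nc (g xi) ^+ 2 * expR (- (n.+1%:R^-1 * xi ^+ 2))); last exact/funext.
  rewrite -[X in _ --> X]mulr1; apply: cvgM; first exact: cvg_cst.
  apply: (@cvg_harmonic_le _ _ _ (xi ^+ 2)) => n.
  rewrite distrC ger0_norm; last by rewrite subr_ge0 -expR0 ler_expR oppr_le0 mulr_ge0 ?sqr_ge0.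
  rewrite [leRHS]mulrC lerBlDl -lerBlDr; exact: expR_ge1Dx.
have mc := monotone_convergence mu (measurableT) mh h0 nd.
apply/integrableP; split.
  by apply/measurable_EFinP; apply: measurable_funX; exact: measurable_nc mg.
rewrite (_ : (\int[mu]_x _ = \int[mu]_x limn (h ^~ x))%E); last first.
  by apply: eq_integral => x _; rewrite lim /= ger0_norm ?sqr_ge0.
rewrite mc; apply: (@le_lt_trans _ _ M%:E); last exact: ltry.
apply: lime_le.
  apply: ereal_nondecreasing_is_cvgn => m n mn; apply: ge0_le_integral => //.
  - by move=> x _; exact: h0.
  - by move=> x _; exact: nd.
apply: nearW => n; have n0 : 0 < n.+1%:R^-1 :> R by rewrite invr_gt0.
have [i l] := fourierL1_damped_L2 n0.
by rewrite -(fineK (integrable_fin_num measurableT i)) lee_fin.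
Unshelve. all: by end_near.
Qed.

End damped.
Lemma is_fourierL2_fourierL1 f : cLfun 1%:E f -> cLfun 2%:E f -> is_fourierL2 f (fourierL1 f).
Proof.
move=> /[dup] L1 /cLfun1P jf /[dup] L2 /cLfun2P[mf if2].
split; first exact: fourierL1_L2.
have z (h : R -> R[i]) : cLnorm 2%:E (fun x => h x - h x) = 0%E.
  rewrite /cLnorm (_ : (fun x => (nc (h x - h x))%:E) = cst 0%E) ?Lnorm0//.
  by apply/funext => x; rewrite subrr nc0.
by exists (fun=> f); split => //; rewrite z; exact: cvg_cst.
Qed.

End plancherel.

(** * From Gaussian bounds to Hermite coefficients *)

Section even_odd_sums.
Context {R : realType}.
Implicit Types (u : nat -> R) (a : nat -> R[i]).

Lemma rsummable_even u : (forall k, 0 <= u k) -> rsummable u -> rsummable (fun k => u k.*2).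
Proof.
move=> u0 su.
have le n : series (fun k => u k.*2) n <= series u n.*2.
  elim: n => [|n IH]; first by rewrite /series /= !big_geq.
  rewrite doubleS !seriesSr; rewrite -addrA; apply: lerD IH _.
  by rewrite lerDl.
have nd : nondecreasing_seq (series (fun k => u k.*2)).
  by apply/nondecreasing_seqP => n; rewrite seriesSr lerDl.
have ndu : nondecreasing_seq (series u) by apply/nondecreasing_seqP => n; rewrite seriesSr lerDl.
have ub : has_ubound (range (series (fun k => u k.*2))).
  exists (rsum u) => _ [n _ <-]; apply: le_trans (le n) _.
  have cu := rsum_cvg su.
  rewrite -(cvg_lim (@Rhausdorff R) cu); apply: nondecreasing_cvgn_le => //.
  by apply/cvg_ex; exists (rsum u).
have := nondecreasing_cvgn nd ub => c.
exact: (ge0_rsummable (fun k => u0 k.*2) c).1.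
Qed.

Lemma rsum_even u : rsummable u -> (forall k, u k.*2.+1 = 0) ->
  rsummable (fun k => u k.*2) -> rsum u = rsum (fun k => u k.*2).
Proof.
move=> su u0 se; apply/esym/(rsumE se).
have -> : series (fun k => u k.*2) = series u \o double.
  apply/funext; elim=> [|n IH]; first by rewrite /series /= !big_geq.
  by rewrite /= doubleS !seriesSr u0 addr0 IH.
apply: cvg_comp (rsum_cvg su) => P [N _ HP]; exists N => // n /= Nn; apply: HP => /=.
by rewrite (leq_trans Nn)// -addnn leq_addr.
Qed.

Lemma csum_even a : csummable a -> (forall k, a k.*2.+1 = 0) ->
  csummable (fun k => a k.*2) /\ csum a = csum (fun k => a k.*2).
Proof.
move=> sa a0.
have sn := rsummable_even (fun k => nc_ge0 (a k)) (csummable_nc sa).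
have se : csummable (fun k => a k.*2) by apply: csummable_le sn _ => k.
split=> //; apply: complex_eqP.
- apply: (rsum_even (cintegrable_Re sa) _ (cintegrable_Re se)) => k.
  by rewrite a0.
- apply: (rsum_even (cintegrable_Im sa) _ (cintegrable_Im se)) => k.
  by rewrite a0.
Qed.

Lemma csum_odd a : csummable a -> (forall k, a k.*2 = 0) ->
  csummable (fun k => a k.*2.+1) /\ csum a = csum (fun k => a k.*2.+1).
Proof.
move=> sa a0; have [sS ->] := csum_peel sa.
rewrite (a0 0%N) add0r; apply: csum_even sS _ => k.
by rewrite -doubleS a0.
Qed.

End even_odd_sums.

Section iterated_integral.
Context d1 d2 (T1 : measurableType d1) (T2 : measurableType d2) {R : realType}.
Variable m1 : {sigma_finite_measure set T1 -> \bar R}.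
Variable m2 : {sigma_finite_measure set T2 -> \bar R}.

Lemma Rintegral_prod (F : T1 * T2 -> R) : (m1 \x m2)%E.-integrable setT (EFin \o F) ->
  \int[(m1 \x m2)%E]_p F p = \int[m1]_x \int[m2]_y F (x, y).
Proof.
move=> iF; rewrite /Rintegral -(integral12_prod_meas1 iF); congr fine.
apply/esym; apply: ae_eq_integral => //.
- apply/measurable_EFinP; apply: measurableT_comp => //.
  exact: (measurable_fubini_F iF).
- exact: (measurable_fubini_F iF).
- have := ae_integrable1 iF.
  by apply: filterS => x h _; rewrite fineK//; exact: integrable_fin_num.
Qed.

Lemma cint_prod (F : T1 * T2 -> R[i]) : cintegrable (m1 \x m2)%E F ->
  cint (m1 \x m2)%E F = cint m1 (fun x => cint m2 (fun y => F (x, y))).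
Proof.
move=> jF; congr (_ +i* _)%C.
- exact: (Rintegral_prod (cintegrable_Re jF)).
- exact: (Rintegral_prod (cintegrable_Im jF)).
Qed.

End iterated_integral.

Section ae_domination.
Context d (T : measurableType d) {R : realType}.
Variable mu : {measure set T -> \bar R}.

Lemma integrable_ae_dom (h h' : T -> R) : measurable_fun setT h ->
  mu.-integrable setT (EFin \o h') -> {ae mu, forall x, `|h x| <= h' x} ->
  mu.-integrable setT (EFin \o h).
Proof.
move=> mh ih hh; apply/integrableP; split; first exact/measurable_EFinP.
have mh' := measurable_int mu ih.
have /integrableP[_ foo] := ih; apply: le_lt_trans foo.
apply: ae_ge0_le_integral => //.
- by apply/measurable_EFinP; apply: measurableT_comp.
- by apply: measurableT_comp.
by apply: filterS hh => x hx _; rewrite /= lee_fin; apply: le_trans hx _; exact: ler_norm.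
Qed.

End ae_domination.

(** * Gaussian means of the Bargmann transform *)

Section bargmann_gaussian_means.
Context {R : realType}.
Local Notation mu := (@lebesgue_measure R).
Local Notation TR := (measurableTypeR R).
Local Notation cmeasR := (@cmeas _ (measurableTypeR R) R).
Implicit Types (x y r s t b : R) (n k j : nat).
Variable f : R -> R[i].
Hypothesis Lf : cLfun 2%:E f.

Let mf : cmeasR f. Proof. by have /cLfun2P[] := Lf. Qed.
Let tf : tame f. Proof. exact: tame_L2. Qed.

Lemma L2_gauss_integrable b : 0 < b ->
  mu.-integrable setT (EFin \o (fun x => nc (f x) * expR (- (b * x ^+ 2)))).
Proof.
move=> b0; have /cLfun2P[_ if2] := Lf.
have ig := gaussian_abs 0 (mulr_gt0 (ltr0n R 2) b0).
have iS : mu.-integrable setT (EFin \o (fun x => nc (f x) ^+ 2 + expR (0 * `|x| - 2 * b * x ^+ 2))).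
  by have := integrableD measurableT if2 ig.
apply: (integrable_dom _ iS).
  by apply: measurable_funM; [exact: measurable_nc mf|exact: measurable_gaussian].
move=> x; rewrite (ger0_norm (mulr_ge0 (nc_ge0 _) (expR_ge0 _))).
have -> : expR (0 * `|x| - 2 * b * x ^+ 2) = expR (- (b * x ^+ 2)) ^+ 2.
  by rewrite -expRM_natl; congr expR; lra.
have := sqr_ge0 (nc (f x) - expR (- (b * x ^+ 2))).
have := nc_ge0 (f x); have := expR_ge0 (- (b * x ^+ 2)).
move: (nc (f x)) (expR _) => u v; rewrite !expr2 => *; nra.
Qed.

Let a n : R[i] := ifact n * hc f n.

(** With [u = |x|], the inequality [2 u r <= u ^+ 2 / 4 + 4 r ^+ 2] turns the exponent
    [2 u r + r ^+ 2 - u ^+ 2 / 2] into [5 r ^+ 2] and a Gaussian of parameter [4^-1], against which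
    [f] is integrable. *)
Lemma hc_growth : exists2 K : R, 0 <= K &
  forall n r, 0 <= r -> nc (a n) * r ^+ n <= K * expR (5 * r ^+ 2).
Proof.
have i4 : 0 < 4^-1 :> R by [].
have iK := L2_gauss_integrable i4.
exists (\int[mu]_x (nc (f x) * expR (- (4^-1 * x ^+ 2)))).
  by apply: Rintegral_ge0 => x _; exact: mulr_ge0 (nc_ge0 _) (expR_ge0 _).
move=> n r r0; have [jh _ _] := bargmann 0 tf.
have -> : nc (a n) * r ^+ n = nc (cint mu (fun x => (n`!%:R^-1 * r ^+ n)%:C * (f x * (herm n x * expR (- (2^-1 * x ^+ 2)))%:C))).
  rewrite (cintZ _ (jh n)) /a /ifact [RHS]Normc.normcM [nc (_%:C * hc f n)]Normc.normcM !ncR.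
  by rewrite normrM (ger0_norm (exprn_ge0 _ r0)) -/(hc f n); ring.
rewrite [leRHS]mulrC -RintegralZl; [|exact: measurableT|exact: iK].
have [mz _] := cintegrableZ (n`!%:R^-1 * r ^+ n)%:C (jh n).
apply: (nc_cint_le mz (integrable_scale _ iK)) => x.
have h := herm_gf_dom x n r0.
rewrite Normc.normcM [nc (f x * _)]Normc.normcM !ncR mulrCA [leRHS]mulrCA ler_wpM2l ?nc_ge0//.
have q0 : 0 <= n`!%:R^-1 * r ^+ n by rewrite mulr_ge0 ?exprn_ge0.
rewrite [`|herm n x * _|]normrM (ger0_norm (expR_ge0 _)) (ger0_norm q0) mulrA.
apply: (@le_trans _ _ (expR (2 * `|x| * r + r ^+ 2) * expR (- (2^-1 * x ^+ 2)))).
  rewrite ler_wpM2r ?expR_ge0//; apply: le_trans h.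
  by rewrite le_eqVlt; apply/orP; left; apply/eqP; ring.
rewrite -!expRD ler_expR -[x ^+ 2]real_normK ?num_real//.
have := sqr_ge0 (2^-1 * `|x| - 2 * r); move: `|x| => u; rewrite !expr2 => *; nra.
Qed.

(** [hc_growth] at radius [2 * t] leaves a geometric series of ratio [2^-1], and [5 * (2 * t) ^+ 2]
    is [20 * t ^+ 2]. *)
Lemma hc_sum_growth : exists2 K : R, 0 <= K & forall t, 0 <= t ->
  rsummable (fun n => nc (a n) * t ^+ n) /\
  rsum (fun n => nc (a n) * t ^+ n) <= K * expR (20 * t ^+ 2).
Proof.
have [K K0 hK] := hc_growth; exists (K * (1 - 2^-1)^-1).
  by rewrite mulr_ge0// invr_ge0; lra.
move=> t t0; have [h0 h1] : 0 <= 2^-1 :> R /\ 2^-1 < 1 :> R by split; lra.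
have [sq eq] := rsum_geom h0 h1.
have le n : nc (a n) * t ^+ n <= K * expR (20 * t ^+ 2) * 2^-1 ^+ n.
  have t2 : 0 <= 2 * t by rewrite mulr_ge0.
  have := hK n _ t2; rewrite exprMn => h.
  have p2 : 0 < 2 ^+ n :> R by rewrite exprn_gt0.
  rewrite exprVn ler_pdivlMr// -mulrA [t ^+ n * _]mulrC.
  by have -> : 20 * t ^+ 2 = 5 * (2 * t) ^+ 2 by ring.
have st : rsummable (fun n => nc (a n) * t ^+ n).
  apply: rsummable_le (rsummableZ _ sq) _ => n.
  by rewrite (ger0_norm (mulr_ge0 (nc_ge0 _) (exprn_ge0 _ t0))); exact: le.
split=> //; apply: le_trans (le_rsum st (rsummableZ _ sq) le) _.
by rewrite /rsum RintegralZl// -/(rsum _) eq mulrAC.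
Qed.

Definition bargmann_mean j s : R[i] :=
  cint mu (fun y => gauss 1 y * y%:C ^+ j * cint mu (fun x => f x * coh (s * y)%:C x)).

Definition moment j : R[i] := cint mu (fun y => gauss 1 y * y%:C ^+ j).

Let pow_le j y : (j < 2)%N -> `|y| ^+ j <= expR `|y|.
Proof.
have := expR_ge1Dx `|y|; have := normr_ge0 y.
by case: j => [|[|//]] h1 h2 _; rewrite ?expr0 ?expr1; apply: le_trans h2; lra.
Qed.

Let cmeas_gpow j : cmeasR (fun y => gauss 1 y * y%:C ^+ j).
Proof. by apply: cmeasM; [exact: cmeas_gauss|exact: cmeas_polyX]. Qed.

Let nc_gpow j y : nc (gauss 1 y * y%:C ^+ j) = expR (- (1 * y ^+ 2)) * `|y| ^+ j.
Proof. by rewrite Normc.normcM ncX !ncR (ger0_norm (expR_ge0 _)). Qed.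

(** The threshold [40^-1] makes [20 * s ^+ 2 * y ^+ 2] at most half of [y ^+ 2], so that the weight
    [expR (- y ^+ 2)] dominates the growth given by [hc_sum_growth]. *)
Lemma bargmann_mean_series j s : (j < 2)%N -> 0 < s -> s ^+ 2 <= 40^-1 ->
  bargmann_mean j s = csum (fun n => a n * s%:C ^+ n * moment (n + j)) /\
  csummable (fun n => a n * s%:C ^+ n * moment (n + j)).
Proof.
move=> j2 s0 s40; have [K K0 hK] := hc_sum_growth.
pose T n y : R[i] := a n * s%:C ^+ n * (gauss 1 y * y%:C ^+ (n + j)).
have mT n : cmeasR (T n) by apply: cmeasM; [exact: cmeas_cst|exact: cmeas_gpow].
pose H y : R := K * expR (1 * `|y| - 2^-1 * y ^+ 2).
have iH : mu.-integrable setT (EFin \o H) by apply: integrable_scale; exact: gaussian_abs.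
have ET n y : nc (T n y) = expR (- (1 * y ^+ 2)) * `|y| ^+ j * (nc (a n) * (s * `|y|) ^+ n).
  rewrite /T Normc.normcM nc_gpow [nc (a n * _)]Normc.normcM ncX ncR (gtr0_norm s0) exprMn exprD.
  by ring.
have TH y : rsummable (fun n => nc (T n y)) /\ rsum (fun n => nc (T n y)) <= H y.
  have [sk ek] := hK (s * `|y|) (mulr_ge0 (ltW s0) (normr_ge0 y)).
  rewrite (_ : (fun n => nc (T n y)) = fun n => expR (- (1 * y ^+ 2)) * `|y| ^+ j * (nc (a n) * (s * `|y|) ^+ n)); last first.
    by apply/funext => n; exact: ET.
  split; first exact: rsummableZ.
  rewrite /rsum RintegralZl// -/(rsum _).
  apply: le_trans (ler_wpM2l _ ek) _; first by rewrite mulr_ge0 ?expR_ge0 ?exprn_ge0.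
  rewrite /H mulrCA ler_wpM2l//.
  apply: (@le_trans _ _ (expR (- (1 * y ^+ 2)) * expR `|y| * expR (20 * (s * `|y|) ^+ 2))).
    by rewrite ler_wpM2r ?expR_ge0// ler_wpM2l ?expR_ge0//; exact: pow_le.
  rewrite -!expRD ler_expR exprMn real_normK ?num_real//.
  have := sqr_ge0 y; move: (y ^+ 2) (s ^+ 2) s40 => u v; move: `|y| => w *; nra.
have [E sT] := @cint_csum_swap _ _ _ mu T H mT TH iH.
have jg n : cintegrable mu (fun y => gauss 1 y * y%:C ^+ n).
  apply: cintegrable_moment; first exact: cmeas_gauss.
  by move=> r _; exact: integrable_gauss_exp.
have eT n : cint mu (T n) = a n * s%:C ^+ n * moment (n + j) by rewrite (cintZ _ (jg _)).
split; last by move: sT; rewrite (_ : (fun n => cint mu (T n)) = fun n => a n * s%:C ^+ n * moment (n + j))//; exact/funext.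
rewrite -(eq_csum eT) -E; apply: eq_cint => y.
have [_ -> sa] := bargmann (s * y)%:C tf.
rewrite /ps -csumZ; last exact: psok_csummable (sa _ (nc_ge0 _)) (lexx _).
apply: eq_csum => n; rewrite /T -/(a n) (rmorphM _ s) exprMn exprD; ring.
Qed.

(* What is left of [bargmann_mean] after completing the square and integrating in [y]. *)
Definition residual j s : R[i] :=
  cint mu (fun x => f x * (x ^+ j * expR ((s ^+ 2 / (1 + s ^+ 2) - 2^-1) * x ^+ 2))%:C).

(** With the [y] integral innermost the integrand is Gaussian in [y]; its parameter is [1 + s ^+ 2]
    because [coh (s * y)] contributes [exp (- (s * y) ^+ 2)]. *)
Lemma bargmann_mean_fubini j s : (j < 2)%N -> 0 < s -> s ^+ 2 <= 40^-1 ->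
  bargmann_mean j s = cint mu (fun x => f x * (expR (- (2^-1 * x ^+ 2)))%:C *
    cint mu (fun y => gauss (1 + s ^+ 2) y * y%:C ^+ j * cexp ((2 * x * s)%:C * y%:C))).
Proof.
move=> j2 s0 s40.
pose F y x : R[i] := gauss 1 y * y%:C ^+ j * (f x * coh (s * y)%:C x).
have i4 : 0 < 4^-1 :> R by [].
have iK := L2_gauss_integrable i4; set K := \int[mu]_x (nc (f x) * expR (- (4^-1 * x ^+ 2))).
have jF : cintegrable (mu \x mu)%E (fun p => F p.1 p.2).
  apply: (@cintegrable_prod_dom _ _ _ _ _ mu mu F
    (fun y x => expR (1 * `|y| - 2^-1 * y ^+ 2) * (nc (f x) * expR (- (4^-1 * x ^+ 2))))
    (fun y => K * expR (1 * `|y| - 2^-1 * y ^+ 2))).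
  - apply: cmeasM; first exact: (@cmeas_fst _ _ TR TR R _ (cmeas_gpow j)).
    apply: cmeasM; first exact: (@cmeas_snd _ _ TR TR R _ mf).
    have m1 : measurable_fun setT (fun p : TR * TR => p.1) by exact: measurable_fst.
    have m2 : measurable_fun setT (fun p : TR * TR => p.2) by exact: measurable_snd.
    apply: cmeasM.
      apply: cmeas_cexp; apply: cmeasB.
        by apply: cmeasM; apply: cmeas_real; apply: measurable_funM.
      by apply: cmeasX; apply: cmeas_real; apply: measurable_funM.
    apply: cmeas_real; exact: (measurableT_comp (measurable_gaussian 2^-1) m2).
  - move=> y x; rewrite Normc.normcM nc_gpow [nc (f x * _)]Normc.normcM mulrCA [leRHS]mulrCA.
    rewrite ler_wpM2l ?nc_ge0// /coh Normc.normcM nc_cexp ncR (ger0_norm (expR_ge0 _)).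
    apply: (@le_trans _ _ (expR (- (1 * y ^+ 2)) * expR `|y| *
        (expR (cRe ((2 * x)%:C * (s * y)%:C - (s * y)%:C ^+ 2)) * expR (- (2^-1 * x ^+ 2))))).
      by rewrite ler_wpM2r ?mulr_ge0 ?expR_ge0// ler_wpM2l ?expR_ge0//; exact: pow_le.
    rewrite -!expRD ler_expR -rmorphXn -rmorphM -rmorphB /= exprMn.
    have h1 : 2 * x * (s * y) <= 4^-1 * x ^+ 2 + 4 * (s ^+ 2 * y ^+ 2).
      by have := sqr_ge0 (2^-1 * x - 2 * (s * y)); rewrite !expr2 => *; nra.
    have h2 : s ^+ 2 * y ^+ 2 <= 40^-1 * y ^+ 2 by rewrite ler_wpM2r ?sqr_ge0.
    by move: h1 h2; have := sqr_ge0 y; move: (s ^+ 2 * y ^+ 2) (y ^+ 2) (x ^+ 2) (2 * x * (s * y)) `|y| => *; lra.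
  - by move=> y; exact: integrable_scale.
  - by move=> y; rewrite RintegralZl; [rewrite mulrC|exact: measurableT|exact: iK].
  - by apply: integrable_scale; exact: gaussian_abs.
have sw := @cint_swap _ _ _ _ _ mu mu F jF.
transitivity (cint mu (fun y => cint mu (F y))).
  apply: eq_cint => y; rewrite -cintZ; last exact: cintegrable_coh_tame.
  by [].
rewrite sw; apply: eq_cint => x.
have a0 : 0 < 1 + s ^+ 2 by rewrite ltr_wpDr ?sqr_ge0.
have jy : cintegrable mu (fun y => gauss (1 + s ^+ 2) y * y%:C ^+ j * cexp ((2 * x * s)%:C * y%:C)).
  apply: (integrable_cintegrable _ (gaussian_abs (1 + nc (2 * x * s)%:C) a0)).
    apply: cmeasM; last exact: cmeas_cexp_lin.
    by apply: cmeasM; [exact: cmeas_gauss|exact: cmeas_polyX].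
  move=> y; rewrite Normc.normcM nc_cexp Normc.normcM ncX !ncR (ger0_norm (expR_ge0 _)).
  apply: (@le_trans _ _ (expR (- ((1 + s ^+ 2) * y ^+ 2)) * expR `|y| * expR (cRe ((2 * x * s)%:C * y%:C)))).
    apply: ler_wpM2r; first exact: expR_ge0.
    by apply: ler_wpM2l; [exact: expR_ge0|exact: pow_le].
  rewrite -!expRD ler_expR mulrDl mul1r.
  have : cRe ((2 * x * s)%:C * y%:C) <= `|2 * x * s| * `|y|.
    by rewrite -normrM -rmorphM /= ler_norm.
  by lra.
rewrite -(cintZ _ jy); apply: eq_cint => y.
rewrite /F /coh cexpD; set c := cexp (_ * y%:C).
have -> : cexp ((2 * x)%:C * (s * y)%:C) = c by rewrite /c -!rmorphM; congr cexp; congr (_%:C); ring.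
have -> : cexp (- (s * y)%:C ^+ 2) = (expR (- ((s * y) ^+ 2)))%:C by rewrite -rmorphXn -rmorphN cexpR.
have -> : gauss (1 + s ^+ 2) y = gauss 1 y * (expR (- ((s * y) ^+ 2)))%:C :> R[i].
  by rewrite /gauss -rmorphM -expRD; congr (expR _)%:C; ring.
by move: c (gauss _ _) (_%:C) (_%:C) => c g u v; ring.
Qed.

Let expo_le s x : s ^+ 2 <= 40^-1 ->
  1 * `|x| + (s ^+ 2 / (1 + s ^+ 2) - 2^-1) * x ^+ 2 <= 2 - 4^-1 * x ^+ 2.
Proof.
move=> s40; have s20 := sqr_ge0 s.
have h : s ^+ 2 / (1 + s ^+ 2) <= 40^-1.
  by rewrite ler_pdivrMr ?ltr_wpDr//; move: (s ^+ 2) s40 s20 => *; lra.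
have h2 : (s ^+ 2 / (1 + s ^+ 2) - 2^-1) * x ^+ 2 <= (40^-1 - 2^-1) * x ^+ 2.
  by rewrite ler_wpM2r ?sqr_ge0// lerB.
have := sqr_ge0 (`|x| - 40 / 18); move: h2; rewrite -[x ^+ 2]real_normK ?num_real//.
by move: (s ^+ 2 / _) `|x| => *; nra.
Qed.

Lemma residual_integrable j s : (j < 2)%N -> s ^+ 2 <= 40^-1 ->
  cintegrable mu (fun x => f x * (x ^+ j * expR ((s ^+ 2 / (1 + s ^+ 2) - 2^-1) * x ^+ 2))%:C).
Proof.
move=> j2 s40; have i4 : 0 < 4^-1 :> R by [].
apply: (integrable_cintegrable _ (integrable_scale (expR 2) (L2_gauss_integrable i4))).
  apply: cmeasM => //; apply: cmeas_real; apply: measurable_funM; first exact: measurable_funX.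
  by apply: measurableT_comp => //; apply: measurable_funM.
move=> x; rewrite Normc.normcM ncR normrM normrX (ger0_norm (expR_ge0 _)) [leRHS]mulrCA.
apply: ler_wpM2l; first exact: nc_ge0.
apply: (@le_trans _ _ (expR `|x| * expR ((s ^+ 2 / (1 + s ^+ 2) - 2^-1) * x ^+ 2))).
  by apply: ler_wpM2r; [exact: expR_ge0|exact: pow_le].
by rewrite -!expRD ler_expR; have := expo_le x s40; rewrite mul1r.
Qed.

Let gauss_shift s x c : (f x * (expR (- (2^-1 * x ^+ 2)))%:C) *
    (c * cexp ((2 * x * s)%:C ^+ 2 * ((4 * (1 + s ^+ 2))^-1)%:C)) =
  c * (f x * (expR ((s ^+ 2 / (1 + s ^+ 2) - 2^-1) * x ^+ 2))%:C).
Proof.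
have a0 : 1 + s ^+ 2 != 0 by rewrite gt_eqF// ltr_wpDr ?sqr_ge0.
rewrite -rmorphXn -rmorphM cexpR.
have -> : expR ((s ^+ 2 / (1 + s ^+ 2) - 2^-1) * x ^+ 2) =
    expR (- (2^-1 * x ^+ 2)) * expR ((2 * x * s) ^+ 2 * (4 * (1 + s ^+ 2))^-1).
  by rewrite -expRD; congr expR; field.
by rewrite [in RHS]rmorphM /=; ring.
Qed.

Lemma bargmann_mean0 s : 0 < s -> s ^+ 2 <= 40^-1 ->
  bargmann_mean 0 s = (Num.sqrt (pi / (1 + s ^+ 2)))%:C * residual 0 s.
Proof.
move=> s0 s40; rewrite (bargmann_mean_fubini (ltn0Sn 1) s0 s40).
have a0 : 0 < 1 + s ^+ 2 by rewrite ltr_wpDr ?sqr_ge0.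
rewrite /residual -(cintZ _ (residual_integrable (ltn0Sn 1) s40)); apply: eq_cint => x.
rewrite expr0 mul1r -gauss_shift; congr (_ * _).
rewrite -(gaussian_integral a0); apply: eq_cint => y.
by rewrite expr0 mulr1.
Qed.

Lemma bargmann_mean1 s : 0 < s -> s ^+ 2 <= 40^-1 ->
  bargmann_mean 1 s = (s / (1 + s ^+ 2) * Num.sqrt (pi / (1 + s ^+ 2)))%:C * residual 1 s.
Proof.
move=> s0 s40; rewrite (bargmann_mean_fubini (ltnSn 1) s0 s40).
have a0 : 0 < 1 + s ^+ 2 by rewrite ltr_wpDr ?sqr_ge0.
rewrite /residual -(cintZ _ (residual_integrable (ltnSn 1) s40)); apply: eq_cint => x.
transitivity ((s / (1 + s ^+ 2) * Num.sqrt (pi / (1 + s ^+ 2)) * x)%:C *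
    (f x * (expR ((s ^+ 2 / (1 + s ^+ 2) - 2^-1) * x ^+ 2))%:C)); last first.
  by rewrite expr1 [(_ * x)%:C]rmorphM [(x * _)%:C]rmorphM /=; ring.
rewrite -gauss_shift; congr (_ * _).
transitivity (cint mu (fun y => gauss (1 + s ^+ 2) y * y%:C * cexp ((2 * x * s)%:C * y%:C))).
  by apply: eq_cint => y; rewrite expr1.
rewrite (gaussian_first_moment a0) mulrA -rmorphM; congr (_%:C * _).
by field; rewrite gt_eqF.
Qed.

End bargmann_gaussian_means.

Section product_sigma_finite.
Context d1 d2 (T1 : measurableType d1) (T2 : measurableType d2) {R : realType}.
Variable m1 : {sigma_finite_measure set T1 -> \bar R}.
Variable m2 : {sigma_finite_measure set T2 -> \bar R}.

Lemma sigma_finite_prod : sigma_finite setT (m1 \x m2)%E.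
Proof.
have [F FT Foo] := sigma_finiteT m1; have [G GT Goo] := sigma_finiteT m2.
pose i (n : nat) : nat * nat := odflt (0%N, 0%N) (unpickle n).
exists (fun n => F (i n).1 `*` G (i n).2).
  apply/esym/seteqP; split=> // -[x y] _.
  have [k _ Fx] : (\bigcup_k F k) x by rewrite -FT.
  have [l _ Gy] : (\bigcup_k G k) y by rewrite -GT.
  by exists (pickle (k, l)) => //; rewrite /i pickleK.
move=> n; have [mF fF] := Foo (i n).1; have [mG fG] := Goo (i n).2.
split; first exact: measurableX.
by rewrite product_measure1E// lte_mul_pinfty// ge0_fin_numE.
Qed.

(* Unification does not find the library's sigma-finite structure on [m1 \x m2]. *)
Definition sigma_finite_product : {sigma_finite_measure set (T1 * T2)%type -> \bar R} :=
  HB.pack_for {sigma_finite_measure set (T1 * T2)%type -> \bar R} (m1 \x m2)%E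
    (Measure_isSigmaFinite.Build _ _ _ (m1 \x m2)%E sigma_finite_prod).

End product_sigma_finite.

(** * Even and odd coefficients as Taylor coefficients of exponential families *)

Section link.
Context {R : realType}.
Local Notation mu := (@lebesgue_measure R).
Local Notation TR := (measurableTypeR R).
Local Notation cmeasR := (@cmeas _ (measurableTypeR R) R).
Implicit Types (x y r s t l : R) (n k j : nat).
Variable f : R -> R[i].
Hypothesis Lf : cLfun 2%:E f.
Hypothesis gb : forall e, 0 < e -> gaussian_bound e f.

Let mf : cmeasR f. Proof. by have /cLfun2P[] := Lf. Qed.

(** The Gaussian means contain a square root of [w = (1 + s ^+ 2)^-1]. The second coordinate,
    integrated against [exp (- w y ^+ 2)], supplies it, and the product is an instance of
    [exp_family]. *)
Definition plane : {sigma_finite_measure set (TR * TR)%type -> \bar R} := sigma_finite_product mu mu.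

(* The factor [p.2 ^+ k] provides the power of [w] needed to make [exp_family] a
   power series in [s ^+ 2] for each parity of the coefficients. *)
Definition weighted j k (p : TR * TR) : R[i] :=
  f p.1 * (p.1 ^+ j * expR (2^-1 * p.1 ^+ 2))%:C * (p.2 ^+ k)%:C.

Definition radius2 (p : TR * TR) : R := p.1 ^+ 2 + p.2 ^+ 2.

Let mfst : measurable_fun setT (fun p : TR * TR => p.1). Proof. exact: measurable_fst. Qed.
Let msnd : measurable_fun setT (fun p : TR * TR => p.2). Proof. exact: measurable_snd. Qed.

Lemma cmeas_weighted j k : cmeas (weighted j k).
Proof.
apply: cmeasM.
  apply: cmeasM; first exact: (@cmeas_fst _ _ TR TR R _ mf).
  apply: cmeas_real; apply: measurable_funM; first exact: measurable_funX.
  by apply: measurableT_comp => //; apply: measurable_funM => //; exact: measurable_funX.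
by apply: cmeas_real; exact: measurable_funX.
Qed.

Lemma measurable_radius2 : measurable_fun setT radius2.
Proof. by apply: measurable_funD; exact: measurable_funX. Qed.

Lemma radius2_ge0 p : 0 <= radius2 p.
Proof. by rewrite addr_ge0 ?sqr_ge0. Qed.

Let gpow l j x := expR (- (l * x ^+ 2)) * `|x| ^+ j.

Let gpow_integrable l j : 0 < l -> mu.-integrable setT (EFin \o gpow l j).
Proof.
move=> l0; have ig r (_ : 0 <= r) := @integrable_gauss_exp R _ l0 r.
have [_] := cintegrable_moment (cmeas_gauss l) ig j.
rewrite (_ : (fun x => _) = EFin \o gpow l j)//; apply/funext => x /=.
by rewrite Normc.normcM ncX !ncR (ger0_norm (expR_ge0 _)).
Qed.

(** Here arbitrarily small [lambda] are used: the bound on [f] at [l / 2] leaves the factor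
    [expR (- (l / 2 * x ^+ 2))]. *)
Let left_integrable l j : 0 < l ->
  mu.-integrable setT (EFin \o (fun x => nc (f x) * (`|x| ^+ j * expR ((2^-1 - l) * x ^+ 2)))).
Proof.
move=> l0; have l20 : 0 < l / 2 by rewrite divr_gt0.
have [C C0 hC] := gb l20.
apply: (integrable_ae_dom _ (integrable_scale C (gpow_integrable j l20))).
  apply: measurable_funM; first exact: measurable_nc mf.
  apply: measurable_funM; first by apply: measurable_funX; exact: normr_measurable.
  by apply: measurableT_comp => //; apply: measurable_funM.
have FF := ae_filter_ringOfSetsType mu.
apply: filterS hC => x hx.
have e0 : 0 <= `|x| ^+ j * expR ((2^-1 - l) * x ^+ 2) by rewrite mulr_ge0 ?exprn_ge0 ?expR_ge0.
rewrite (ger0_norm (mulr_ge0 (nc_ge0 _) e0)); apply: le_trans (ler_wpM2r e0 hx) _.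
rewrite -mulrA ler_wpM2l ?(ltW C0)// /gpow mulrCA -expRD mulrC le_eqVlt; apply/orP; left; apply/eqP.
by congr (expR _ * _); lra.
Qed.

Lemma weighted_integrable j k l : 0 < l ->
  (mu \x mu)%E.-integrable setT (EFin \o (fun p => nc (weighted j k p) * expR (- (l * radius2 p)))).
Proof.
move=> l0.
pose u x := nc (f x) * (`|x| ^+ j * expR ((2^-1 - l) * x ^+ 2)).
have iu : mu.-integrable setT (EFin \o u) by exact: left_integrable.
have iv := gpow_integrable k l0.
have E x y : nc (weighted j k (x, y)) * expR (- (l * radius2 (x, y))) = u x * gpow l k y.
  rewrite /weighted /radius2 /u /gpow Normc.normcM [nc (f x * _)]Normc.normcM !ncR normrM !normrX.
  rewrite (ger0_norm (expR_ge0 _)).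
  have -> : - (l * (x ^+ 2 + y ^+ 2)) = - (l * x ^+ 2) + - (l * y ^+ 2) by ring.
  have -> : (2^-1 - l) * x ^+ 2 = 2^-1 * x ^+ 2 + - (l * x ^+ 2) by ring.
  rewrite [expR (- (l * x ^+ 2) + _)]expRD [expR (2^-1 * _ + _)]expRD.
  move: (expR _) (expR _) (expR _) (`|x| ^+ j) (`|y| ^+ k) (nc _) => a b c d e g; ring.
have j' : cintegrable (mu \x mu)%E (fun p => (nc (weighted j k (p.1, p.2)) * expR (- (l * radius2 (p.1, p.2))))%:C).
  apply: (@cintegrable_prod_dom _ _ _ _ _ mu mu
    (fun x y => (nc (weighted j k (x, y)) * expR (- (l * radius2 (x, y))))%:C)
    (fun x y => u x * gpow l k y) (fun x => (\int[mu]_y gpow l k y) * u x)).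
  - apply: cmeas_real; apply: measurable_funM.
      by rewrite (_ : (fun p => _) = fun p => nc (weighted j k p)); [exact: measurable_nc (cmeas_weighted j k)|apply/funext; case].
    rewrite (_ : (fun p => _) = fun p => expR (- (l * radius2 p))); last by apply/funext; case.
    apply: measurableT_comp => //; apply: measurable_funN; apply: measurable_funM => //.
    exact: measurable_radius2.
  - move=> x y; rewrite E ncR ger0_norm// mulr_ge0 ?mulr_ge0 ?nc_ge0 ?expR_ge0 ?exprn_ge0//.
  - by move=> x; exact: integrable_scale.
  - by move=> x; rewrite RintegralZl; [rewrite mulrC|exact: measurableT|exact: iv].
  - exact: integrable_scale.
have := cintegrable_Re j'; congr (integrable _ _ _); apply/funext; by case.
Qed.

Lemma weighted_left_analytic j k : left_analytic (exp_family plane (weighted j k) radius2).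
Proof.
apply: left_analytic_exp_family.
- exact: cmeas_weighted.
- exact: measurable_radius2.
- exact: radius2_ge0.
- by move=> l; exact: weighted_integrable.
Qed.

Lemma exp_family_weighted j k s : (j < 2)%N -> 0 < s -> s ^+ 2 <= 40^-1 ->
  exp_family plane (weighted j k) radius2 (- (s ^+ 2)%:C) =
  ((1 + s ^+ 2)^-1 ^+ 2)%:C * residual f j s *
  cint mu (fun y => gauss (1 + s ^+ 2)^-1 y * y%:C ^+ k).
Proof.
move=> j2 s0 s40; set a := 1 + s ^+ 2.
have a0 : 0 < a by rewrite /a ltr_wpDr ?sqr_ge0.
have w0 : 0 < a^-1 by rewrite invr_gt0.
have zE : (1 - - (s ^+ 2)%:C)^-1 = a^-1%:C.
  by rewrite opprK -[1](rmorph1 (real_complex R)) -rmorphD -fmorphV.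
rewrite /exp_family zE.
pose F (p : TR * TR) : R[i] := weighted j k p * (a^-1%:C ^+ 2 * cexp (- ((radius2 p)%:C * a^-1%:C))).
have jF : cintegrable plane F.
  apply: (integrable_cintegrable _ (integrable_scale (a^-1 ^+ 2) (weighted_integrable j k w0))).
    apply: cmeasM; first exact: cmeas_weighted.
    apply: cmeasM; first exact: cmeas_cst.
    apply: cmeas_cexp; apply: cmeasN; apply: cmeasM; last exact: cmeas_cst.
    by apply: cmeas_real; exact: measurable_radius2.
  move=> p; rewrite /F Normc.normcM [nc (_ * cexp _)]Normc.normcM ncX ncR nc_cexp (gtr0_norm w0).
  rewrite -rmorphM -rmorphN /= mulrCA [radius2 p * _]mulrC; exact: lexx.
have iw r (_ : 0 <= r) := @integrable_gauss_exp R _ w0 r.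
have jy := cintegrable_moment (cmeas_gauss a^-1) iw k.
set M := cint mu (fun y => gauss a^-1 y * y%:C ^+ k).
transitivity (cint mu (fun x => cint mu (fun y => F (x, y)))); first exact: cint_prod jF.
transitivity (cint mu (fun x => (a^-1 ^+ 2)%:C * M *
    (f x * (x ^+ j * expR ((s ^+ 2 / a - 2^-1) * x ^+ 2))%:C))); last first.
  by rewrite (cintZ _ (residual_integrable Lf j2 s40)) /residual mulrAC.
apply: eq_cint => x.
transitivity ((a^-1 ^+ 2)%:C * (f x * (x ^+ j * expR ((s ^+ 2 / a - 2^-1) * x ^+ 2))%:C) * M); last by rewrite mulrAC.
rewrite -(cintZ _ jy); apply: eq_cint => y.
rewrite /F /weighted /radius2 /gauss /= -rmorphM -rmorphN cexpR.
(* [s ^+ 2 / a] equals [1 - a^-1], where [a^-1] plays the role of [w]. *)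
have -> : expR ((s ^+ 2 / a - 2^-1) * x ^+ 2) = expR (2^-1 * x ^+ 2) * expR (- (a^-1 * x ^+ 2)).
  by rewrite -expRD; congr expR; rewrite /a; field; rewrite gt_eqF.
have -> : expR (- ((x ^+ 2 + y ^+ 2) * a^-1)) = expR (- (a^-1 * x ^+ 2)) * expR (- (a^-1 * y ^+ 2)).
  by rewrite -expRD; congr expR; ring.
rewrite -!rmorphXn; move: (expR _) (expR _) (expR _) (a^-1 ^+ 2) (x ^+ j) (y ^+ k) => u v w c d e.
by rewrite !rmorphM /=; ring.
Qed.

Lemma sqrt_pi_mul (a : R) : 0 < a -> Num.sqrt (pi / a^-1) = a * Num.sqrt (pi / a).
Proof.
move=> a0; rewrite -{2}(ger0_norm (ltW a0)) -sqrtr_sqr -sqrtrM ?sqr_ge0//.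
by congr Num.sqrt; field; rewrite gt_eqF.
Qed.

Lemma exp_family_even s : 0 < s -> s ^+ 2 <= 40^-1 ->
  exp_family plane (weighted 0 2) radius2 (- (s ^+ 2)%:C) = 2^-1%:C * bargmann_mean f 0 s.
Proof.
move=> s0 s40; have a0 : 0 < 1 + s ^+ 2 by rewrite ltr_wpDr ?sqr_ge0.
have w0 : 0 < (1 + s ^+ 2)^-1 by rewrite invr_gt0.
rewrite exp_family_weighted// bargmann_mean0// gaussian_second_moment//.
rewrite sqrt_pi_mul// mulrAC -rmorphM [RHS]mulrA -[in RHS]rmorphM; congr (_%:C * _).
by field; rewrite gt_eqF.
Qed.

Lemma exp_family_odd s : 0 < s -> s ^+ 2 <= 40^-1 ->
  s%:C * exp_family plane (weighted 1 0) radius2 (- (s ^+ 2)%:C) = bargmann_mean f 1 s.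
Proof.
move=> s0 s40; have a0 : 0 < 1 + s ^+ 2 by rewrite ltr_wpDr ?sqr_ge0.
have w0 : 0 < (1 + s ^+ 2)^-1 by rewrite invr_gt0.
rewrite exp_family_weighted// bargmann_mean1// gaussian_moment0//.
rewrite sqrt_pi_mul// [_ * residual _ _ _ * _]mulrAC -rmorphM mulrA -[in LHS]rmorphM; congr (_%:C * _).
by field; rewrite gt_eqF.
Qed.

(** Half the Gaussian moment of order [2k] divided by [(2k)!], see [moment_even]. The half matches
    the one in [exp_family_even]; for the odd coefficients [moment_even_shift] yields the same
    number, so one weight serves both parities. *)
Definition wgt k : R := Num.sqrt pi / (2 * (4 ^+ k * k`!%:R)).

Lemma moment_even k : ifact k.*2 * moment k.*2 = (2 * wgt k)%:C :> R[i].
Proof.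
suff -> : moment k.*2 = (2 * wgt k * (k.*2)`!%:R)%:C.
  rewrite /ifact -rmorphM; congr (_%:C).
  by field; rewrite pnatr_eq0 -lt0n fact_gt0.
elim: k => [|k IH].
  rewrite /moment gaussian_moment0// divr1; congr (_%:C).
  by rewrite /wgt double0 expr0 fact0; field.
rewrite /moment doubleS gaussian_momentSS// -/(moment k.*2) IH -rmorphM; congr (_%:C).
rewrite /wgt !factS exprS !natrM.
have -> : k.*2.+2%:R = 2 * k.+1%:R :> R by rewrite -doubleS -mul2n natrM.
have f0 : k`!%:R != 0 :> R by rewrite pnatr_eq0 -lt0n fact_gt0.
have k0 : 1 + k%:R != 0 :> R by rewrite addrC natr1 pnatr_eq0.
have p0 : 4 ^+ k != 0 :> R by rewrite expf_neq0.
by field; rewrite f0 k0 p0.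
Qed.

Lemma moment_odd k : moment k.*2.+1 = 0 :> R[i].
Proof.
elim: k => [|k IH]; first by rewrite /moment double0 gaussian_moment1.
by rewrite /moment doubleS gaussian_momentSS// -/(moment k.*2.+1) IH mulr0.
Qed.

Lemma moment_even_shift k : ifact k.*2.+1 * moment k.*2.+2 = (wgt k)%:C :> R[i].
Proof.
have -> : moment k.*2.+2 = (k.*2.+1%:R / (2 * 1))%:C * moment k.*2 :> R[i] by rewrite /moment gaussian_momentSS.
have -> : wgt k = 2^-1 * (2 * wgt k) by field.
rewrite [(2^-1 * _)%:C]rmorphM /= -moment_even mulrCA [RHS]mulrA mulrCA mulrA; congr (_ * _).
rewrite /ifact -!rmorphM; congr (_%:C); rewrite factS natrM.
have f0 : (k.*2)`!%:R != 0 :> R by rewrite pnatr_eq0 -lt0n fact_gt0.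
have n0 : 1 + k.*2%:R != 0 :> R by rewrite addrC natr1 pnatr_eq0.
by field; rewrite f0 n0.
Qed.

Lemma link_even : exists A, [/\ left_analytic A,
  psok (fun k => hc f k.*2 * (wgt k)%:C) 40^-1 &
  forall x, 0 < x -> x <= 40^-1 -> A (- x%:C) = ps (fun k => hc f k.*2 * (wgt k)%:C) x%:C].
Proof.
exists (exp_family plane (weighted 0 2) radius2).
have main x : 0 < x -> x <= 40^-1 ->
    csummable (fun k => hc f k.*2 * (wgt k)%:C * x%:C ^+ k) /\
    exp_family plane (weighted 0 2) radius2 (- x%:C) = ps (fun k => hc f k.*2 * (wgt k)%:C) x%:C.
  (* The series variable is [x = s ^+ 2]; the odd orders drop out because the odd Gaussian moments
     vanish. *)
  move=> x0 x40; pose s := Num.sqrt x.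
  have s0 : 0 < s by rewrite sqrtr_gt0.
  have s2 : s ^+ 2 = x by rewrite sqr_sqrtr// ltW.
  have s40 : s ^+ 2 <= 40^-1 by rewrite s2.
  have [E sm] := bargmann_mean_series Lf (ltn0Sn 1) s0 s40.
  have odd0 k : ifact k.*2.+1 * hc f k.*2.+1 * s%:C ^+ k.*2.+1 * moment (k.*2.+1 + 0) = 0.
    by rewrite addn0 moment_odd mulr0.
  have [se ee] := csum_even sm odd0.
  have tE k : ifact k.*2 * hc f k.*2 * s%:C ^+ k.*2 * moment (k.*2 + 0) =
      2 * (hc f k.*2 * (wgt k)%:C * x%:C ^+ k).
    rewrite addn0 -mul2n exprM -rmorphXn s2 mul2n.
    transitivity (ifact k.*2 * moment k.*2 * (hc f k.*2 * x%:C ^+ k)); first by ring.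
    by rewrite moment_even rmorphM /= -(natrC 2); ring.
  have c2 : 2 != 0 :> R[i] by rewrite pnatr_eq0.
  have sx : csummable (fun k => hc f k.*2 * (wgt k)%:C * x%:C ^+ k).
    have := csummableZ 2^-1 se; congr cintegrable; apply/funext => k.
    by rewrite tE mulKf.
  split; first exact: sx.
  rewrite -s2 (exp_family_even s0 s40) E ee (eq_csum tE) (csumZ _ sx) s2 mulrA.
  by rewrite fmorphV /= -(natrC 2) (mulVf c2) mul1r.
split; first exact: weighted_left_analytic.
- have i40 : 0 < 40^-1 :> R by [].
  have [sm _] := main _ i40 (lexx _).
  rewrite /psok; under eq_fun do rewrite -[40^-1](gtr0_norm i40) -ncR -ncX -Normc.normcM.
  exact: csummable_nc.
- by move=> x x0 x40; have [_ ->] := main x x0 x40.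
Qed.

Lemma link_odd : exists A, [/\ left_analytic A,
  psok (fun k => hc f k.*2.+1 * (wgt k)%:C) 40^-1 &
  forall x, 0 < x -> x <= 40^-1 -> A (- x%:C) = ps (fun k => hc f k.*2.+1 * (wgt k)%:C) x%:C].
Proof.
exists (exp_family plane (weighted 1 0) radius2).
have main x : 0 < x -> x <= 40^-1 ->
    csummable (fun k => hc f k.*2.+1 * (wgt k)%:C * x%:C ^+ k) /\
    exp_family plane (weighted 1 0) radius2 (- x%:C) = ps (fun k => hc f k.*2.+1 * (wgt k)%:C) x%:C.
  move=> x0 x40; pose s := Num.sqrt x.
  have s0 : 0 < s by rewrite sqrtr_gt0.
  have s2 : s ^+ 2 = x by rewrite sqr_sqrtr// ltW.
  have s40 : s ^+ 2 <= 40^-1 by rewrite s2.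
  have [E sm] := bargmann_mean_series Lf (ltnSn 1) s0 s40.
  (* The factor [y] in the mean exchanges the parities: the even orders vanish, and the surviving
     ones share a factor [s], which is cancelled. *)
  have even0 k : ifact k.*2 * hc f k.*2 * s%:C ^+ k.*2 * moment (k.*2 + 1) = 0.
    by rewrite addn1 moment_odd mulr0.
  have [so eo] := csum_odd sm even0.
  have sn0 : s%:C != 0 :> R[i] by rewrite -nc_eq0 ncR normr_eq0 gt_eqF.
  have tE k : ifact k.*2.+1 * hc f k.*2.+1 * s%:C ^+ k.*2.+1 * moment (k.*2.+1 + 1) =
      s%:C * (hc f k.*2.+1 * (wgt k)%:C * x%:C ^+ k).
    rewrite addn1 exprS -mul2n exprM -[s%:C ^+ 2]rmorphXn s2 mul2n -moment_even_shift; ring.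
  have sx : csummable (fun k => hc f k.*2.+1 * (wgt k)%:C * x%:C ^+ k).
    have := csummableZ s%:C^-1 so; congr cintegrable; apply/funext => k.
    by rewrite tE mulKf.
  split; first exact: sx.
  by apply: (mulfI sn0); rewrite -{1}s2 (exp_family_odd s0 s40) E eo (eq_csum tE) (csumZ _ sx).
split; first exact: weighted_left_analytic.
- have i40 : 0 < 40^-1 :> R by [].
  have [sm _] := main _ i40 (lexx _).
  rewrite /psok; under eq_fun do rewrite -[40^-1](gtr0_norm i40) -ncR -ncX -Normc.normcM.
  exact: csummable_nc.
- by move=> x x0 x40; have [_ ->] := main x x0 x40.
Qed.

End link.

(** * Decay of the Hermite coefficients and the equivalence *)

Section main.
Context {R : realType}.
Local Notation mu := (@lebesgue_measure R).
Local Notation cmeasR := (@cmeas _ (measurableTypeR R) R).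
Implicit Types (f g : R -> R[i]) (n k : nat) (r : R).

Lemma fact_sqr_le k n : (k.*2 <= n)%N -> (k`! * k`! <= n`!)%N.
Proof.
move=> kn; have k2 : (k <= k.*2)%N by rewrite -addnn leq_addr.
apply: (@leq_trans (k.*2)`!); last first.
  by elim: n kn => [|n IH]; [rewrite leqn0 => /eqP ->|rewrite leq_eqVlt => /orP[/eqP ->//|/IH h];
    rewrite factS (leq_trans h)// leq_pmull].
have := bin_fact k2; rewrite -{2}addnn addnK => <-.
by rewrite leq_pmull// bin_gt0.
Qed.

(** [k! ^ 2 <= n!] compares [1 / sqrt (n!)] with [1 / k!]. The exponential loss [4 ^+ k] is
    harmless, since the weighted series are entire. *)
Lemma hnorm_le_wgt n k : (k.*2 <= n)%N -> hnorm n <= 2 * 4 ^+ k * wgt k :> R.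
Proof.
move=> kn; have f0 : 0 < k`!%:R :> R by rewrite ltr0n fact_gt0.
have p4 : 0 < 4 ^+ k :> R by rewrite exprn_gt0.
have pi1 : 1 <= pi :> R by have := @pi_ge2 R; lra.
have sp1 : 1 <= Num.sqrt pi :> R by have := ler_wsqrtr pi1; rewrite sqrtr1.
have sp0 : 0 < Num.sqrt pi :> R by rewrite sqrtr_gt0 pi_gt0.
have -> : 2 * 4 ^+ k * wgt k = Num.sqrt pi / k`!%:R :> R.
  by rewrite /wgt; field; rewrite !gt_eqF.
have N0 : 0 <= hnorm n :> R by exact/ltW/herm_norm_gt0.
rewrite -(@ler_pXn2r _ 2)// ?nnegrE ?divr_ge0 ?(ltW sp0) ?(ltW f0)//.
rewrite hnorm_sqr expr_div_n; apply: ler_pM.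
- by rewrite invr_ge0 ltW.
- by rewrite invr_ge0 mulr_ge0 ?exprn_ge0.
- by apply: (@le_trans _ _ 1); [rewrite invf_le1|rewrite exprn_ege1].
- rewrite lef_pV2 ?posrE ?mulr_gt0 ?exprn_gt0 ?ltr0n ?fact_gt0//.
  apply: (@le_trans _ _ n`!%:R); first by rewrite expr2 -natrM ler_nat fact_sqr_le.
  by rewrite ler_peMl// exprn_ege1// ler1n.
Qed.

Lemma coef_decay f : tame f ->
  (forall rho, exists C, forall k, nc (hc f k.*2 * (wgt k)%:C) * rho ^+ k <= C) ->
  (forall rho, exists C, forall k, nc (hc f k.*2.+1 * (wgt k)%:C) * rho ^+ k <= C) ->
  forall r, 0 < r -> exists2 C, 0 < C & forall n, nc (hermite_coef f n) <= C * expR (- r * n%:R).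
Proof.
(* The 4 absorbs the loss in [hnorm_le_wgt]; [expR (2 * r * k)] reaches [expR (r * n)] up to a
   factor [expR r] because [n <= 2k + 1]. *)
move=> tf he ho r r0; pose rho := 4 * expR (2 * r).
have w0 k : 0 < wgt k :> R.
  by rewrite divr_gt0 ?sqrtr_gt0 ?pi_gt0// !mulr_gt0 ?exprn_gt0// ltr0n fact_gt0.
have step n k C : (k.*2 <= n <= k.*2.+1)%N -> nc (hc f n * (wgt k)%:C) * rho ^+ k <= C ->
    nc (hermite_coef f n) <= 2 * C * expR r * expR (- r * n%:R).
  move=> /andP[kn nk] h; rewrite hermite_coefE// -/(hnorm n) Normc.normcM ncR.
  rewrite (gtr0_norm (herm_norm_gt0 n)).
  have h1 : hnorm n * nc (hc f n) <= 2 * 4 ^+ k * (nc (hc f n * (wgt k)%:C)).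
    rewrite Normc.normcM ncR (gtr0_norm (w0 k)) [nc _ * wgt k]mulrC mulrA.
    by rewrite ler_wpM2r ?nc_ge0//; exact: hnorm_le_wgt.
  apply: le_trans h1 _.
  have E1 : rho ^+ k = 4 ^+ k * expR (2 * r * k%:R) by rewrite /rho exprMn -expRM_natl mulrC [k%:R * _]mulrC mulrC.
  have C0 : 0 <= C by apply: le_trans h; rewrite mulr_ge0 ?nc_ge0 ?exprn_ge0// mulr_ge0 ?expR_ge0.
  apply: (@le_trans _ _ (2 * C * expR (- (2 * r * k%:R)))).
    rewrite expRN -mulrA -[leRHS]mulrA ler_wpM2l// ler_pdivlMr ?expR_gt0//.
    by apply: le_trans h; rewrite E1 le_eqVlt; apply/orP; left; apply/eqP; ring.
  rewrite -[leRHS]mulrA -expRD ler_wpM2l ?mulr_ge0// ler_expR.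
  have : n%:R <= 2 * k%:R + 1 :> R by rewrite -natrM natr1 ler_nat mul2n.
  by move: n%:R k%:R => u v h2; have := mulr_ge0 (ltW r0) (_ : 0 <= 2 * v + 1 - u); rewrite subr_ge0 => /(_ h2); lra.
have [C1 h1] := he rho; have [C2 h2] := ho rho.
have C10 : 0 <= C1 by apply: le_trans (h1 0%N); rewrite expr0 mulr1 nc_ge0.
have C20 : 0 <= C2 by apply: le_trans (h2 0%N); rewrite expr0 mulr1 nc_ge0.
exists (2 * (C1 + C2 + 1) * expR r); first by rewrite !mulr_gt0 ?expR_gt0// ltr_wpDl// addr_ge0.
move=> n; have [k [->|->]] : exists k, n = k.*2 \/ n = k.*2.+1.
- exists n./2; have E := odd_double_half n.
  by case: (odd n) E => E; [right|left]; exact: esym E.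
- apply: le_trans (step _ k C1 _ (h1 k)) _; first by rewrite leqnn leqnSn.
  by rewrite !ler_wpM2r ?expR_ge0// ler_wpM2l//; lra.
- apply: le_trans (step _ k C2 _ (h2 k)) _; first by rewrite leqnSn leqnn.
  by rewrite !ler_wpM2r ?expR_ge0// ler_wpM2l//; lra.
Qed.

(** A Gaussian bound puts [f] in L^1, where [fourierL1 f] is a transform by
    [is_fourierL2_fourierL1]; a solution exists, so the value selected by [fourier] is one too. *)
Lemma fourier_spec f : cLfun 2%:E f -> (forall e, 0 < e -> gaussian_bound e f) ->
  is_fourierL2 f (fourier f).
Proof.
move=> Lf gb; have /cLfun2P[mf _] := Lf.
have e4 : 0 < 4^-1 :> R by [].
have [C C0 hC] := gb _ e4.
have jf : cintegrable mu f.
  split=> //; apply: (integrable_ae_dom _ (integrable_scale C (gaussian_abs 0 e4))).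
    exact: measurable_nc mf.
  have FF := ae_filter_ringOfSetsType mu.
  apply: filterS hC => x hx; rewrite (ger0_norm (nc_ge0 _)); apply: le_trans hx _.
  by rewrite ler_pM2l// ler_expR; lra.
have Ff := is_fourierL2_fourierL1 ((cLfun1P f).2 jf) Lf.
by apply: (@xgetPex _ (fun=> 0) [set g | is_fourierL2 f g]); exists (fourierL1 f).
Qed.

Lemma scale_L2 (c : R[i]) g : cLfun 2%:E g -> cLfun 2%:E (fun x => c * g x).
Proof.
move=> /cLfun2P[mg ig]; apply/cLfun2P; split; first by apply: cmeasM => //; exact: cmeas_cst.
rewrite (_ : (fun x => nc (c * g x) ^+ 2) = fun x => nc c ^+ 2 * nc (g x) ^+ 2).
  exact: integrable_scale.
by apply/funext => x; rewrite Normc.normcM exprMn.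
Qed.

Lemma hc_scale (c : R[i]) g n : tame g -> hc (fun x => c * g x) n = c * hc g n.
Proof.
move=> tg; have [jh _ _] := bargmann 0 tg.
by rewrite -(cintZ _ (jh n)); apply: eq_cint => x; rewrite mulrA.
Qed.

Lemma expIk k : (- iunit) ^+ k.*2 = (-1) ^+ k :> R[i].
Proof. by rewrite -mul2n exprM expr2 mulrNN iunit2. Qed.

End main.

Theorem theorem1p1 (R : realType) (f : R -> R[i]) (hf : cLfun 2%:E f) :
  (forall lambda : R, 0 < lambda ->
     gaussian_bound lambda f /\ gaussian_bound lambda (fourier f))
  <->
  (forall r : R, 0 < r ->
     exists2 C : R, 0 < C &
       forall n : nat, Normc.normc (hermite_coef f n) <= C * expR (- r * n%:R)).
Proof.
have tf := tame_L2 hf.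
split=> [gb|dec].
- have gf e (e0 : 0 < e) := (gb e e0).1; have gg e (e0 : 0 < e) := (gb e e0).2.
  have Fg := fourier_spec hf gf; set g := fourier f in Fg gg.
  have Lg : cLfun 2%:E g by case: Fg.
  have tg := tame_L2 Lg.
  have r40 : 0 < 40^-1 :> R by [].
  apply: coef_decay tf _ _.
  + have [A [lA se EA]] := link_even hf gf; have [B [lB _ EB]] := link_even Lg gg.
    apply: (left_analytic_entire lA lB r40 se) => x x0 /ltW x40; first exact: EA.
    rewrite (EB _ x0 x40) -(ps_neg (fun k => hc f k.*2 * (wgt k)%:C)); apply: eq_csum => k.
    by rewrite (hc_fourier _ hf Fg) expIk !mulrA.
  + (* the odd coefficients of [g] carry an extra factor [- iunit] *)
    have Lg' := scale_L2 iunit Lg.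
    have gg' e : 0 < e -> gaussian_bound e (fun x => iunit * g x).
      move=> e0; have [C C0 h] := gg e e0; exists C => //.
      have FF := ae_filter_ringOfSetsType (@lebesgue_measure R).
      apply: filterS h => x; rewrite Normc.normcM (_ : nc iunit = 1) ?mul1r//.
      by rewrite /iunit /= expr0n add0r expr1n sqrtr1.
    have [A [lA se EA]] := link_odd hf gf; have [B [lB _ EB]] := link_odd Lg' gg'.
    apply: (left_analytic_entire lA lB r40 se) => x x0 /ltW x40; first exact: EA.
    rewrite (EB _ x0 x40) -(ps_neg (fun k => hc f k.*2.+1 * (wgt k)%:C)); apply: eq_csum => k.
    rewrite hc_scale// (hc_fourier _ hf Fg) exprS expIk.
    by rewrite mulrA [iunit * (_ * _)]mulrA mulrN iunit2 opprK mul1r !mulrA.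
- have gf := coef_decay_bound hf dec.
  (* The bound on [f] comes first, since it is what identifies [fourier f] as a transform of [f]. *)
  have Fg := fourier_spec hf gf; have Lg : cLfun 2%:E (fourier f) by case: Fg.
  move=> e e0; split; first exact: gf.
  apply: coef_decay_bound e0 => // r r0; have [C C0 h] := dec r r0.
  exists C => // n; apply: le_trans (h n).
  rewrite !hermite_coefE//; last exact: tame_L2.
  rewrite (hc_fourier _ hf Fg) mulrCA [leLHS]Normc.normcM ncX ncN.
  by rewrite (_ : nc iunit = 1) ?expr1n ?mul1r// /iunit /= expr0n add0r expr1n sqrtr1.
Qed.
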